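(* Let $n\ge 2$ and $0<s<1$. Set $$E_s(x)=\alpha(n,s)\,|x|^{-(n-2s)},\qquad \alpha(n,s)=\frac{\Gamma\left(\frac n2-s\right)}{2^{2s}\,\pi^{\frac n2}\,\Gamma(s)} .$$ Then $E_s$ is a fundamental solution for $(-\Delta)^s$; that is, $E_s\in\mathscr S'_s(\mathbb R^n)$ and for every $\varphi\in\mathscr S(\mathbb R^n)$ $$\langle E_s,(-\Delta)^s\varphi\rangle=\int_{\mathbb R^n}E_s(x)\,(-\Delta)^s\varphi(x)\,dx=\varphi(0).$$
   Context: $\mathscr S(\mathbb R^n)$ is the Schwartz space. For $\varphi\in\mathscr S(\mathbb R^n)$, $$(-\Delta)^s \varphi(x)=\frac{\gamma(n,s)}{2}\int_{\mathbb R^n}\frac{2\varphi(x)-\varphi(x+y)-\varphi(x-y)}{|y|^{n+2s}}\,dy,\qquad \gamma(n,s)=\frac{s\,2^{2s}\,\Gamma\left(\frac{n+2s}{2}\right)}{\pi^{n/2}\,\Gamma(1-s)}.$$ $\mathscr S_s(\mathbb R^n)$ is the space of all $u\in C^\infty(\mathbb R^n)$ such that for every multi-index $\alpha$, $[u]_\alpha=\sup_{x\in\mathbb R^n}(1+|x|^{n+2s})|\partial^\alpha u(x)|<\infty$, with the topology of the countable family of seminorms $[\cdot]_\alpha$; $\mathscr S'_s(\mathbb R^n)$ is its topological dual. If $\varphi\in\mathscr S(\mathbb R^n)$ then $(-\Delta)^s\varphi\in\mathscr S_s(\mathbb R^n)$. A distribution $E\in\mathscr S'_s(\mathbb R^n)$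 is called a fundamental solution of $(-\Delta)^s$ if $\langle E,(-\Delta)^s\varphi\rangle=\varphi(0)$ for every $\varphi\in\mathscr S(\mathbb R^n)$. A function is identified with the distribution it induces by integration. *)

(* Defs.v *)
From HB Require Import structures.
From mathcomp Require Import all_boot all_order all_algebra.
From mathcomp Require Import all_classical all_reals all_analysis.
From mathcomp Require Import complex.

Set Implicit Arguments.
Unset Strict Implicit.
Unset Printing Implicit Defensive.

Import Order.TTheory GRing.Theory Num.Theory.
Import numFieldNormedType.Exports.
Import ComplexField.

Local Open Scope classical_set_scope.
Local Open Scope ring_scope.
Local Open Scope complex_scope.

(* R^n is 'rV[R]_n.  Its library norm `|x| is the sup norm; it is only used
   through the topology and the derivatives it induces. *)
Definition enorm (R : realType) (n : nat) (x : 'rV[R]_n) : R :=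
  Num.sqrt (\sum_(i < n) x ord0 i ^+ 2).

Definition rV_display : measure_display.
Proof. exact: default_measure_display. Qed.

(* The product sigma-algebra of R^n, generated by the coordinate maps; it is
   also the Borel sigma-algebra. *)
Section rV_measurable.
Context (R : realType) (n : nat).

Definition rV_coord (i : 'I_n) (x : 'rV[R]_n) : measurableTypeR R := x ord0 i.

Let rV_set0 : g_sigma_preimage rV_coord set0.
Proof. exact: sigma_algebra0. Qed.

Let rV_setC A : g_sigma_preimage rV_coord A -> g_sigma_preimage rV_coord (~` A).
Proof. exact: sigma_algebraC. Qed.

Let rV_bigcup (F : (set 'rV[R]_n)^nat) :
  (forall i, g_sigma_preimage rV_coord (F i)) ->
  g_sigma_preimage rV_coord (\bigcup_i (F i)).
Proof. exact: sigma_algebra_bigcup. Qed.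

HB.instance Definition _ := @isMeasurable.Build rV_display
  'rV[R]_n (g_sigma_preimage rV_coord) rV_set0 rV_setC rV_bigcup.

End rV_measurable.

Lemma measurable_rV_coord (R : realType) (n : nat) (i : 'I_n) :
  measurable_fun [set: 'rV[R]_n] (rV_coord i).
Proof.
move=> _ Y mY; rewrite setTI; apply: sub_sigma_algebra => /=.
rewrite -bigcup_seq/=; exists i => /=; first by rewrite mem_index_enum.
by exists Y => //; rewrite setTI.
Qed.

Lemma measurable_fun_rV_coordP d (T : measurableType d) (R : realType)
    (n : nat) (f : T -> 'rV[R]_n) :
  (forall i, measurable_fun [set: T] (rV_coord i \o f)) ->
  measurable_fun [set: T] f.
Proof.
move=> mf.
suff sub : g_sigma_preimage (fun i => rV_coord i \o f) `<=` measurable.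
  rewrite g_sigma_preimage_comp in sub.
  by move=> _ A mA; apply: sub; exists A.
apply: smallest_sub; first exact: sigma_algebra_measurable.
case: n => [|n] in f mf *; first by rewrite big_ord0.
rewrite -bigcup_mkord_ord; apply: bigcup_sub => i Ii.
by move=> A [B mB <-]; exact: mf.
Qed.

Section lebesgue_rV.
Variable R : realType.

Definition rV_cons (n : nat) (p : measurableTypeR R * 'rV[R]_n) : 'rV[R]_n.+1 :=
  \row_i (if unlift ord0 i is Some j then p.2 ord0 j else p.1).

Definition rV_uncons (n : nat) (x : 'rV[R]_n.+1) : measurableTypeR R * 'rV[R]_n :=
  (x ord0 ord0, \row_j x ord0 (lift ord0 j)).

Lemma rV_consK n : cancel (@rV_cons n) (@rV_uncons n).
Proof.
case=> a v; rewrite /rV_uncons /rV_cons mxE unlift_none; congr pair.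
by apply/rowP => j; rewrite !mxE liftK.
Qed.

Lemma rV_unconsK n : cancel (@rV_uncons n) (@rV_cons n).
Proof.
move=> x; apply/rowP => i; rewrite mxE.
by case: unliftP => [j ->|->] //=; rewrite mxE.
Qed.

Lemma measurable_rV_cons n : measurable_fun [set: _] (@rV_cons n).
Proof.
apply: measurable_fun_rV_coordP => i.
case: (unliftP ord0 i) => [j ->|->].
- rewrite (_ : _ \o _ = rV_coord j \o snd); last first.
    by apply/funext => p; rewrite /= /rV_coord mxE liftK.
  by apply: measurableT_comp => //; exact: measurable_rV_coord.
- rewrite (_ : _ \o _ = fst); last first.
    by apply/funext => p; rewrite /= /rV_coord mxE unlift_none.
  exact: measurable_fst.
Qed.

Lemma measurable_rV_uncons n : measurable_fun [set: _] (@rV_uncons n).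
Proof.
apply: measurable_fun_pair; first exact: (measurable_rV_coord ord0).
apply: measurable_fun_rV_coordP => i.
rewrite (_ : _ \o _ = rV_coord (lift ord0 i)).
  exact: measurable_rV_coord.
by apply/funext => x; rewrite /= /rV_coord mxE.
Qed.

Section step.
Variables (n : nat) (m : {sigma_finite_measure set 'rV[R]_n -> \bar R}).
Local Open Scope ereal_scope.

Definition lebesgue_rV_step (A : set 'rV[R]_n.+1) : \bar R :=
  (lebesgue_measure \x m) (@rV_cons n @^-1` A).

Let step0 : lebesgue_rV_step set0 = 0.
Proof. by rewrite /lebesgue_rV_step preimage_set0 measure0. Qed.

Let step_ge0 A : 0 <= lebesgue_rV_step A.
Proof. exact: measure_ge0. Qed.

Let step_sigma_additive : semi_sigma_additive lebesgue_rV_step.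
Proof.
move=> F mF tF mUF; rewrite /lebesgue_rV_step preimage_bigcup.
have mcons B : measurable B -> measurable (@rV_cons n @^-1` B).
  by move=> mB; rewrite -[X in measurable X]setTI; exact: measurable_rV_cons.
apply: measure_semi_sigma_additive.
- by move=> k; exact: mcons.
- apply/trivIsetP => /= i j _ _ ij; rewrite -preimage_setI.
  by move/trivIsetP : tF => /(_ _ _ _ _ ij) ->//; rewrite preimage_set0.
- by rewrite -preimage_bigcup; exact: mcons.
Qed.

HB.instance Definition _ := isMeasure.Build _ _ _ lebesgue_rV_step
  step0 step_ge0 step_sigma_additive.

Let step_sigma_finite : sigma_finite setT lebesgue_rV_step.
Proof.
have /sigma_finiteP[F [FT ndF Foo]] := sigma_finiteT (@lebesgue_measure R).
have /sigma_finiteP[G [GT ndG Goo]] := sigma_finiteT m.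
exists (fun k => @rV_uncons n @^-1` (F k `*` G k)).
  rewrite -preimage_bigcup (_ : \bigcup_i _ = setT) ?preimage_setT//.
  apply/seteqP; split => // -[a v] _.
  have [i _ Fa] : (\bigcup_i F i) a by rewrite -FT.
  have [j _ Gv] : (\bigcup_i G i) v by rewrite -GT.
  exists (maxn i j) => //; split.
  - by move: a Fa; exact/subsetPset/ndF/leq_maxl.
  - by move: v Gv; exact/subsetPset/ndG/leq_maxr.
move=> k; have [mF Fk] := Foo k; have [mG Gk] := Goo k; split.
  rewrite -[X in measurable X]setTI; apply: measurable_rV_uncons => //.
  exact: measurableX.
rewrite /lebesgue_rV_step -comp_preimage (_ : _ \o _ = id); last first.
  by apply/funext => p; rewrite /= rV_consK.
rewrite (_ : id @^-1` _ = F k `*` G k)// product_measure1E//.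
by rewrite lte_mul_pinfty// ge0_fin_numE.
Qed.

HB.instance Definition _ := Measure_isSigmaFinite.Build _ _ _ lebesgue_rV_step
  step_sigma_finite.

End step.

Section point.
Local Open Scope ereal_scope.
Definition lebesgue_rV0 : set 'rV[R]_0 -> \bar R := \d_(0%R : 'rV[R]_0).

HB.instance Definition _ := Measure.on lebesgue_rV0.

Let rV0_sigma_finite : sigma_finite setT lebesgue_rV0.
Proof.
exists (fun=> setT); first by rewrite bigcup_const//; exists 0%N.
by move=> _; split=> //; rewrite /lebesgue_rV0 diracE; case: (_ \in _); rewrite ltry.
Qed.

HB.instance Definition _ := Measure_isSigmaFinite.Build _ _ _ lebesgue_rV0
  rV0_sigma_finite.
End point.

(* The n-fold product of the Lebesgue measure of R; see lebesgue_rV_box. *)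
Fixpoint lebesgue_rV (n : nat) : {sigma_finite_measure set 'rV[R]_n -> \bar R} :=
  if n is n'.+1 then lebesgue_rV_step (lebesgue_rV n') else lebesgue_rV0.

Lemma lebesgue_rV_box (n : nat) (A : 'I_n -> set R) :
  (forall i, measurable (A i : set (measurableTypeR R))) ->
  lebesgue_rV n [set x : 'rV[R]_n | forall i, A i (x ord0 i)] =
  (\prod_(i < n) lebesgue_measure (A i))%E.
Proof.
elim: n A => [|n IH] A mA.
  rewrite big_ord0 /= /lebesgue_rV0 diracE mem_set//=.
  by case.
rewrite big_ord_recl /= /lebesgue_rV_step.
have -> : @rV_cons n @^-1` [set x | forall i, A i (x ord0 i)] =
    A ord0 `*` [set x : 'rV[R]_n | forall i, A (lift ord0 i) (x ord0 i)].
  apply/seteqP; split => [[a v] /= Ax|[a v] /= [Aa Av] i]; last first.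
    by rewrite mxE; case: unliftP => [j|] ->.
  split; first by have := Ax ord0; rewrite mxE unlift_none.
  by move=> i; have := Ax (lift ord0 i); rewrite mxE liftK.
rewrite product_measure1E//; first by congr (_ * _)%E; exact: (IH (fun i => A (lift ord0 i))).
rewrite (_ : mkset _ = \bigcap_(i in [set: 'I_n]) (rV_coord i @^-1` A (lift ord0 i))).
  apply: fin_bigcap_measurable => [|i _]; first exact: finite_finset.
  rewrite -[X in measurable X]setTI.
  exact: measurable_rV_coord.
by apply/seteqP; split => x /= Ax i; [move=> _|]; exact: Ax.
Qed.

End lebesgue_rV.

Section calculus.
Context {R : realType} {n : nat}.
Implicit Types (f g : 'rV[R]_n -> R) (u v : 'rV[R]_n -> R[i]).

Definition partial (i : 'I_n) f : 'rV[R]_n -> R := 'D_(delta_mx ord0 i) f.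

Definition partials (l : seq 'I_n) f : 'rV[R]_n -> R := foldr partial f l.

(* C^oo: all partial derivatives of all orders exist and are continuous. *)
Definition smooth f : Prop := forall l : seq 'I_n,
  continuous (partials l f) /\
  forall i x, derivable (partials l f) x (delta_mx ord0 i).

Definition multiindex := {ffun 'I_n -> nat}.

(* On smooth functions the order of the derivations is irrelevant. *)
Definition mpartial (a : multiindex) f : 'rV[R]_n -> R :=
  partials (flatten [seq nseq (a i) i | i <- enum 'I_n]) f.

(* Test functions are complex valued; calculus and integration are done on the
   real and imaginary parts, as R[i] has no normed R-module structure here. *)
Definition csmooth u : Prop :=
  smooth (fun x => complex.Re (u x)) /\ smooth (fun x => complex.Im (u x)).

Definition cmpartial (a : multiindex) u (x : 'rV[R]_n) : R[i] :=
  mpartial a (fun x => complex.Re (u x)) x +i* mpartial a (fun x => complex.Im (u x)) x.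

Definition monomial (b : multiindex) (x : 'rV[R]_n) : R :=
  \prod_(i < n) x ord0 i ^+ b i.

Definition schwartz u : Prop := csmooth u /\
  forall a b : multiindex, has_ubound
    (range (fun x => `|monomial b x| * Normc.normc (cmpartial a u x))).

Lemma partials_lin f g (k : R) (l : seq 'I_n) : smooth f -> smooth g ->
  partials l (fun x => k * f x + g x) =
  (fun x => k * partials l f x + partials l g x).
Proof.
move=> sf sg; elim: l => [|i l IH]; first by [].
rewrite /= IH; apply/funext => x; rewrite /partial.
have df := (sf l).2 i x; have dg := (sg l).2 i x.
have dkf := @derivableZ _ _ _ (partials l f) k x _ df.
rewrite -[k * _]/(k *: _) -(deriveZ k df).
exact: (deriveD dkf dg).
Qed.

Lemma smooth_lin f g (k : R) : smooth f -> smooth g ->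
  smooth (fun x => k * f x + g x).
Proof.
move=> sf sg l; rewrite partials_lin//; split.
  move=> x.
  apply: (@continuousD R R^o _ (fun x => k * partials l f x)); last exact: (sg l).1.
  by apply: (@continuousM R _ (cst k)); [exact: cst_continuous|exact: (sf l).1].
move=> i x.
have dkf := @derivableZ _ _ _ (partials l f) k x _ ((sf l).2 i x).
exact: (derivableD dkf ((sg l).2 i x)).
Qed.

Lemma smooth0 : smooth (fun=> 0).
Proof.
have p0 l : partials l (fun=> 0) = fun=> 0.
  elim: l => //= i l ->; apply/funext => x.
  exact: (@derive_cst _ _ _ (0 : R^o)).
move=> l; rewrite p0; split=> [|i x]; [exact: cst_continuous|].
exact: (@derivable_cst _ _ _ (0 : R^o)).
Qed.

Lemma csmooth_lin u v (k : R[i]) : csmooth u -> csmooth v ->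
  csmooth (fun x => k * u x + v x).
Proof.
move=> [su1 su2] [sv1 sv2]; split.
- rewrite (_ : (fun x => complex.Re _) =
    (fun x => complex.Re k * complex.Re (u x) + ((- complex.Im k) * complex.Im (u x) + complex.Re (v x)))); last first.
    apply/funext => x; case: k (u x) (v x) => [a b] [c d] [e f] /=.
    by rewrite mulNr addrA.
  exact: (smooth_lin _ su1 (smooth_lin _ su2 sv1)).
- rewrite (_ : (fun x => complex.Im _) =
    (fun x => complex.Re k * complex.Im (u x) + (complex.Im k * complex.Re (u x) + complex.Im (v x)))); last first.
    apply/funext => x; case: k (u x) (v x) => [a b] [c d] [e f] /=.
    by rewrite addrA.
  exact: (smooth_lin _ su2 (smooth_lin _ su1 sv2)).
Qed.

Lemma csmooth0 : csmooth (fun=> 0).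
Proof. by split; exact: smooth0. Qed.

Lemma cmpartial_lin u v (k : R[i]) (a : multiindex) : csmooth u -> csmooth v ->
  cmpartial a (fun x => k * u x + v x) =
  (fun x => k * cmpartial a u x + cmpartial a v x).
Proof.
move=> [su1 su2] [sv1 sv2]; apply/funext => x; rewrite /cmpartial.
rewrite (_ : (fun x => complex.Re _) =
  (fun x => complex.Re k * complex.Re (u x) + ((- complex.Im k) * complex.Im (u x) + complex.Re (v x)))); last first.
  apply/funext => y; case: k (u y) (v y) => [p b] [c d] [e f] /=.
  by rewrite mulNr addrA.
rewrite (_ : (fun x => complex.Im _) =
  (fun x => complex.Re k * complex.Im (u x) + (complex.Im k * complex.Re (u x) + complex.Im (v x)))); last first.
  apply/funext => y; case: k (u y) (v y) => [p b] [c d] [e f] /=.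
  by rewrite addrA.
rewrite /mpartial (partials_lin _ _ su1 (smooth_lin _ su2 sv1)).
rewrite (partials_lin _ _ su2 (smooth_lin _ su1 sv2)).
rewrite (partials_lin _ _ su2 sv1) (partials_lin _ _ su1 sv2).
by case: k => p q; apply/eqP; rewrite eq_complex /= mulNr !addrA !eqxx.
Qed.

End calculus.
Arguments multiindex n : clear implicits.

Section Ss.
Context (R : realType) (n : nat) (s : R).

Definition Ss_weight (a : multiindex n) (u : 'rV[R]_n -> R[i]) (x : 'rV[R]_n) : R :=
  (1 + enorm x `^ (n%:R + 2 * s)) * Normc.normc (cmpartial a u x).

Definition Ss_pred : {pred 'rV[R]_n -> R[i]^o} := [pred u |
  `[< csmooth u /\ forall a, has_ubound (range (Ss_weight a u)) >]].

(* [u]_a < oo is the boundedness of the range; the supremum is Ss_seminorm. *)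
Record Ss := MkSs { Ss_fun :> 'rV[R]_n -> R[i]^o; _ : Ss_fun \in Ss_pred }.

HB.instance Definition _ := [isSub for Ss_fun].
HB.instance Definition _ := [Choice of Ss by <:].

Lemma Ss_submod_closed : submod_closed Ss_pred.
Proof.
split=> [|k u v /asboolP[su bu] /asboolP[sv bv]]; apply/asboolP.
  split; first exact: csmooth0.
  move=> a; exists 0 => _ [x _ <-].
  suff -> : Ss_weight a 0 x = 0 by [].
  have := @cmpartial_lin R n (fun=> 0) (fun=> 0) (-1) a csmooth0 csmooth0.
  rewrite (_ : (fun=> _ * _ + _) = (fun=> 0)); last first.
    by apply/funext => y; rewrite mulr0 addr0.
  move/(congr1 (fun f => f x)); rewrite mulN1r addNr => c0.
  by rewrite /Ss_weight c0 Normc.normc0 mulr0.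
split; first exact: csmooth_lin.
move=> a; have [M hM] := bu a; have [N hN] := bv a.
exists (Normc.normc k * M + N) => _ [x _ <-].
have {}hM : Ss_weight a u x <= M by apply: hM; exists x.
have {}hN : Ss_weight a v x <= N by apply: hN; exists x.
have -> : Ss_weight a (k *: u + v) x = (1 + enorm x `^ (n%:R + 2 * s)) *
    Normc.normc (k * cmpartial a u x + cmpartial a v x).
  congr (_ * Normc.normc _).
  exact: (congr1 (fun f => f x) (cmpartial_lin k a su sv)).
have k0 : 0 <= Normc.normc k by case: (k) => p q; exact: sqrtr_ge0.
apply: (le_trans _ (lerD (ler_wpM2l k0 hM) hN)).
rewrite /Ss_weight mulrCA -mulrDr ler_wpM2l ?addr_ge0 ?powR_ge0//.
rewrite -Normc.normcM; exact: le_normcD.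
Qed.

HB.instance Definition _ := GRing.isSubmodClosed.Build _ _ Ss_pred
  Ss_submod_closed.
HB.instance Definition _ := [SubChoice_isSubLmodule of Ss by <:].

Definition Ss_seminorm (a : multiindex n) (u : 'rV[R]_n -> R[i]) : R :=
  sup (range (Ss_weight a u)).

Definition Ss_balls : set (set Ss) := [set B | exists (a : multiindex n)
  (u : Ss) (e : R), 0 < e /\ B = [set v | Ss_seminorm a (v - u) < e]].

HB.instance Definition _ := isSubBaseTopological.Build Ss Ss_balls id.

Record Ss_dual := MkSs_dual {
  Ss_dual_fun :> {scalar Ss};
  Ss_dual_continuous : continuous (Ss_dual_fun : Ss -> R[i]^o) }.

End Ss.

Section integral.
Context {R : realType} {n : nat}.
Implicit Type u : 'rV[R]_n -> R[i].

Definition cintegrable u : Prop :=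
  (lebesgue_rV R n).-integrable setT (fun x => (complex.Re (u x))%:E) /\
  (lebesgue_rV R n).-integrable setT (fun x => (complex.Im (u x))%:E).

Definition cintegral u : R[i] :=
  (\int[lebesgue_rV R n]_x complex.Re (u x)) +i* (\int[lebesgue_rV R n]_x complex.Im (u x)).

End integral.

Definition Gamma (R : realType) (x : R) : R :=
  \int[lebesgue_measure]_(t in `]0, +oo[) (t `^ (x - 1) * expR (- t)).

Section fractional_laplacian.
Context {R : realType} {n : nat}.
Implicit Type s : R.

Definition gamma_ns s : R :=
  s * 2 `^ (2 * s) * Gamma ((n%:R + 2 * s) / 2) /
  (pi `^ (n%:R / 2) * Gamma (1 - s)).

(* At y = 0, a null set, the integrand is 0 by the conventions on powR and /. *)
Definition fracLap s (phi : 'rV[R]_n -> R[i]) (x : 'rV[R]_n) : R[i] :=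
  (gamma_ns s / 2)%:C * cintegral (fun y =>
    (2 * phi x - phi (x + y) - phi (x - y)) / (enorm y `^ (n%:R + 2 * s))%:C).

(* The pairing <E, fracLap s phi> presupposes that fracLap s phi belongs to S_s;
   this membership is asserted by the existence of u. *)
Definition fundamental_solution s (E : Ss_dual n s) : Prop :=
  forall phi : 'rV[R]_n -> R[i], schwartz phi ->
  exists u : Ss n s, (u : _ -> _) = fracLap s phi /\ E u = phi 0.

(* E is the distribution that f induces by integration. *)
Definition induced_by s (f : 'rV[R]_n -> R) (E : Ss_dual n s) : Prop :=
  forall u : Ss n s, cintegrable (fun x => (f x)%:C * u x) /\
    E u = cintegral (fun x => (f x)%:C * u x).

Definition alpha_ns s : R :=
  Gamma (n%:R / 2 - s) / (2 `^ (2 * s) * pi `^ (n%:R / 2) * Gamma s).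

(* The value at 0, on a null set, is 0 since 0 `^ r = 0 for r <> 0. *)
Definition E_s s (x : 'rV[R]_n) : R :=
  alpha_ns s * enorm x `^ (- (n%:R - 2 * s)).

End fractional_laplacian.

(* Main.v *)
(* Put p = n/2 - s and m = n/2 + s.  Both kernels are mixtures of Gaussians:
   Gamma(p) |x|^(-2p) is the integral of a^(p-1) exp(-a|x|^2) over a > 0, and
   likewise for |y|^(-2m).  By Fubini, Gamma(p) Gamma(m) times the integral of
   |x|^(-2p) (2 f(x) - f(x+y) - f(x-y)) |y|^(-2m) over x and y becomes an
   integral over a, b > 0, in which completing the square computes the Gaussian
   integrals.  With h(r) = f(z / sqrt r) and c = ab/(a+b) what remains is
   2 pi^(n/2) times the integral of
     exp(-|z|^2) a^(-s-1) b^(s-1) (h(a) - h(c))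
   over z, a and b.  Writing h(a) - h(c) as the integral of h'(r) over
   c <= r < a and integrating in (a, b) first gives a Beta integral that does not
   depend on r, hence a constant times h(oo) - h(0) = f(0) for every z <> 0; the
   Gamma factors cancel against those of the two normalising constants.  The
   first use of Fubini needs the decay O(|x|^(-n-2s)) of the y-integral of the
   absolute value, which also shows that (-Delta)^s f lies in S_s. *)
Require Import Defs.
From HB Require Import structures.
From mathcomp Require Import all_boot all_order all_algebra.
From mathcomp Require Import all_classical all_reals all_analysis.
From mathcomp Require Import complex.
From mathcomp Require Import measurable_realfun.
From mathcomp Require Import ring lra.

Set Implicit Arguments.
Unset Strict Implicit.
Unset Printing Implicit Defensive.

Import Order.TTheory GRing.Theory Num.Theory.
Import numFieldNormedType.Exports.

Local Open Scope classical_set_scope.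
Local Open Scope ring_scope.

(** * One-dimensional integrals and the Gamma function *)

(** Gaussian integrals, mean values and Tonelli's theorem replace Fourier transforms and polar
    coordinates. The terms f(x), f(x+y), f(x-y) are the values of f(x+ey) at e = 0, 1, -1.
    Integrated against exp(-a|x|^2 - b|y|^2), such a term leaves a Gaussian in z = x+ey of parameter
    c = ab/(b+ae^2) and the factor (pi/(b+ae^2))^(n/2). Rescaling z by sqrt c contributes c^(-n/2),
    and because (b+ae^2)c = ab the total factor pi^(n/2) (ab)^(-n/2) does not depend on e. This is
    why the three terms combine into a single increment of h, and why its weight is a^(-s-1)
    b^(s-1), for which the dimension has disappeared. The weight has infinite mass, so the increment
    cannot be separated into its two terms once a and b are integrated. Absolute convergence comes
    instead from the integral of |h'|, which is bounded uniformly in z. At the origin the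
    conventions on powers give the kernels the value 0, which the Gaussian mixtures do not
    reproduce; that null point is removed by a cut-off. *)

Section affine1.
Context {R : realType}.
Local Notation mu := (@lebesgue_measure R).
Local Open Scope ereal_scope.

Lemma measurable_affine (a c : R) :
  measurable_fun [set: measurableTypeR R]
    (fun t : measurableTypeR R => (a + c * t)%R : measurableTypeR R).
Proof. by apply: measurable_funD => //; exact: measurable_funM. Qed.

(** Both sides are measures in [A], so uniqueness of the Lebesgue measure reduces the identity to
    half-open intervals. A negative [c] exchanges the open and the closed end, which does not change
    the length. *)
Lemma lebesgue_measure_affine (a c : R) (A : set R) : c != 0%R -> measurable A ->
  mu A = `|c|%:E * pushforward mu
    ((fun t => a + c * t)%R : measurableTypeR R -> measurableTypeR R) A.
Proof.
move=> c0 mA; have nc : (0 <= `|c|)%R by [].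
pose f : {mfun measurableTypeR R >-> measurableTypeR R} :=
  HB.pack (fun t : measurableTypeR R => (a + c * t)%R : measurableTypeR R)
    (isMeasurableFun.Build _ _ _ _ _ (measurable_affine a c)).
rewrite (@lebesgue_measure_unique _ (mscale (NngNum nc) (pushforward mu f)))//.
move=> _ [[u v]] _ <-; transitivity (`|c|%:E * mu ((fun t : R => (a + c * t)%R) @^-1` `]u, v]%classic)); last by [].
have [cp|cp|cp] := ltgtP c 0%R; last by rewrite cp eqxx in c0.
- rewrite (_ : _ @^-1` _ = `[((v - a) / c)%R, ((u - a) / c)%R[%classic); last first.
    apply/seteqP; split => t /=; rewrite !in_itv/= ler_ndivrMr// ltr_ndivlMr//;
      move=> /andP[? ?]; apply/andP; split; lra.
  rewrite !lebesgue_measure_itv/= !lte_fin ltr_ndivrMr// divfK ?lt_eqF//.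
  rewrite ltrD2r; case: ifPn => _; last by rewrite mule0.
  rewrite -!EFinB -EFinM ltr0_norm//; congr EFin; field.
  by rewrite lt_eqF.
- rewrite (_ : _ @^-1` _ = `]((u - a) / c)%R, ((v - a) / c)%R]%classic); last first.
    apply/seteqP; split => t /=; rewrite !in_itv/= ler_pdivlMr// ltr_pdivrMr//;
      move=> /andP[? ?]; apply/andP; split; lra.
  rewrite !lebesgue_measure_itv/= !lte_fin ltr_pdivrMr// divfK ?gt_eqF//.
  rewrite ltrD2r; case: ifPn => _; last by rewrite mule0.
  rewrite -!EFinB -EFinM gtr0_norm//; congr EFin; field.
  by rewrite gt_eqF.
Qed.

Lemma ge0_integral_affine (a c : R) (f : R -> \bar R) : c != 0%R ->
  measurable_fun [set: R] f -> (forall t, 0 <= f t) ->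
  \int[mu]_t f t = `|c|%:E * \int[mu]_t f (a + c * t)%R.
Proof.
move=> c0 mf f0; have nc : (0 <= `|c|)%R by [].
pose g : {mfun measurableTypeR R >-> measurableTypeR R} :=
  HB.pack (fun t : measurableTypeR R => (a + c * t)%R : measurableTypeR R)
    (isMeasurableFun.Build _ _ _ _ _ (measurable_affine a c)).
rewrite [LHS](eq_measure_integral (mscale (NngNum nc) (pushforward mu g))); last first.
  by move=> A mA _; rewrite /mscale/=; exact: (lebesgue_measure_affine a).
rewrite ge0_integral_mscale//= (@ge0_integral_pushforward _ _ _ _ _ g)//.
Qed.

End affine1.

Section improper.
Context {R : realType}.
Local Notation mu := (@lebesgue_measure R).
Variables f F : R -> R.
Hypothesis dF : forall t : R, (0 < t) -> is_derive t 1 F (f t).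
Hypothesis cf : forall t : R, (0 < t) -> {for t, continuous f}.

Lemma integral_segment_derive (a b : R) : (0 < a) -> (a <= b) ->
  (\int[mu]_(t in `[a, b]) (f t)%:E = (F b - F a)%:E)%E.
Proof.
move=> a0; rewrite le_eqVlt => /predU1P[<-|ab].
  by rewrite set_itv1 integral_set1 subrr.
have pos (t : R) : t \in `[a, b]%R -> (0 < t).
  by rewrite in_itv/= => /andP[at_ _]; exact: lt_le_trans at_.
have cF (t : R) : (0 < t) -> {for t, continuous F}.
  move=> t0; apply/differentiable_continuous/derivable1_diffP.
  exact: (@ex_derive _ _ _ _ _ _ _ (dF t0)).
rewrite EFinB (@continuous_FTC2 _ f F)//.
- apply: continuous_in_subspaceT => t; rewrite inE => /pos t0; exact: cf.
- split.
  + move=> t tab; apply: (@ex_derive _ _ _ _ _ _ _ (dF _)).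
    exact/pos/subset_itv_oo_cc.
  + by apply: cvg_at_right_filter; apply: cF.
  + by apply: cvg_at_left_filter; apply: cF; exact: lt_trans ab.
- move=> t tab; rewrite derive1E.
  have t0 : (0 < t) by exact/pos/subset_itv_oo_cc.
  by have := dF t0 => dFt; rewrite derive_val.
Qed.

Let I k : set R := `[k.+1%:R^-1, k.+1%:R]%classic.

Let I_bigcup : \bigcup_k I k = `]0%R, +oo[%classic :> set R.
Proof.
apply/seteqP; split => [t [k _] | t] /=; rewrite /I/= !in_itv/= ?andbT.
  by move=> /andP[+ _]; apply: lt_le_trans; rewrite invr_gt0.
move=> t0; pose k := maxn (Num.truncn t) (Num.truncn t^-1).
exists k => //; rewrite /I /= in_itv/=; apply/andP; split.
  rewrite invf_ple ?posrE//; apply/ltW/(lt_le_trans (truncnS_gt _)).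
  by rewrite ler_nat ltnS leq_maxr.
by apply/ltW/(lt_le_trans (truncnS_gt _)); rewrite ler_nat ltnS leq_maxl.
Qed.

Let I_nd : nondecreasing_seq I.
Proof.
move=> m n mn; apply/subsetPset => t; rewrite /I /= !in_itv/= => /andP[a b].
apply/andP; split; last by rewrite (le_trans b)// ler_nat ltnS.
by rewrite (le_trans _ a)// lef_pV2 ?posrE// ler_nat ltnS.
Qed.

Let I_inv k : (k.+1%:R^-1 <= k.+1%:R :> R).
Proof. by apply: (@le_trans _ _ 1); rewrite ?invf_le1// ler1n. Qed.

Let mf : measurable_fun (`]0%R, +oo[%classic : set R) f.
Proof.
apply: open_continuous_measurable_fun => //.
move=> t; rewrite inE/= in_itv/= andbT; exact: cf.
Qed.

Let I_sub k : I k `<=` `]0%R, +oo[%classic.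
Proof. by rewrite -I_bigcup; exact: bigcup_sup. Qed.

(** Positivity makes the integrals over the segments [I k] increase to the integral over the
    half-line, so a bounded primitive suffices and no limit at 0 or at infinity has to be known. *)
Lemma integral_primitive_le (M : R) :
  (forall t : R, 0 < t -> 0 <= f t) -> (forall t : R, 0 < t -> 0 <= F t <= M) ->
  (\int[mu]_(t in `]0%R, +oo[) (f t)%:E <= M%:E)%E.
Proof.
move=> f0 FM; have mI k : measurable (I k) by exact: measurable_itv.
rewrite -I_bigcup.
have := @ge0_nondecreasing_set_cvg_integral _ (measurableTypeR R) _ I (EFin \o f) mu I_nd mI.
move=> /(_ _ _)/cvg_lim <-//; last 2 first.
- by move=> k; apply/measurable_EFinP; apply: measurable_funS mf.
- by move=> k t /I_sub/=; rewrite in_itv/= andbT lee_fin; exact: f0.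
apply: lime_le.
  apply: ereal_nondecreasing_is_cvgn.
  apply: ge0_nondecreasing_set_nondecreasing_integral => //.
  - by move=> k; apply/measurable_EFinP; apply: measurable_funS mf.
  - by move=> k t /I_sub/=; rewrite in_itv/= andbT lee_fin; exact: f0.
apply: nearW => k; rewrite integral_segment_derive ?invr_gt0//.
rewrite lee_fin lerBlDr.
have /andP[_ h1] := FM k.+1%:R ltac:(by []).
have /andP[h2 _] := FM k.+1%:R^-1 ltac:(by rewrite invr_gt0).
by rewrite (le_trans h1)// lerDl.
Qed.

(** For an integrand of variable sign the exhaustion by the segments [I k] is justified by dominated
    convergence, hence the integrability assumption. *)
Lemma integral_derive_lim (A B : R) :
  mu.-integrable (`]0%R, +oo[%classic : set R) (EFin \o f) ->
  F k.+1%:R^-1 @[k --> \oo] --> A -> F k.+1%:R @[k --> \oo] --> B ->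
  (\int[mu]_(t in `]0%R, +oo[) (f t)%:E = (B - A)%:E)%E.
Proof.
move=> intf FA FB.
pose g k := (EFin \o f) \_ (I k).
have mg k : measurable_fun (`]0%R, +oo[%classic : set R) (g k).
  apply/(measurable_restrict (EFin \o f)) => //; first exact: measurable_itv.
  by apply: measurable_funS (measurable_int _ intf).
have gf : {ae mu, forall t : R, (`]0%R, +oo[%classic : set R) t ->
    g k t @[k --> \oo] --> (EFin \o f) t}.
  apply: aeW => t; rewrite -I_bigcup => -[k _ kt].
  apply: cvg_near_cst; exists k => // m /= km.
  rewrite /g patchE mem_set//; move: t kt; apply/subsetPset; exact: I_nd.
have gle : {ae mu, forall (t : R) k, (`]0%R, +oo[%classic : set R) t ->
    (`|g k t| <= (abse \o (EFin \o f)) t)%E}.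
  apply: aeW => t k _; rewrite /g patchE; case: ifPn => //= _.
  by rewrite normr0 lee_fin.
have [_ _ /cvg_lim <-//] := @dominated_convergence _
  (measurableTypeR R) _ mu _ (measurable_itv _) _ _ _ mg (measurable_int _ intf) gf (integrable_abse intf) gle.
rewrite (_ : (fun _ => _) = fun k => (F k.+1%:R - F k.+1%:R^-1)%:E).
  by apply/cvg_lim => //; apply: cvg_EFin; [exact: nearW|exact: cvgB].
apply/funext => k; rewrite /g -integral_mkcondr setIC.
by rewrite (setIidl (@I_sub k))// integral_segment_derive// invr_gt0.
Qed.

End improper.

Section gamma.
Context {R : realType}.
Local Notation mu := (@lebesgue_measure R).

Lemma is_derive_continuous (f : R -> R) (x df : R) :
  is_derive x 1 f df -> {for x, continuous f}.
Proof.
move=> dfx; apply/differentiable_continuous/derivable1_diffP.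
exact: (@ex_derive _ _ _ _ _ _ _ dfx).
Qed.

(** For [t > 0] the function is t^a (1+t)^b, written as an exponential so that the chain rule
    applies to real exponents. It supplies the primitives both for the Gamma integral and, with
    [b = 0], for plain powers. *)
Lemma is_derive_expR_lin_ln (a b : R) (t : R) : 0 < t ->
  is_derive t (1 : R) (fun u : R => expR (a * ln u + b * ln (1 + u)))
    (expR (a * ln t + b * ln (1 + t)) * (a / t + b / (1 + t))).
Proof.
move=> t0; have t1 : 0 < 1 + t by rewrite addr_gt0.
have d1 : is_derive t (1 : R) (@ln R) t^-1 by exact: is_derive1_ln.
have d2 : is_derive t (1 : R) (@ln R \o (fun u => 1 + u)) ((1 + t)^-1 * 1).
  apply: is_derive1_comp; first exact: is_derive1_ln.
  by rewrite -[X in is_derive _ _ _ X]add0r; apply: is_deriveD.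
rewrite mulr1 in d2.
exact: (is_derive1_comp (f := expR)
  (is_derive_expR _) (is_deriveD (is_deriveZ a d1) (is_deriveZ b d2))).
Qed.

(** Cutting the power off at 0 lets half-line integrals run over the whole line, where Tonelli's
    theorem on products applies directly. The sign test matters because [powR] does not vanish on
    negative numbers. The exponent parameter [p] may itself be negative. *)
Definition hpow (p t : R) : R := if 0 < t then t `^ (p - 1) else 0.

Lemma hpow_ge0 p t : 0 <= hpow p t.
Proof. by rewrite /hpow; case: ifP => // _; exact: powR_ge0. Qed.

Lemma measurable_hpow p : measurable_fun [set: measurableTypeR R] (hpow p).
Proof.
apply: (@measurable_fun_ifT _ _ (measurableTypeR R) (measurableTypeR R)) => //.
exact: measurable_fun_ltr.
Qed.

Lemma measurable_hpow_expR (p b : R) :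
  measurable_fun [set: measurableTypeR R]
    (fun t => (hpow p t * expR (- (b * t)))%:E).
Proof.
apply/measurable_EFinP; apply: measurable_funM; first exact: measurable_hpow.
by apply: measurableT_comp => //; exact: measurableT_comp.
Qed.

Lemma measurable_hpow_expRN (p : R) :
  measurable_fun [set: measurableTypeR R] (fun t => (hpow p t * expR (- t))%:E).
Proof.
have := measurable_hpow_expR p 1.
by congr (measurable_fun _ _); apply/funext => t; rewrite mul1r.
Qed.

Lemma hpow_expR_ge0 (p b t : R) : (0 <= (hpow p t * expR (- (b * t)))%:E)%E.
Proof. by rewrite lee_fin mulr_ge0 ?hpow_ge0 ?expR_ge0. Qed.

Lemma integral_gt0_if (g : R -> \bar R) :
  (\int[mu]_(t in `]0%R, +oo[) g t = \int[mu]_t (if (0 < t)%R then g t else 0))%E.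
Proof.
rewrite integral_mkcond; apply: eq_integral => t _.
by rewrite patchE mem_setE in_itv/= andbT.
Qed.

(** The logarithm lies below its tangent at 1, applied to (1+t)/(p+1): this trades exp(-t) for a
    multiple of (1+t)^(-(p+1)). The majorant t^(p-1) (1+t)^(-p-1) has the bounded primitive
    (t/(1+t))^p / p. *)
Lemma gamma_integrand_le (p t : R) : 0 < p -> 0 < t ->
  t `^ (p - 1) * expR (- t) <= expR ((p + 1) * ln (p + 1)) *
    expR ((p - 1) * ln t + (- (p + 1)) * ln (1 + t)).
Proof.
move=> p0 t0; rewrite /powR gt_eqF// -!expRD ler_expR.
have p1 : 0 < p + 1 by rewrite addr_gt0.
suff : (p + 1) * ln (1 + t) <= t + (p + 1) * ln (p + 1) by lra.
have := @le_ln1Dx R ((t - p) / (p + 1)) ltac:(by rewrite ltr_pdivlMr//; lra).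
rewrite (_ : 1 + _ = (1 + t) / (p + 1)); last by field; rewrite gt_eqF.
rewrite lnM ?posrE ?invr_gt0 ?addr_gt0// lnV ?posrE//.
rewrite ler_pdivlMr//; nra.
Qed.

Lemma Gamma_integral_lty (p : R) : 0 < p ->
  (\int[mu]_t (hpow p t * expR (- t))%:E < +oo)%E.
Proof.
move=> p0.
pose C := expR ((p + 1) * ln (p + 1)).
pose F t := expR (p * ln t + (- p) * ln (1 + t)).
pose f t := C * p * expR ((p - 1) * ln t + (- (p + 1)) * ln (1 + t)).
have dF (t : R) : 0 < t -> is_derive t (1 : R) (C \*: F) (f t).
  move=> t0; have t1 : 0 < 1 + t by rewrite addr_gt0.
  have := is_deriveZ C (is_derive_expR_lin_ln p (- p) t0).
  congr is_derive; rewrite /f -mulrA; congr (C * _); apply/esym.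
  rewrite (_ : (p - 1) * _ + _ = (p * ln t + - p * ln (1 + t)) + (- ln t - ln (1 + t))); last by ring.
  rewrite expRD mulrCA; congr (_ * _).
  rewrite expRD !expRN !lnK ?posrE//; field.
  by rewrite !gt_eqF.
have cf (t : R) : 0 < t -> {for t, continuous f}.
  move=> t0; exact: (is_derive_continuous
    (is_deriveZ (C * p) (is_derive_expR_lin_ln (p - 1) (- (p + 1)) t0))).
have C0 : 0 < C by exact: expR_gt0.
have f0 (t : R) : 0 < t -> 0 <= f t by move=> _; rewrite !mulr_ge0 ?expR_ge0// ltW.
have FC (t : R) : 0 < t -> 0 <= (C \*: F) t <= C.
  move=> t0; rewrite -[(_ \*: _) t]/(C * F t) mulr_ge0 ?expR_ge0 ?(ltW C0)//=.
  rewrite ler_piMr ?(ltW C0)//.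
  rewrite /F -[leRHS]expR0 ler_expR mulNr subr_le0 ler_pM2l// ler_ln ?posrE ?addr_gt0// lerDr ler01 //.
have := integral_primitive_le dF cf f0 FC; rewrite integral_gt0_if => fC.
have pint : (0 <= \int[mu]_t (p%:E * (hpow p t * expR (- t))%:E) <= C%:E)%E.
  apply/andP; split.
    apply: integral_ge0 => t _.
    by rewrite mule_ge0 ?lee_fin ?mulr_ge0 ?hpow_ge0 ?expR_ge0// ltW.
  apply: le_trans fC; apply: ge0_le_integral => //.
  - by move=> t _; rewrite mule_ge0 ?lee_fin ?mulr_ge0 ?hpow_ge0 ?expR_ge0// ltW.
  - by apply: measurable_funeM; exact: measurable_hpow_expRN.
  - apply: measurable_fun_ifT => //; first exact: measurable_fun_ltr.
    apply/measurable_EFinP; apply: measurable_funM => //.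
    apply: measurableT_comp => //; apply: measurable_funD.
      by apply: measurable_funM => //; exact: measurable_ln.
    apply: measurable_funM => //; apply: measurableT_comp.
      exact: measurable_ln.
    exact: measurable_funD.
  - move=> t _; rewrite /hpow; case: ifPn => t0; last by rewrite mul0r mule0.
    rewrite -EFinM lee_fin /f mulrAC mulrC ler_pM2r//.
    exact: gamma_integrand_le.
move: pint; rewrite ge0_integralZl//; last 3 first.
- exact: measurable_hpow_expRN.
- by move=> t _; rewrite lee_fin mulr_ge0 ?hpow_ge0 ?expR_ge0.
- by rewrite lee_fin ltW.
case: integral => [r _||]; first by rewrite ltry.
- by rewrite gt0_muley ?lte_fin// => /andP[_]; rewrite leye_eq.
- by rewrite ltNye.
Qed.

(** [Gamma] is the real part of an extended integral and would hide an infinite value; finiteness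
    turns the definition into an identity of extended reals. *)
Lemma Gamma_integral (p : R) : 0 < p ->
  (\int[mu]_t (hpow p t * expR (- t))%:E = (Gamma p)%:E)%E.
Proof.
move=> p0; rewrite /Gamma /Rintegral integral_gt0_if fineK.
  by apply: eq_integral => t _; rewrite /hpow; case: ifP => // _; rewrite mul0r.
rewrite ge0_fin_numE; last first.
  apply: integral_ge0 => t _; case: ifP => // _.
  by rewrite lee_fin mulr_ge0 ?powR_ge0 ?expR_ge0.
apply: le_lt_trans (Gamma_integral_lty p0); rewrite le_eqVlt; apply/orP; left.
apply/eqP.
by apply: eq_integral => t _; rewrite /hpow; case: ifP => // _; rewrite mul0r.
Qed.

Lemma Gamma_gt0 (p : R) : 0 < p -> 0 < Gamma p.
Proof.
move=> p0; rewrite -lte_fin -Gamma_integral//.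
(* On [[1, 2]] one has |(p-1) ln t| <= |p-1| ln 2 and t <= 2, so [c] bounds the integrand from below
   there. *)
pose c := expR (- `|p - 1| * ln 2 - 2).
apply: (@lt_le_trans _ _ (\int[mu]_(t in `[1%R, 2%R]) (cst c%:E t))%E).
  rewrite integral_cst//= lebesgue_measure_itv/= lte_fin ltr1n.
  by rewrite -EFinB -EFinM lte_fin mulr_gt0 ?expR_gt0//; lra.
apply: (@le_trans _ _ (\int[mu]_(t in `[1%R, 2%R]) (hpow p t * expR (- t))%:E)%E).
  apply: ge0_le_integral => //.
  - by move=> t _; rewrite lee_fin expR_ge0.
  - by apply: measurable_funTS; exact: measurable_hpow_expRN.
  - move=> t; rewrite /= in_itv/= => /andP[t1 t2].
    have t0 : 0 < t by rewrite (lt_le_trans _ t1).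
    rewrite lee_fin /hpow t0 /powR gt_eqF// -expRD ler_expR.
    rewrite lerB// mulNr lerNl.
    have lt : 0 <= ln t <= ln 2.
      by rewrite ln_ge0// ler_ln ?posrE.
    have : `|(p - 1) * ln t| <= `|p - 1| * ln 2.
      by rewrite normrM ler_wpM2l// ger0_norm; case/andP: lt.
    by rewrite ler_norml => /andP[+ _]; rewrite lerNl.
apply: ge0_subset_integral => //.
- exact: measurable_hpow_expRN.
- by move=> t _; rewrite lee_fin mulr_ge0 ?hpow_ge0 ?expR_ge0.
Qed.

Lemma Gamma_integralZ (p c : R) : 0 < p -> 0 < c ->
  (\int[mu]_t (hpow p t * expR (- (c * t)))%:E = (Gamma p * c `^ (- p))%:E)%E.
Proof.
move=> p0 c0; have c1 : c^-1 != 0 by rewrite invr_eq0 gt_eqF.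
rewrite (ge0_integral_affine 0 c1); last 2 first.
- exact: measurable_hpow_expR.
- by move=> t; exact: hpow_expR_ge0.
under eq_integral => t _.
  rewrite add0r mulrA divff ?gt_eqF// mul1r.
  rewrite (_ : hpow p (c^-1 * t) = c `^ (1 - p) * hpow p t); last first.
    rewrite /hpow pmulr_rgt0 ?invr_gt0//; case: ifP => t0; last by rewrite mulr0.
    rewrite powRM ?invr_ge0 ?ltW// -powR_inv1 ?ltW// -powRrM.
    by congr (_ `^ _ * _); ring.
  rewrite -mulrA EFinM -[X in expR (- X)]mul1r; over.
rewrite ge0_integralZl//=; last 3 first.
- exact: measurable_hpow_expR.
- by move=> t _; exact: hpow_expR_ge0.
- by rewrite lee_fin powR_ge0.
under eq_integral do rewrite mul1r.
rewrite Gamma_integral// -!EFinM ger0_norm ?invr_ge0 ?ltW//; congr EFin.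
rewrite mulrA mulrC; congr (_ * _); rewrite -powR_inv1 ?ltW// -powRD; last by rewrite (gt_eqF c0) implybT.
by congr (_ `^ _); ring.
Qed.

End gamma.

(** * Gaussian and power integrals on R^n *)

Section rVint.
Context {R : realType}.
Local Notation mu := (@lebesgue_measure R).

Definition sqn {n} (x : 'rV[R]_n) : R := \sum_(i < n) x ord0 i ^+ 2.

(** Peels off the first coordinate; integrals over R^n then follow from the one-dimensional ones by
    induction on [n]. *)
Lemma ge0_integral_rVS n (f : 'rV[R]_n.+1 -> \bar R) :
  measurable_fun [set: 'rV[R]_n.+1] f -> (forall x, (0 <= f x)%E) ->
  (\int[lebesgue_rV R n.+1]_x f x =
   \int[mu]_t \int[lebesgue_rV R n]_v f (rV_cons (t, v)))%E.
Proof.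
move=> mf f0.
pose g : {mfun (measurableTypeR R * 'rV[R]_n)%type >-> 'rV[R]_n.+1} :=
  HB.pack (@rV_cons R n) (isMeasurableFun.Build _ _ _ _ _ (@measurable_rV_cons R n)).
rewrite (eq_measure_integral (pushforward (mu \x lebesgue_rV R n)%E g))//.
rewrite (@ge0_integral_pushforward _ _ _ _ _ g)//.
rewrite preimage_setT fubini_tonelli1//; last by move=> p; exact: f0.
by apply: measurableT_comp => //; exact: measurable_rV_cons.
Qed.

Lemma measurable_fun_integral_rVS n (f : 'rV[R]_n.+1 -> \bar R) :
  measurable_fun [set: 'rV[R]_n.+1] f -> (forall x, (0 <= f x)%E) ->
  measurable_fun [set: measurableTypeR R]
    (fun t => (\int[lebesgue_rV R n]_v f (rV_cons (t, v)))%E).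
Proof.
move=> mf f0.
apply: (@measurable_fun_fubini_tonelli_F _ _ (measurableTypeR R) 'rV[R]_n R
  (lebesgue_rV R n) (f \o @rV_cons R n)); last by move=> p; exact: f0.
by apply: measurableT_comp => //; exact: measurable_rV_cons.
Qed.

Lemma sqn_cons n t (v : 'rV[R]_n) : sqn (rV_cons (t, v)) = t ^+ 2 + sqn v.
Proof.
rewrite /sqn big_ord_recl mxE unlift_none; congr (_ + _).
by apply: eq_bigr => i _; rewrite mxE liftK.
Qed.

Lemma measurable_rV_affine n (a : 'rV[R]_n) (c : R) :
  measurable_fun [set: 'rV[R]_n] (fun x : 'rV[R]_n => a + c *: x).
Proof.
apply: measurable_fun_rV_coordP => i.
rewrite (_ : _ \o _ = fun x => a ord0 i + c * rV_coord i x); last first.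
  by apply/funext => x; rewrite /= /rV_coord !mxE.
apply: measurable_funD => //; apply: measurable_funM => //.
exact: measurable_rV_coord.
Qed.

Lemma ge0_integral_rV_affine n (a : 'rV[R]_n) (c : R) (f : 'rV[R]_n -> \bar R) :
  c != 0 -> measurable_fun [set: 'rV[R]_n] f -> (forall x, (0 <= f x)%E) ->
  (\int[lebesgue_rV R n]_x f x =
   (`|c| ^+ n)%:E * \int[lebesgue_rV R n]_x f (a + c *: x)%R)%E.
Proof.
move=> c0; elim: n a f => [|n IH] a f mf f0.
  rewrite expr0 mul1e; apply: eq_integral => x _; congr f.
  by apply/rowP => -[].
have mcons : measurable_fun setT (fun p : measurableTypeR R * 'rV[R]_n => f (rV_cons p)).
  by apply: measurableT_comp => //; exact: measurable_rV_cons.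
have maff : measurable_fun setT (fun x : 'rV[R]_n.+1 => f (a + c *: x)).
  by apply: measurableT_comp => //; exact: measurable_rV_affine.
rewrite !ge0_integral_rVS//.
rewrite (ge0_integral_affine (a ord0 ord0) c0); last 2 first.
- exact: measurable_fun_integral_rVS.
- by move=> t; exact: integral_ge0.
under eq_integral => t _.
  rewrite (IH (\row_j a ord0 (lift ord0 j)))//; last first.
    by apply: measurableT_comp mcons _; exact: measurable_pair1.
  under eq_integral => x _.
    rewrite (_ : rV_cons _ = a + c *: rV_cons (t, x)); last first.
      apply/rowP => i; rewrite !mxE; case: unliftP => [j ->|->] //=.
      by rewrite !mxE.
    over.
  over.
rewrite ge0_integralZl//; last 2 first.
- exact: (@measurable_fun_integral_rVS n (fun x => f (a + c *: x))).
- by move=> t _; exact: integral_ge0.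
by rewrite muleA -EFinM -exprS.
Qed.

Lemma gauss1 (c : R) : 0 < c ->
  (\int[mu]_t (expR (- (c * t ^+ 2)))%:E = ((pi / c) `^ 2^-1)%:E)%E.
Proof.
move=> c0; have mg (b : R) : measurable_fun [set: R] (fun t : R => (expR (- (b * t ^+ 2)))%:E).
  apply/measurable_EFinP; apply: measurableT_comp => //.
  by apply: measurableT_comp => //; apply: measurable_funM.
have s0 : (Num.sqrt c)^-1 != 0 by rewrite invr_eq0 gt_eqF// sqrtr_gt0.
rewrite (ge0_integral_affine 0 s0)//.
under eq_integral => t _.
  rewrite add0r exprMn exprVn sqr_sqrtr ?ltW// mulrA divff ?gt_eqF// mul1r.
  over.
rewrite integralT_gauss ger0_norm ?invr_ge0 ?sqrtr_ge0// -EFinM.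
rewrite powR12_sqrt ?divr_ge0 ?pi_ge0 ?ltW// sqrtrM ?pi_ge0// sqrtrV ?ltW//.
by rewrite mulrC.
Qed.

Lemma measurable_sqn n : measurable_fun [set: 'rV[R]_n] (@sqn n).
Proof.
apply: measurable_sum => i; apply: measurable_funX.
exact: (measurable_rV_coord i).
Qed.

Lemma gauss_rV n (c : R) : 0 < c ->
  (\int[lebesgue_rV R n]_x (expR (- (c * sqn x)))%:E
   = ((pi / c) `^ (n%:R / 2))%:E)%E.
Proof.
move=> c0; have mg m : measurable_fun setT (fun x : 'rV[R]_m => (expR (- (c * sqn x)))%:E).
  apply/measurable_EFinP; apply: measurableT_comp => //.
  by apply: measurableT_comp => //; apply: measurable_funM => //; exact: measurable_sqn.
elim: n => [|n IH].
  rewrite mul0r powRr0 /= integral_dirac//; last exact: mg.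
  rewrite diracT mul1e.
  by rewrite /sqn big_ord0 mulr0 oppr0 expR0.
rewrite ge0_integral_rVS//.
under eq_integral => t _.
  under eq_integral do rewrite sqn_cons mulrDr opprD expRD EFinM.
  rewrite ge0_integralZl//=; last exact: mg.
  rewrite IH muleC; over.
rewrite ge0_integralZl//=; last 2 first.
- apply/measurable_EFinP; apply: measurableT_comp => //.
  by apply: measurableT_comp => //; apply: measurable_funM.
- by rewrite lee_fin powR_ge0.
rewrite gauss1// -EFinM -powRD; last by rewrite gt_eqF ?implybT// divr_gt0// pi_gt0.
by congr (_ `^ _)%:E; rewrite -[in RHS]addn1 natrD; field.
Qed.
End rVint.

(** * Integrability of powers of |x| and the Beta integral *)

Section riesz.
Context {R : realType}.
Local Notation mu := (@lebesgue_measure R).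

Lemma sqn_ge0 n (x : 'rV[R]_n) : 0 <= sqn x.
Proof. by apply: sumr_ge0 => i _; exact: sqr_ge0. Qed.

Lemma sqn_eq0 n (x : 'rV[R]_n) : (sqn x == 0) = (x == 0).
Proof.
apply/idP/eqP => [|->]; last first.
  by rewrite /sqn big1// => i _; rewrite mxE expr0n.
rewrite psumr_eq0 => [/allP x0|i _]; last exact: sqr_ge0.
apply/rowP => i; rewrite mxE; apply/eqP.
by have := x0 i (mem_index_enum _); rewrite /= sqrf_eq0.
Qed.

Lemma lebesgue_rV_set1 n : (0 < n)%N -> lebesgue_rV R n [set 0] = 0.
Proof.
move=> n0.
rewrite (_ : [set 0] = [set x : 'rV[R]_n | forall i, [set (0:R)] (x ord0 i)]).
  rewrite (lebesgue_rV_box (A := fun=> [set 0]))//; case: n n0 => // n _.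
  by rewrite big_ord_recl lebesgue_measure_set1 mul0e.
apply/seteqP; split => [x -> i /=|x /= x0]; first by rewrite mxE.
by apply/rowP => i; rewrite mxE x0.
Qed.

Lemma measurable_hpow_sqn n (p b : R) : measurable_fun setT
  (fun z : 'rV[R]_n * measurableTypeR R =>
    (hpow p z.2 * expR (- ((b + z.2) * sqn z.1)))%:E).
Proof.
apply/measurable_EFinP; apply: measurable_funM.
  by apply: (measurableT_comp (measurable_hpow p)).
apply: measurableT_comp => //; apply: measurableT_comp => //.
apply: measurable_funM; first exact: measurable_funD.
by apply: measurableT_comp => //; exact: measurable_sqn.
Qed.

Lemma measurable_powR_sqn n (p b : R) : measurable_fun [set: 'rV[R]_n]
  (fun x => (b + sqn x) `^ p).
Proof.
apply: (measurableT_comp (measurable_powR p)).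
by apply: measurable_funD => //; exact: measurable_sqn.
Qed.

Lemma integral_gauss_mixture n (p b : R) : 0 <= b ->
  (\int[lebesgue_rV R n]_x \int[mu]_t
      (hpow p t * expR (- ((b + t) * sqn x)))%:E =
  \int[mu]_t (hpow p t * (pi / (b + t)) `^ (n%:R / 2))%:E)%E.
Proof.
move=> b0.
rewrite (@fubini_tonelli _ _ 'rV[R]_n (measurableTypeR R) R (lebesgue_rV R n) mu
  (fun z => (hpow p z.2 * expR (- ((b + z.2) * sqn z.1)))%:E))//; last 2 first.
- exact: measurable_hpow_sqn.
- by move=> z; rewrite lee_fin mulr_ge0 ?hpow_ge0 ?expR_ge0.
apply: eq_integral => t _ /=; under eq_integral do rewrite EFinM.
rewrite ge0_integralZl//=; last 2 first.
- apply/measurable_EFinP; apply: measurableT_comp => //.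
  by apply: measurableT_comp => //; apply: measurable_funM => //; exact: measurable_sqn.
- by rewrite lee_fin hpow_ge0.
rewrite /hpow; case: ifPn => t0; last by rewrite mul0e mul0r.
by rewrite gauss_rV ?ltr_wpDl.
Qed.

(** Polar coordinates are avoided by writing the power as a Gamma mixture of exp(-t(1+|x|^2)).
    Integrating in x first leaves a multiple of the Gamma integral of parameter m - n/2, which
    converges because n/2 < m. *)
Lemma integral_powR_sqnD1_lty n (m : R) : n%:R / 2 < m ->
  (\int[lebesgue_rV R n]_x ((1 + sqn x) `^ (- m))%:E < +oo)%E.
Proof.
move=> nm; have m0 : 0 < m by rewrite (le_lt_trans _ nm)// divr_ge0.
have -> : (\int[lebesgue_rV R n]_x ((1 + sqn x) `^ (- m))%:E =
    \int[lebesgue_rV R n]_x \int[mu]_t ((Gamma m)^-1%:E *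
      (hpow m t * expR (- ((1 + sqn x) * t)))%:E))%E.
  apply: eq_integral => x _; rewrite ge0_integralZl//; last 3 first.
  - exact: measurable_hpow_expR.
  - by move=> t _; exact: hpow_expR_ge0.
  - by rewrite lee_fin invr_ge0 ltW// Gamma_gt0.
  rewrite Gamma_integralZ// ?ltr_wpDr ?sqn_ge0//.
  by rewrite -EFinM mulKf// gt_eqF// Gamma_gt0.
rewrite (@fubini_tonelli _ _ 'rV[R]_n (measurableTypeR R) R (lebesgue_rV R n) mu
  (fun z => ((Gamma m)^-1%:E *
      (hpow m z.2 * expR (- ((1 + sqn z.1) * z.2)))%:E)%E))//; last 2 first.
- apply: measurable_funeM.
  apply/measurable_EFinP; apply: measurable_funM.
    by apply: (measurableT_comp (measurable_hpow m)).
  apply: measurableT_comp => //; apply: measurableT_comp => //.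
  apply: measurable_funM => //; apply: measurable_funD => //.
  by apply: measurableT_comp => //; exact: measurable_sqn.
- move=> z; apply: mule_ge0; last exact: hpow_expR_ge0.
  by rewrite lee_fin invr_ge0 ltW// Gamma_gt0.
rewrite (_ : (\int[mu]_t _)%E = ((Gamma m)^-1 * pi `^ (n%:R / 2) *
    Gamma (m - n%:R / 2))%:E) ?ltry//.
under eq_integral => t _.
  under eq_integral => x _.
    rewrite /= mulrDl mul1r opprD expRD mulrA [sqn x * t]mulrC -EFinM mulrA EFinM; over.
  rewrite ge0_integralZl//=; last 2 first.
  - apply/measurable_EFinP; apply: measurableT_comp => //.
    by apply: measurableT_comp => //; apply: measurable_funM => //; exact: measurable_sqn.
  - by rewrite lee_fin !mulr_ge0 ?invr_ge0 ?hpow_ge0 ?expR_ge0// ltW// Gamma_gt0.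
  rewrite (_ : (_ * _)%E = (((Gamma m)^-1 * pi `^ (n%:R / 2))%:E *
      (hpow (m - n%:R / 2) t * expR (- t))%:E)%E).
    over.
  rewrite /hpow; case: ifPn => t0; last by rewrite !(mul0r, mulr0, mul0e, mule0).
  rewrite gauss_rV// -!EFinM; congr EFin.
  rewrite powRM ?pi_ge0 ?invr_ge0 ?ltW// -[t^-1]powR_inv1 ?ltW// -powRrM.
  have -> : t `^ (m - n%:R / 2 - 1) = t `^ (m - 1) * t `^ (-1 * (n%:R / 2)).
    rewrite -powRD ?(gt_eqF t0) ?implybT//; by congr (_ `^ _); ring.
  ring.
rewrite ge0_integralZl//=; last 3 first.
- exact: measurable_hpow_expRN.
- by move=> t _; rewrite lee_fin mulr_ge0 ?hpow_ge0 ?expR_ge0.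
- by rewrite lee_fin mulr_ge0 ?powR_ge0// invr_ge0 ltW// Gamma_gt0.
by rewrite Gamma_integral ?subr_gt0// -EFinM.
Qed.

(** Euler's Beta integral in Gamma form: expand (b+t)^(-m) as a mixture of exponentials, then
    integrate in t before the mixing variable. *)
Lemma integral_hpow_powRD (p m b : R) : 0 < p -> p < m -> 0 < b ->
  (\int[mu]_t (hpow p t * (b + t) `^ (- m))%:E =
   (Gamma p * Gamma (m - p) / Gamma m * b `^ (p - m))%:E)%E.
Proof.
move=> p0 pm b0; have m0 : 0 < m by rewrite (lt_trans p0).
have Gm := Gamma_gt0 m0; have Gp := Gamma_gt0 p0.
have -> : (\int[mu]_t (hpow p t * (b + t) `^ (- m))%:E =
    \int[mu]_t \int[mu]_u ((Gamma m)^-1 * hpow p t * (hpow m u * expR (- ((b + t) * u))))%:E)%E.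
  apply: eq_integral => t _; under eq_integral do rewrite EFinM.
  rewrite ge0_integralZl//; last 3 first.
  - exact: measurable_hpow_expR.
  - by move=> u _; exact: hpow_expR_ge0.
  - by rewrite lee_fin mulr_ge0 ?hpow_ge0// invr_ge0 ltW.
  rewrite /hpow; case: ifPn => t0; last by rewrite mulr0 mul0r mul0e.
  rewrite Gamma_integralZ// ?addr_gt0// -EFinM; congr EFin.
  by field; rewrite gt_eqF.
rewrite (@fubini_tonelli _ _ (measurableTypeR R) (measurableTypeR R) R mu mu
  (fun z => ((Gamma m)^-1 * hpow p z.1 * (hpow m z.2 * expR (- ((b + z.1) * z.2))))%:E))//; last 2 first.
- apply/measurable_EFinP; apply: measurable_funM.
    by apply: measurable_funM => //; apply: (measurableT_comp (measurable_hpow p)).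
  apply: measurable_funM.
    by apply: (measurableT_comp (measurable_hpow m)).
  apply: measurableT_comp => //; apply: measurableT_comp => //.
  by apply: measurable_funM => //; apply: measurable_funD.
- move=> z; rewrite lee_fin.
  by rewrite !mulr_ge0 ?hpow_ge0 ?expR_ge0// invr_ge0 ltW.
transitivity (\int[mu]_u (((Gamma m)^-1 * Gamma p)%:E *
    (hpow (m - p) u * expR (- (b * u)))%:E))%E.
  apply: eq_integral => u _ /=.
  under eq_integral => t _.
    rewrite (_ : _ * _ = ((Gamma m)^-1 * (hpow m u * expR (- (b * u)))) * (hpow p t * expR (- (u * t)))).
      rewrite EFinM; over.
    rewrite (_ : - ((b + t) * u) = - (b * u) + - (u * t)) ?expRD; ring.
  rewrite ge0_integralZl//; last 3 first.
  - exact: measurable_hpow_expR.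
  - by move=> t _; exact: hpow_expR_ge0.
  - by rewrite lee_fin !mulr_ge0 ?hpow_ge0 ?expR_ge0// invr_ge0 ltW.
  rewrite /hpow; case: ifPn => u0; last by rewrite !(mul0r, mulr0, mul0e, mule0).
  rewrite Gamma_integralZ// -!EFinM; congr EFin.
  have -> : u `^ (m - p - 1) = u `^ (m - 1) * u `^ (- p).
    by rewrite -powRD ?(gt_eqF u0) ?implybT//; congr (_ `^ _); ring.
  ring.
rewrite ge0_integralZl//=; last 3 first.
- exact: measurable_hpow_expR.
- by move=> t _; exact: hpow_expR_ge0.
- by rewrite lee_fin; apply: mulr_ge0; rewrite ?invr_ge0; exact: ltW.
by rewrite Gamma_integralZ ?subr_gt0// -EFinM opprB; congr EFin; ring.
Qed.

(** The Gaussian factor removes infinity and isolates the singularity at 0. After the mixture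
    formula and integration in x, the Beta integral of t^(p-1) (1+t)^(-n/2) remains, convergent
    because p < n/2. Only an inequality is used at the start, since the power is 0 by convention at
    the origin. *)
Lemma integral_powR_sqn_gauss_lty n (p : R) : 0 < p -> p < n%:R / 2 ->
  (\int[lebesgue_rV R n]_x (sqn x `^ (- p) * expR (- sqn x))%:E < +oo)%E.
Proof.
move=> p0 pn; have Gp := Gamma_gt0 p0.
apply: (@le_lt_trans _ _ (\int[lebesgue_rV R n]_x ((Gamma p)^-1%:E * \int[mu]_t
      (hpow p t * expR (- ((1 + t) * sqn x)))%:E))%E).
  apply: ge0_le_integral => //.
  - by move=> x _; rewrite lee_fin mulr_ge0 ?powR_ge0 ?expR_ge0.
  - apply/measurable_EFinP; apply: measurable_funM.
      apply: (measurableT_comp (measurable_powR (- p))); exact: measurable_sqn.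
    by apply: measurableT_comp => //; apply: measurableT_comp => //; exact: measurable_sqn.
  - apply: measurable_funeM.
    apply: (@measurable_fun_fubini_tonelli_F _ _ 'rV[R]_n (measurableTypeR R) R mu
      (fun z => (hpow p z.2 * expR (- ((1 + z.2) * sqn z.1)))%:E)).
      exact: measurable_hpow_sqn.
    by move=> z; rewrite lee_fin mulr_ge0 ?hpow_ge0 ?expR_ge0.
  - move=> x _; have [x0|x0] := eqVneq (sqn x) 0.
      rewrite x0 powR0 ?oppr_eq0 ?gt_eqF// mul0r.
      apply: mule_ge0; first by rewrite lee_fin invr_ge0 ltW.
      by apply: integral_ge0 => t _; rewrite lee_fin mulr_ge0 ?hpow_ge0 ?expR_ge0.
    have {}x0 : 0 < sqn x by rewrite lt_neqAle eq_sym x0 sqn_ge0.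
    under eq_integral => t _.
      rewrite (_ : _ * _ = expR (- sqn x) * (hpow p t * expR (- (sqn x * t)))).
        rewrite EFinM; over.
      rewrite (_ : - ((1 + t) * sqn x) = - sqn x + - (sqn x * t)) ?expRD; ring.
    rewrite ge0_integralZl//; last 2 first.
    - exact: measurable_hpow_expR.
    - by move=> t _; exact: hpow_expR_ge0.
    rewrite Gamma_integralZ// -!EFinM lee_fin.
    by rewrite [_ * (_ * _)]mulrCA mulKf ?gt_eqF// mulrC.
rewrite ge0_integralZl//; last 3 first.
- apply: (@measurable_fun_fubini_tonelli_F _ _ 'rV[R]_n (measurableTypeR R) R mu
      (fun z => (hpow p z.2 * expR (- ((1 + z.2) * sqn z.1)))%:E)).
    exact: measurable_hpow_sqn.
  by move=> z; rewrite lee_fin mulr_ge0 ?hpow_ge0 ?expR_ge0.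
- move=> x _; apply: integral_ge0 => t _.
  by rewrite lee_fin mulr_ge0 ?hpow_ge0 ?expR_ge0.
- by rewrite lee_fin invr_ge0 ltW.
rewrite integral_gauss_mixture//.
apply: lte_mul_pinfty; [by rewrite lee_fin invr_ge0 ltW|by []|].
under eq_integral => t _.
  rewrite (_ : hpow p t * _ =
      pi `^ (n%:R / 2) * (hpow p t * (1 + t) `^ (- (n%:R / 2)))).
    rewrite EFinM; over.
  rewrite /hpow; case: ifPn => t0; last by rewrite !mul0r mulr0.
  have t1 : 0 < 1 + t by rewrite addr_gt0.
  rewrite powRM ?pi_ge0 ?invr_ge0 ?ltW// -[(1 + t)^-1]powR_inv1 ?ltW//.
  by rewrite -powRrM mulN1r mulrCA.
rewrite ge0_integralZl//=; last 3 first.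
- apply/measurable_EFinP; apply: measurable_funM; first exact: measurable_hpow.
  apply: (measurableT_comp (measurable_powR _)); exact: measurable_funD.
- by move=> t _; rewrite lee_fin mulr_ge0 ?hpow_ge0 ?powR_ge0.
- by rewrite lee_fin powR_ge0.
apply: lte_mul_pinfty; [by rewrite lee_fin powR_ge0|by []|].
by rewrite integral_hpow_powRD// ltry.
Qed.

(** The comparison test used for every integrability claim on R^n with a singularity at 0: one
    exponent below n/2 on the unit ball, another above n/2 outside it. *)
Lemma integrable_rV_powR_sqn n (p m C : R) (f : 'rV[R]_n -> R) :
  0 < p -> p < n%:R / 2 -> n%:R / 2 < m -> 0 <= C ->
  measurable_fun [set: 'rV[R]_n] f ->
  (forall x, sqn x <= 1 -> `|f x| <= C * sqn x `^ (- p)) ->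
  (forall x, 1 <= sqn x -> `|f x| <= C * sqn x `^ (- m)) ->
  (lebesgue_rV R n).-integrable setT (EFin \o f).
Proof.
move=> p0 pn nm C0 mf f1 f2.
have m0 : 0 < m by rewrite (lt_trans p0)// (lt_trans pn).
pose g1 (x : 'rV[R]_n) := sqn x `^ (- p) * expR (- sqn x).
pose g2 (x : 'rV[R]_n) := (1 + sqn x) `^ (- m).
have g10 x : 0 <= g1 x by rewrite mulr_ge0 ?powR_ge0 ?expR_ge0.
have g20 x : 0 <= g2 x by rewrite powR_ge0.
have mg1 : measurable_fun setT g1.
  apply: measurable_funM.
    by apply: (measurableT_comp (measurable_powR (- p))); exact: measurable_sqn.
  by apply: measurableT_comp => //; apply: measurableT_comp => //; exact: measurable_sqn.
have mg2 : measurable_fun setT g2 by exact: measurable_powR_sqn.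
have i1 : (lebesgue_rV R n).-integrable setT (EFin \o g1).
  apply/integrableP; split; first exact/measurable_EFinP.
  under eq_integral do rewrite /= ger0_norm//.
  exact: integral_powR_sqn_gauss_lty.
have i2 : (lebesgue_rV R n).-integrable setT (EFin \o g2).
  apply/integrableP; split; first exact/measurable_EFinP.
  under eq_integral do rewrite /= ger0_norm//.
  exact: integral_powR_sqnD1_lty.
(* The factor e compensates exp(-|x|^2) on the unit ball; outside it, 1 + |x|^2 <= 2|x|^2 accounts
   for 2^m. *)
apply: (@le_integrable _ _ _ _ _ _ _ (EFin \o (fun x => C * expR 1 * g1 x + C * 2 `^ m * g2 x))) => //.
- exact/measurable_EFinP.
- move=> x _; rewrite /= lee_fin [leRHS]ger0_norm; last first.
    by rewrite addr_ge0// !mulr_ge0 ?expR_ge0 ?powR_ge0.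
  have [x1|x1] := leP (sqn x) 1.
    rewrite (le_trans (f1 x x1))// -[leLHS]addr0 lerD ?mulr_ge0 ?powR_ge0//.
    rewrite /g1 -mulrA ler_wpM2l// mulrCA -expRD ler_peMr ?powR_ge0//.
    by rewrite -[leLHS]expR0 ler_expR subr_ge0.
  rewrite (le_trans (f2 x (ltW x1)))// -[leLHS]add0r lerD//.
    by rewrite mulr_ge0// mulr_ge0 ?expR_ge0.
  have q0 : 0 < sqn x by rewrite (lt_trans _ x1).
  rewrite -mulrA ler_wpM2l// /g2 (_ : _ * _ = (((1 + sqn x) / 2) `^ m)^-1).
    rewrite powRN lef_pV2 ?posrE ?powR_gt0 ?divr_gt0 ?addr_gt0//.
    rewrite ge0_ler_powR ?nnegrE ?(ltW m0) ?(ltW q0) ?divr_ge0 ?addr_ge0 ?(ltW q0)//.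
    lra.
  rewrite -powRN powRM ?addr_ge0 ?(ltW q0) ?invr_ge0// mulrC; congr (_ * _).
  by rewrite -powR_inv1// -powRrM mulrN mulN1r opprK.
exact: (integrableD measurableT (integrableZl measurableT (C * expR 1) i1)
  (integrableZl measurableT (C * 2 `^ m) i2)).
Qed.

Lemma measurable_rV_set1 n : measurable [set (0 : 'rV[R]_n)].
Proof.
rewrite (_ : [set 0] = @sqn R n @^-1` [set 0]).
  by rewrite -[X in measurable X]setTI; apply: measurable_sqn.
by apply/seteqP; split => x /= /eqP x0; apply/eqP; rewrite ?sqn_eq0// -sqn_eq0.
Qed.

Lemma ae_rV_neq0 n (P : 'rV[R]_n -> Prop) : (0 < n)%N ->
  (forall x, x != 0 -> P x) -> {ae lebesgue_rV R n, forall x, P x}.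
Proof.
move=> n0 HP; exists [set 0]; split; first exact: measurable_rV_set1.
  exact: lebesgue_rV_set1.
by move=> x /= nP; apply/eqP; apply: contra_notT nP; exact: HP.
Qed.
End riesz.

(** * Smooth and rapidly decreasing functions *)

Section chain_rule.
Context {R : realType} {n : nat}.
Implicit Types (f : 'rV[R]_n -> R) (x v : 'rV[R]_n).
Local Notation e_ i := (delta_mx ord0 i : 'rV[R]_n).

Lemma is_derive_eps (g : R -> R) (t d : R) :
  (forall e : R, 0 < e -> exists2 r : R, 0 < r &
    forall h : R, `|h| < r -> `|g (t + h) - g t - h * d| <= e * `|h|) ->
  is_derive t 1 g d.
Proof.
move=> gd.
have cvgd : (h^-1 *: ((g \o shift t) (h *: 1) - g t)) @[h --> 0^'] --> d.
  apply/cvgrPdist_le => e e0; have [r r0 gr] := gd e e0.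
  near=> h; have h0 : h != 0 by near: h; exact: nbhs_dnbhs_neq.
  rewrite /= [h *: 1]mulr1 [h + t]addrC distrC.
  rewrite -[_ *: _]/(h^-1 * _) (_ : _ - d = h^-1 * (g (t + h) - g t - h * d)); last first.
    by field.
  rewrite normrM normfV ler_pdivrMl ?normr_gt0// [leRHS]mulrC gr//.
  by near: h; apply: dnbhs0_lt.
apply: DeriveDef; first by apply/cvg_ex; exists d.
exact: cvg_lim cvgd.
Unshelve. all: by end_near. Qed.

Lemma is_derive_coord f x v : (forall y, derivable f y v) -> forall t : R,
  is_derive t 1 (fun u : R => f (x + u *: v)) ('D_v f (x + t *: v)).
Proof.
move=> df t.
have E : (fun h : R => h^-1 *: (((fun u => f (x + u *: v)) \o shift t) (h *: 1) - f (x + t *: v)))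
   = (fun h => h^-1 *: ((f \o shift (x + t *: v)) (h *: v) - f (x + t *: v))).
  apply/funext => h /=; rewrite [h *: 1]mulr1.
  by rewrite scalerDl addrCA.
have := df (x + t *: v); rewrite /derivable -E => c.
by apply: DeriveDef => //; rewrite /derive E.
Qed.

Lemma MVT_dist (g dg : R -> R) : (forall t : R, is_derive t 1 g (dg t)) ->
  forall a b : R, exists2 c : R, `|c - a| <= `|b - a| & g b - g a = dg c * (b - a).
Proof.
move=> dgt a b.
have cg c d : {within `[c, d], continuous g}.
  by apply: continuous_subspaceT => t; exact: (is_derive_continuous (dgt t)).
have [ab|ba] := leP a b.
- have [c + ->] := MVT_segment ab (fun t _ => dgt t) (cg _ _).
  rewrite in_itv/= => /andP[ac cb]; exists c => //.
  by rewrite !ger0_norm ?subr_ge0// lerB.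
- have [c + E] := MVT_segment (ltW ba) (fun t _ => dgt t) (cg _ _).
  rewrite in_itv/= => /andP[bc ca]; exists c.
    by rewrite distrC [leRHS]distrC !ger0_norm ?subr_ge0 ?(ltW ba)// lerB.
  by rewrite -[LHS]opprB E -mulrN opprB.
Qed.

Lemma MVT_coord f x i (c : R) : (forall y, derivable f y (e_ i)) ->
  exists2 d : R, `|d| <= `|c| &
    f (x + c *: e_ i) - f x = c * partial i f (x + d *: e_ i).
Proof.
move=> df; have [d] := MVT_dist (is_derive_coord x df) 0 c.
by rewrite !subr0 scale0r addr0 => dc E; exists d => //; rewrite E mulrC.
Qed.

(** Continuity of the partial derivatives gives differentiability along any direction: the
    displacement is made one coordinate at a time, each step by the mean value theorem, and the
    induction runs over the list of coordinates already moved. *)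
Lemma is_derive_line f x v (t : R) :
  (forall i, continuous (partial i f)) ->
  (forall i y, derivable f y (e_ i)) ->
  is_derive t 1 (fun u : R => f (x + u *: v))
    (\sum_i v ord0 i * partial i f (x + t *: v)).
Proof.
move=> cf df; set y := x + t *: v; apply: is_derive_eps.
suff H (l : seq 'I_n) (e : R) : 0 < e -> exists2 r : R, 0 < r & forall h : R, `|h| < r ->
    `|f (y + h *: \sum_(i <- l) v ord0 i *: e_ i) - f y -
      h * \sum_(i <- l) v ord0 i * partial i f y| <= e * `|h|.
  move=> e e0; have [r r0 hr] := H (index_enum 'I_n) e e0.
  exists r => // h /hr; congr (`|f _ - _ - _| <= _).
  by rewrite -row_sum_delta scalerDl addrA.
clearbody y; elim: l e => [|i l IH] e e0.
  exists 1 => // h _; rewrite !big_nil scaler0 addr0 mulr0 !subrr normr0.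
  by rewrite mulr_ge0// ltW.
have e20 : 0 < e / 2 by rewrite divr_gt0.
have [r r0 hr] := IH (e / 2) e20.
pose K : R := `|v ord0 i| + 1.
have K0 : 0 < K by rewrite ltr_wpDl.
have eK : 0 < e / 2 / K by rewrite divr_gt0.
have /cvgrPdist_le/(_ _ eK)/nbhs_normP[r1 /= r10 hr1] := cf i y.
pose w : 'rV[R]_n := \sum_(j <- l) v ord0 j *: e_ j.
(* [N * |h|] bounds the distance from [y] to the point where the mean value theorem evaluates the
   [i]-th partial derivative; the summand 1 keeps [N] positive. *)
pose N : R := `|w| + `|v ord0 i| * `|e_ i| + 1.
have N0 : 0 < N by rewrite ltr_wpDl// addr_ge0// mulr_ge0.
exists (Num.min r (r1 / N)) => [|h]; first by rewrite lt_min r0 divr_gt0.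
rewrite lt_min => /andP[/hr {}hr hN]; rewrite !big_cons -/w.
have [d dle E] := MVT_coord (y + h *: w) (h * v ord0 i) (df i).
rewrite (_ : y + h *: (_ + _) = y + h *: w + (h * v ord0 i) *: e_ i); last first.
  by rewrite scalerDr scalerA addrA addrAC.
set z := y + h *: w + d *: e_ i in E.
have yz : `|partial i f y - partial i f z| <= e / 2 / K.
  apply: hr1; rewrite /ball_/= /z -addrA opprD addNKr normrN.
  rewrite (le_lt_trans (ler_normD _ _))// !normrZ.
  rewrite ltr_pdivlMr// in hN; apply: le_lt_trans hN.
  rewrite /N mulrDr mulr1 mulrDr -[leLHS]addr0 lerD// lerD//.
  by rewrite mulrA ler_wpM2r// -normrM.
rewrite (_ : _ - f y - _ = (f (y + h *: w) - f y - h * \sum_(i <- l) v ord0 i * partial i f y)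
   + h * v ord0 i * (partial i f z - partial i f y)); last first.
  by rewrite mulrBr -E; ring.
rewrite (le_trans (ler_normD _ _))// [leRHS](_ : _ = e / 2 * `|h| + e / 2 * `|h|); last by field.
rewrite lerD// normrM distrC (le_trans (ler_wpM2l _ yz))// normrM -mulrA mulrC.
rewrite ler_wpM2r// mulrCA ler_piMr ?(ltW e20)//.
by rewrite ler_pdivrMr// mul1r /K lerDl.
Qed.

End chain_rule.

(** * Symmetry of mixed partial derivatives *)

Section clairaut.
Context {R : realType} {n : nat}.
Implicit Types (f : 'rV[R]_n -> R) (x v : 'rV[R]_n).
Local Notation e_ i := (delta_mx ord0 i : 'rV[R]_n).

Lemma second_difference f x i j (h : R) : smooth f ->
  exists c d : R, [/\ `|c| <= `|h|, `|d| <= `|h| &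
  f (x + h *: e_ i + h *: e_ j) - f (x + h *: e_ i) - (f (x + h *: e_ j) - f x)
   = h * (h * partial j (partial i f) (x + c *: e_ i + d *: e_ j))].
Proof.
move=> sf; have df k y : derivable f y (e_ k) by exact: (sf [::]).2.
have ddf k l y : derivable (partial k f) y (e_ l) by exact: (sf [:: k]).2.
have dg (t : R) : is_derive t 1 (fun u : R => f (x + h *: e_ j + u *: e_ i) - f (x + u *: e_ i))
    (partial i f (x + h *: e_ j + t *: e_ i) - partial i f (x + t *: e_ i)).
  exact: is_deriveB (is_derive_coord _ (df i) t) (is_derive_coord _ (df i) t).
have [c] := MVT_dist dg 0 h; rewrite !subr0 scale0r !addr0 => ch E.
have [d dh E2] := MVT_coord (x + c *: e_ i) h (ddf i j).
exists c, d; split => //.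
rewrite -E2 mulrC [x + c *: _ + h *: _]addrAC -E.
by rewrite addrAC [x + h *: e_ i + _]addrAC; ring.
Qed.

(** The second difference of step [h] is symmetric in [i] and [j], and equals h^2 times either mixed
    derivative at a point close to [x]. If the two derivatives differed at [x], continuity up to a
    third of the gap on each side would make the gap at most two thirds of itself. *)
Lemma partialC f i j : smooth f -> partial i (partial j f) = partial j (partial i f).
Proof.
move=> sf; apply/funext => x; apply/eqP; apply: contraT => neq.
pose e : R := `|partial i (partial j f) x - partial j (partial i f) x| / 3.
have e0 : 0 < e by rewrite divr_gt0// normr_gt0 subr_eq0.
have /cvgrPdist_le/(_ _ e0)/nbhs_normP[r1 /= r10 h1] := (sf [:: i; j]).1 x.
have /cvgrPdist_le/(_ _ e0)/nbhs_normP[r2 /= r20 h2] := (sf [:: j; i]).1 x.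
pose N : R := `|e_ i| + `|e_ j| + 1.
have N0 : 0 < N by rewrite ltr_wpDl// addr_ge0.
pose h : R := Num.min r1 r2 / N / 2.
have h0 : 0 < h by rewrite !divr_gt0// lt_min r10.
have close (c d : R) : `|c| <= `|h| -> `|d| <= `|h| ->
    `|x - (x + c *: e_ i + d *: e_ j)| < Num.min r1 r2.
  move=> ch dh; rewrite -addrA opprD addNKr normrN.
  rewrite (le_lt_trans (ler_normD _ _))// !normrZ.
  rewrite (@le_lt_trans _ _ (h * N))//.
    rewrite (gtr0_norm h0) in ch dh; rewrite /N !mulrDr mulr1 -[leLHS]addr0 lerD ?(ltW h0)//.
    by rewrite lerD// ler_wpM2r.
  rewrite /h mulrAC divfK ?gt_eqF// ltr_pdivrMr// ltr_pMr ?ltr1n// lt_min r10//.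
clearbody h; have [c [d [ch dh E1]]] := second_difference x i j h sf.
have [c' [d' [c'h d'h E2]]] := second_difference x j i h sf.
have E : partial j (partial i f) (x + c *: e_ i + d *: e_ j) =
    partial i (partial j f) (x + c' *: e_ j + d' *: e_ i).
  apply: (mulfI (lt0r_neq0 h0)); apply: (mulfI (lt0r_neq0 h0)).
  have swap (a b b' d0 : R) : a - b - (b' - d0) = a - b' - (b - d0) by ring.
  rewrite -[LHS]E1 -[RHS]E2.
  rewrite (addrAC x (h *: e_ i)).
  exact: swap.
have := close _ _ ch dh; rewrite lt_min => /andP[_ /h2 b2].
have := close _ _ d'h c'h; rewrite lt_min addrAC => /andP[/h1 b1 _].
rewrite /= -E in b1; rewrite /= distrC in b2.
have := le_trans (ler_distD _ _ _) (lerD b1 b2).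
have : 0 < `|partial i (partial j f) x - partial j (partial i f) x|.
  by rewrite normr_gt0 subr_eq0.
have third (a : R) : 0 < a -> a <= a / 3 + a / 3 -> false by clear; lra.
exact: third.
Qed.

Lemma partials_smooth f l : smooth f -> smooth (partials l f).
Proof. by move=> sf m; rewrite /partials -foldr_cat; exact: sf. Qed.

Lemma partials_perm f l1 l2 : smooth f -> perm_eq l1 l2 ->
  partials l1 f = partials l2 f.
Proof.
move=> sf; elim: l1 l2 => [|i l1 IH] l2; first by rewrite perm_sym => /perm_nilP ->.
move=> p; have il2 : i \in l2 by rewrite -(perm_mem p) mem_head.
have {il2} [a [b l2E]] : exists a b, l2 = a ++ i :: b.
  by case/path.splitPr: il2 => a b; exists a, b.
move: p; rewrite {}l2E => p.
have /IH /= -> : perm_eq l1 (a ++ b).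
  by rewrite -(perm_cons i) (permPl p) -cat1s perm_catCA.
elim: a {p IH} => //= k a <-.
by rewrite partialC//; exact: partials_smooth.
Qed.

(** Carries bounds stated for multi-indices over to arbitrary lists of derivations, which are more
    convenient since one more derivative is one more list entry. *)
Lemma partials_mpartial f l : smooth f ->
  partials l f = mpartial [ffun i => count_mem i l] f.
Proof.
move=> sf; apply: partials_perm => //; apply/allP => k _ /=; apply/eqP.
rewrite count_flatten -map_comp sumnE big_map big_enum/= (bigD1 k)//=.
rewrite count_nseq/= eqxx mul1n ffunE big1 ?addn0// => i ik.
by rewrite count_nseq/= (negbTE ik).
Qed.

End clairaut.

(** * Borel measurability of continuous functions on R^n *)

Section measurable_rV.
Context {R : realType} {n : nat}.

(** The sigma-algebra is generated by the coordinates whereas continuity refers to the topology. An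
    open set is the union of the grid cells it contains, and the cells, indexed by an integer vector
    and a mesh, are countably many. *)
Lemma open_measurable_rV (U : set 'rV[R]_n) : open U -> measurable U.
Proof.
move=> oU.
pose cube (p : 'rV[int]_n * nat) : set 'rV[R]_n :=
  [set x | forall i, Num.floor (p.2.+1%:R * x ord0 i) = p.1 ord0 i].
have mcube p : measurable (cube p).
  rewrite (_ : cube p = \bigcap_(i in [set: 'I_n])
      (rV_coord i @^-1` [set t : R | (p.1 ord0 i)%:~R <= p.2.+1%:R * t < (p.1 ord0 i + 1)%:~R])).
    apply: fin_bigcap_measurable => [|i _]; first exact: finite_finset.
    rewrite -[X in measurable X]setTI; apply: measurable_rV_coord => //.
    rewrite (_ : [set t | _] = [set` `[(p.1 ord0 i)%:~R / p.2.+1%:R,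
       (p.1 ord0 i + 1)%:~R / p.2.+1%:R[ ]).
      exact: measurable_itv.
    by apply/seteqP; split => t /=; rewrite in_itv/= ler_pdivrMr// ltr_pdivlMr// [t * _]mulrC.
  apply/seteqP; split => x /= px i; first move=> _ /=.
    by rewrite -px floor_itv.
  by apply/eqP; rewrite floor_eq; exact: px.
pose F p := if `[< cube p `<=` U >] then cube p else set0.
have -> : U = \bigcup_p F p.
  apply/seteqP; split => [x Ux|x [p _]]; last first.
    by rewrite /F; case: ifPn => // /asboolP + ?; apply.
  have /nbhs_ballP[e /= e0 eU] : nbhs x U by exact: open_nbhs_nbhs.
  (* The mesh 1/(k+1) is below [e]. Two points of one cell differ by less than the mesh in each
     coordinate, and the balls are those of the sup norm. *)
  pose k := Num.truncn e^-1.
  exists (\row_i Num.floor (k.+1%:R * x ord0 i), k) => //.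
  rewrite /F; case: ifPn => [_ i|/asboolP []]; first by rewrite mxE.
  move=> y cy; apply: eU; split => // i j; rewrite ord1 /ball/=.
  have := cy j; rewrite mxE/= => E.
  have /andP[y1 y2] := floor_itv (k.+1%:R * y ord0 j).
  have /andP[x1 x2] := floor_itv (k.+1%:R * x ord0 j).
  rewrite {}E in y1 y2; rewrite intrD in x2 y2.
  have k0 : 0 < k.+1%:R :> R by [].
  have ke : 1 < k.+1%:R * e.
    by rewrite -ltr_pdivrMr// mul1r truncnS_gt.
  rewrite -(ltr_pM2l k0); apply: lt_trans ke.
  rewrite -[X in X * _]gtr0_norm// -normrM mulrBr ltr_norml; lra.
have := @countable_bigcupT_measurable _ 'rV[R]_n ('rV[int]_n * nat)%type F.
apply; first exact: countableP.
by move=> p; rewrite /F; case: ifP.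
Qed.

Lemma continuous_measurable_rV (f : 'rV[R]_n -> R) :
  continuous f -> measurable_fun [set: 'rV[R]_n] f.
Proof.
move=> /continuousP cf; apply: (measurability _ (RGenOpens.measurableE R)).
move=> _ [_ [a [b ->] <-]]; rewrite setTI.
by apply: open_measurable_rV; exact/cf/interval_open.
Qed.

End measurable_rV.

(** * Real-valued Schwartz functions *)

Section rschwartz.
Context {R : realType} {n : nat}.
Implicit Types (f : 'rV[R]_n -> R) (x y : 'rV[R]_n).

(** The weights (1+|x|^2)^k replace the monomials and lists replace the multi-indices; the class is
    then stable under derivation simply by concatenating lists. *)
Definition rschwartz f := smooth f /\
  forall l k, exists C : R, forall x, (1 + sqn x) ^+ k * `|partials l f x| <= C.

(** One more factor 1 + |x|^2 is one more copy of the bound plus, for each [i], the bound for the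
    monomial with its [i]-th exponent raised by 2. The induction therefore has to quantify over all
    monomials. *)
Lemma monomial_decay (g : 'rV[R]_n -> R) :
  (forall b : multiindex n, exists C : R, forall x, `|monomial b x| * `|g x| <= C) ->
  forall k (b : multiindex n), exists C : R, forall x,
    (1 + sqn x) ^+ k * (`|monomial b x| * `|g x|) <= C.
Proof.
move=> gb; elim=> [|k IH] b.
  by have [C hC] := gb b; exists C => x; rewrite expr0 mul1r.
have [C0 hC0] := IH b.
pose b2 i : multiindex n := [ffun j => (b j + 2 * (j == i))%N].
have [C hC] := choice (fun i => IH (b2 i)).
exists (C0 + \sum_i C i) => x.
rewrite exprS -mulrA mulrDl mul1r lerD// /sqn mulr_suml ler_sum// => i _.
apply: le_trans (hC i x); rewrite mulrCA ler_wpM2l//.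
  by rewrite exprn_ge0// addr_ge0// sqn_ge0.
rewrite mulrA ler_wpM2r// -[X in X * _]ger0_norm ?sqr_ge0// -normrM le_eqVlt.
apply/orP; left; apply/eqP; congr `| _ |.
rewrite /monomial [RHS](eq_bigr (fun j => x ord0 j ^+ b j * x ord0 j ^+ (2 * (j == i)))).
  rewrite big_split/= mulrC; congr (_ * _).
  rewrite (bigD1 i)//= eqxx muln1 big1 ?mulr1// => j /negbTE ->.
  by rewrite muln0 expr0.
by move=> j _; rewrite ffunE exprD.
Qed.

Lemma schwartz_Re (u : 'rV[R]_n -> R[i]) : schwartz u ->
  rschwartz (fun x => complex.Re (u x)).
Proof.
move=> [[sre sim] bu]; split => // l k.
have [|C hC] := @monomial_decay (partials l (fun x => complex.Re (u x))) _ k [ffun=> 0%N].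
  move=> b; have [C hC] := bu [ffun i => count_mem i l] b.
  exists C => x; rewrite partials_mpartial//; apply: le_trans (hC _ _); last by exists x.
  by rewrite ler_wpM2l// /cmpartial /= -sqrtr_sqr ler_wsqrtr// lerDl sqr_ge0.
exists C => x; have := hC x.
by rewrite /monomial big1 ?normr1 ?mul1r// => i _; rewrite ffunE expr0.
Qed.

Lemma schwartz_Im (u : 'rV[R]_n -> R[i]) : schwartz u ->
  rschwartz (fun x => complex.Im (u x)).
Proof.
move=> [[sre sim] bu]; split => // l k.
have [|C hC] := @monomial_decay (partials l (fun x => complex.Im (u x))) _ k [ffun=> 0%N].
  move=> b; have [C hC] := bu [ffun i => count_mem i l] b.
  exists C => x; rewrite partials_mpartial//; apply: le_trans (hC _ _); last by exists x.
  by rewrite ler_wpM2l// /cmpartial /= -sqrtr_sqr ler_wsqrtr// lerDr sqr_ge0.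
exists C => x; have := hC x.
by rewrite /monomial big1 ?normr1 ?mul1r// => i _; rewrite ffunE expr0.
Qed.

Lemma rschwartz_partials f l : rschwartz f -> rschwartz (partials l f).
Proof.
move=> [sf bf]; split; first exact: partials_smooth.
by move=> m k; have := bf (m ++ l) k; rewrite /partials foldr_cat.
Qed.

Lemma rschwartz_le f k : rschwartz f ->
  exists2 C : R, 0 <= C & forall x, `|f x| <= C / (1 + sqn x) ^+ k.
Proof.
move=> [sf bf]; have [C hC] := bf [::] k.
exists C => [|x].
  by apply: le_trans (hC 0); rewrite mulr_ge0// exprn_ge0// addr_ge0// sqn_ge0.
by rewrite ler_pdivlMr ?exprn_gt0 ?ltr_pwDl ?sqn_ge0// mulrC; exact: hC.
Qed.

Lemma rschwartz_partial_le f k : rschwartz f ->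
  exists2 C : R, 0 <= C & forall i x, `|partial i f x| <= C / (1 + sqn x) ^+ k.
Proof.
move=> rf.
have /choice[C hC] i : exists C : R, 0 <= C /\
    forall x, `|partial i f x| <= C / (1 + sqn x) ^+ k.
  have [C C0 hC] := rschwartz_le k (rschwartz_partials [:: i] rf).
  by exists C.
exists (\sum_i C i) => [|i x]; first by apply: sumr_ge0 => i _; exact: (hC i).1.
apply: le_trans ((hC i).2 x) _.
rewrite ler_wpM2r ?invr_ge0 ?exprn_ge0 ?addr_ge0 ?sqn_ge0//.
by rewrite (bigD1 i)//= lerDl sumr_ge0// => j _; exact: (hC j).1.
Qed.

Lemma rschwartz_partial2_le f k : rschwartz f ->
  exists2 C : R, 0 <= C & forall i j x,
    `|partial j (partial i f) x| <= C / (1 + sqn x) ^+ k.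
Proof.
move=> rf.
have /choice[C hC] i : exists C : R, 0 <= C /\ forall j x,
    `|partial j (partial i f) x| <= C / (1 + sqn x) ^+ k.
  have [C C0 hC] := rschwartz_partial_le k (rschwartz_partials [:: i] rf).
  by exists C.
exists (\sum_i C i) => [|i j x]; first by apply: sumr_ge0 => i _; exact: (hC i).1.
apply: le_trans ((hC i).2 j x) _.
rewrite ler_wpM2r ?invr_ge0 ?exprn_ge0 ?addr_ge0 ?sqn_ge0//.
by rewrite (bigD1 i)//= lerDl sumr_ge0// => m _; exact: (hC m).1.
Qed.

End rschwartz.

(** * Size and decay of second differences *)

Section second_difference.
Context {R : realType} {n : nat}.
Implicit Types (f : 'rV[R]_n -> R) (x y : 'rV[R]_n).

Definition diff2 f x y := 2 * f x - f (x + y) - f (x - y).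

Lemma coord_sqn y i : y ord0 i ^+ 2 <= sqn y.
Proof. by rewrite /sqn (bigD1 i)//= lerDl sumr_ge0// => j _; exact: sqr_ge0. Qed.

Lemma coordM_sqn y i j : `|y ord0 i| * `|y ord0 j| <= sqn y.
Proof.
have := coord_sqn y i; have := coord_sqn y j.
rewrite -[y ord0 i ^+ 2]real_normK ?num_real// -[y ord0 j ^+ 2]real_normK ?num_real//.
have := sqr_ge0 (`|y ord0 i| - `|y ord0 j|).
by set a := `|y _ i|; set b := `|y _ j|; move=> *; nra.
Qed.

(** The mean value theorem is applied to f(x+ty) + f(x-ty), and the gradient at [x] cancels between
    the two terms. Each remaining gradient difference is again a mean value along the line, whence
    the second factor |y|. *)
Lemma diff2_le f x y (M : R) : smooth f ->
  (forall t : R, `|t| <= 1 -> forall i j, `|partial j (partial i f) (x + t *: y)| <= M) ->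
  `|diff2 f x y| <= 2 * n%:R ^+ 2 * sqn y * M.
Proof.
move=> sf bM.
have dg z (t : R) := @is_derive_line R n f x z t (fun i => (sf [:: i]).1) (fun i y => (sf [::]).2 i y).
have dpsi (t : R) := is_deriveD (dg y t) (dg (- y) t).
have [c c1 E] := MVT_dist dpsi 0 1.
rewrite !subr0 normr1 in c1.
have inc i (r : R) : `|r| <= 1 ->
    `|partial i f (x + r *: y) - partial i f x| <= \sum_j `|y ord0 j| * M.
  move=> r1.
  have dh (t : R) := @is_derive_line R n (partial i f) x y t
    (fun j => (sf [:: j; i]).1) (fun j z => (sf [:: i]).2 j z).
  have [d] := MVT_dist dh 0 r; rewrite !subr0 scale0r addr0 => dr ->.
  rewrite normrM (le_trans (ler_piMr _ r1))//.
  rewrite (le_trans (ler_norm_sum _ _ _))// ler_sum// => j _.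
  by rewrite normrM ler_wpM2l// bM// (le_trans dr).
have -> : diff2 f x y = - (\sum_i y ord0 i * (partial i f (x + c *: y) - partial i f x) -
    \sum_i y ord0 i * (partial i f (x + (- c) *: y) - partial i f x)).
  transitivity (- ((f (x + 1 *: y) + f (x + 1 *: - y)) - (f (x + 0 *: y) + f (x + 0 *: - y)))).
    by rewrite /diff2 !scale0r !scale1r !addr0; ring.
  move: E => /= ->; rewrite subr0 mulr1; congr (- _).
  rewrite -sumrB -big_split/=; apply: eq_bigr => i _.
  by rewrite mxE scalerN scaleNr; ring.
rewrite normrN (le_trans (ler_normB _ _))//.
have B (r : R) : `|r| <= 1 ->
    `|\sum_i y ord0 i * (partial i f (x + r *: y) - partial i f x)| <= n%:R ^+ 2 * sqn y * M.
  move=> r1; rewrite (le_trans (ler_norm_sum _ _ _))//.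
  apply: (@le_trans _ _ (\sum_(i < n) \sum_(j < n) sqn y * M)).
    apply: ler_sum => i _; rewrite normrM (le_trans (ler_wpM2l _ (inc i r r1)))//.
    have M0 : 0 <= M by apply: le_trans (bM 0 _ i i); rewrite ?normr0.
    by rewrite mulr_sumr ler_sum// => j _; rewrite mulrA ler_wpM2r// coordM_sqn.
  have S (a : R) : \sum_(i < n) a = n%:R * a by rewrite sumr_const card_ord mulr_natl.
  by under eq_bigr do rewrite S; rewrite S expr2 !mulrA.
by rewrite (le_trans (lerD (B _ c1) (B (- c) _)))// ?normrN//; lra.
Qed.

(** When [y] is short compared with [x], the whole segment from x-y to x+y stays at a distance from
    the origin comparable with |x|, so decay at its points is decay in [x]. *)
Lemma sqn_line_ge x y (t : R) : `|t| <= 1 -> 8 * sqn y <= sqn x ->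
  1 + sqn x <= 4 * (1 + sqn (x + t *: y)).
Proof.
move=> t1 yx.
have : sqn x <= 2 * sqn (x + t *: y) + 2 * sqn y.
  rewrite /sqn !mulr_sumr -big_split/= ler_sum// => i _; rewrite !mxE.
  have : (t * y ord0 i) ^+ 2 <= y ord0 i ^+ 2.
    by rewrite exprMn ler_piMl ?sqr_ge0// -[t ^+ 2]real_normK ?num_real// expr_le1.
  have := sqr_ge0 (x ord0 i + 2 * (t * y ord0 i)).
  by move: (x ord0 i) (y ord0 i) (t * _) => a b c; nra.
by have := sqn_ge0 y; lra.
Qed.

(** There are three regimes. For [y] short compared with [x], both [f] and its second derivatives
    decay along the segment. For the other [y] in the unit ball, [x] is bounded as well. For the
    remaining large [y], the point x+y or x-y may fall near the origin, so these two values are kept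
    as they are and are to be integrated over [y]. *)
Lemma diff2_decay f k : rschwartz f ->
  exists2 C : R, 0 <= C & forall x y, `|diff2 f x y| <=
    C * Num.min 1 (sqn y) / (1 + sqn x) ^+ k +
    (if (1 < sqn y) && (1 + sqn x <= 9 * sqn y)
     then `|f (x + y)| + `|f (x - y)| else 0).
Proof.
move=> rf; have sf := rf.1.
have [C0 C00 h0] := rschwartz_le k rf.
have [C2 C20 h2] := rschwartz_partial2_le k rf.
pose D : R := 2 * n%:R ^+ 2 * C2 + 4 * C0.
have D0 : 0 <= D by rewrite addr_ge0// !mulr_ge0.
have D2 : 2 * n%:R ^+ 2 * C2 <= D by rewrite lerDl mulr_ge0.
have D1 : 4 * C0 <= D by rewrite lerDr !mulr_ge0.
have w0 x : 0 < 1 + sqn x by rewrite ltr_pwDl ?sqn_ge0.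
have wk x : 0 < (1 + sqn x) ^+ k by rewrite exprn_gt0.
have scale (a c : R) x y : 0 <= c -> 0 < a -> 1 + sqn x <= a * (1 + sqn y) ->
    c / (1 + sqn y) ^+ k <= c * a ^+ k / (1 + sqn x) ^+ k.
  move=> c0 a0 xy; rewrite -mulrA ler_wpM2l// ler_pdivlMr// mulrC ler_pdivrMr//.
  by rewrite -exprMn lerXn2r ?nnegrE ?mulr_ge0 ?(ltW (w0 _)) ?(ltW a0).
(* If |x|^2 < 8|y|^2 and |y| <= 1, then 1 + |x|^2 <= 9; the same 9 absorbs the factor 4 of
   [sqn_line_ge]. *)
exists (D * 9 ^+ k) => [|x y]; first by rewrite mulr_ge0.
have tail0 : 0 <= (if (1 < sqn y) && (1 + sqn x <= 9 * sqn y)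
     then `|f (x + y)| + `|f (x - y)| else 0) by case: ifP => // _; rewrite addr_ge0.
have [yx|xy] := leP (8 * sqn y) (sqn x).
  rewrite -[leLHS]addr0 lerD//.
  have h49 : (4 ^+ k : R) <= 9 ^+ k by rewrite lerXn2r ?nnegrE// ler_nat.
  have near (t : R) : `|t| <= 1 -> 1 + sqn x <= 4 * (1 + sqn (x + t *: y)).
    by move=> t1; exact: sqn_line_ge.
  have B1 : `|diff2 f x y| <= D * 9 ^+ k / (1 + sqn x) ^+ k.
    apply: (@le_trans _ _ (4 * C0 * 9 ^+ k / (1 + sqn x) ^+ k)); last first.
      by rewrite ler_wpM2r ?invr_ge0 ?(ltW (wk _))// ler_wpM2r ?exprn_ge0.
    have b (t : R) : `|t| <= 1 -> `|f (x + t *: y)| <= C0 * 9 ^+ k / (1 + sqn x) ^+ k.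
      move=> t1; apply: le_trans (h0 _) _; apply: scale => //.
      by rewrite (le_trans (near t t1))// ler_wpM2r ?(ltW (w0 _))// ler_nat.
    have b0 := b 0; rewrite scale0r addr0 normr0 in b0.
    have b1 := b 1; rewrite scale1r normr1 in b1.
    have b2 := b (-1); rewrite scaleN1r normrN1 in b2.
    have {b0} b0 := b0 ler01; have {b1} b1 := b1 (lexx _); have {b2} b2 := b2 (lexx _).
    rewrite /diff2 (le_trans (ler_normB _ _))// (le_trans (lerD (ler_normB _ _) (lexx _)))//.
    rewrite normrM [`|2|]ger0_norm//.
    by move: b0 b1 b2; set a := `|f x|; set a1 := `|_|; set a2 := `|_|; lra.
  have B2 : `|diff2 f x y| <= D * 9 ^+ k * sqn y / (1 + sqn x) ^+ k.
    have := @diff2_le f x y (C2 * 9 ^+ k / (1 + sqn x) ^+ k) sf.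
    move=> /(_ _)/le_trans; apply.
      move=> t t1 i j; apply: le_trans (h2 _ _ _) _; apply: scale => //.
      by rewrite (le_trans (near t t1))// ler_wpM2r ?(ltW (w0 _))// ler_nat.
    rewrite !mulrA ler_wpM2r ?invr_ge0 ?(ltW (wk _))//.
    rewrite [leRHS]mulrAC ler_wpM2r ?exprn_ge0//.
    by rewrite mulrAC ler_wpM2r ?sqn_ge0// -[2 * _ * _]mulrA.
  by rewrite -mulrA [_ * _^-1]mulrC /Num.min; case: ifP => _; rewrite ?mulr1 ?mulrA// mulrAC.
have [y1|y1] := leP (sqn y) 1.
  rewrite -[leLHS]addr0 lerD//.
  have := @diff2_le f x y C2 sf.
  move=> /(_ _)/le_trans; apply.
    move=> t t1 i j; apply: le_trans (h2 _ _ _) _.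
    by rewrite ler_pdivrMr// ler_peMr// exprn_ege1// lerDl sqn_ge0.
  rewrite ler_pdivlMr//.
  rewrite [2 * _ * _ * _]mulrAC -[leLHS]mulrA [leRHS]mulrAC -[leRHS]mulrA.
  rewrite ler_pM// ?mulr_ge0 ?sqn_ge0 ?exprn_ge0 ?(ltW (w0 _))//.
  rewrite ler_wpM2l ?sqn_ge0// lerXn2r ?nnegrE ?(ltW (w0 _))//; lra.
rewrite [if _ then _ else _]ifT; last by rewrite /=; lra.
rewrite mulr1 /diff2 (le_trans (ler_normB _ _))// (le_trans (lerD (ler_normB _ _) (lexx _)))//.
rewrite -addrA lerD// normrM [`|2|]ger0_norm//.
apply: le_trans (ler_wpM2l _ (h0 x)) _ => //.
rewrite mulrA ler_wpM2r ?invr_ge0 ?(ltW (wk _))//.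
have : 1 <= (9 ^+ k : R) by rewrite exprn_ege1// ler1n.
by move: D1; nra.
Qed.

End second_difference.

(** * The fractional Laplacian of a real Schwartz function *)

Section real_fractional_laplacian.
Context {R : realType} {n : nat} (m : R).
Implicit Types (f : 'rV[R]_n -> R) (x y : 'rV[R]_n).
Hypotheses (n2m : n%:R / 2 < m) (m1n : m - 1 < n%:R / 2) (m1 : 1 < m).
Local Notation lam := (lebesgue_rV R n).

Definition rker y : R := sqn y `^ (- m).

Definition rlap f x : R := \int[lam]_y (diff2 f x y * rker y).

Lemma rker_ge0 y : 0 <= rker y. Proof. exact: powR_ge0. Qed.

Lemma measurable_rker : measurable_fun setT rker.
Proof.
by apply: (measurableT_comp (measurable_powR (- m))); exact: measurable_sqn.
Qed.

(** At the origin |y|^2 lowers the exponent to m - 1 < n/2, and at infinity m > n/2 suffices. With m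
    = n/2 + s these are the conditions s < 1 and s > 0. *)
Lemma integrable_min_rker : lam.-integrable setT
  (EFin \o (fun y => Num.min 1 (sqn y) * rker y)).
Proof.
apply: (@integrable_rV_powR_sqn _ _ (m - 1) m 1) => //.
- by rewrite subr_gt0.
- apply: measurable_funM; last exact: measurable_rker.
  by apply: measurable_minr => //; exact: measurable_sqn.
- move=> x x1; rewrite ger0_norm; last first.
    by rewrite mulr_ge0 ?rker_ge0// le_min ler01 sqn_ge0.
  have -> : Num.min 1 (sqn x) = sqn x by apply/min_idPr.
  rewrite mul1r /rker; have [->|x0] := eqVneq (sqn x) 0.
    by rewrite mul0r powR_ge0.
  rewrite -{1}(powRr1 (sqn_ge0 x)) -powRD ?x0 ?implybT//.
  by rewrite opprB.
- move=> x x1; rewrite ger0_norm; last first.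
    by rewrite mulr_ge0 ?rker_ge0// le_min ler01 sqn_ge0.
  have -> : Num.min 1 (sqn x) = 1 by apply/min_idPl.
  by [].
Qed.

Lemma measurable_translate f (x : 'rV[R]_n) (c : R) : continuous f ->
  measurable_fun setT (fun y : 'rV[R]_n => f (x + c *: y)).
Proof.
move=> cf; apply: (@measurableT_comp _ _ _ _ _ _ f _ (fun y : 'rV[R]_n => x + c *: y)).
  exact: continuous_measurable_rV.
exact: measurable_rV_affine.
Qed.

Lemma diff2E f x y : diff2 f x y = 2 * f x - f (x + 1 *: y) - f (x + (- 1) *: y).
Proof. by rewrite scale1r scaleN1r. Qed.

Lemma measurable_diff2 f x : continuous f -> measurable_fun setT (diff2 f x).
Proof.
move=> cf; rewrite (funext (diff2E f x)).
by apply: measurable_funB; [apply: measurable_funB => //|]; exact: measurable_translate.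
Qed.

Lemma rschwartz_continuous f : rschwartz f -> continuous f.
Proof. by move=> rf; exact: (rf.1 [::]).1. Qed.

Lemma diff2_le_min f : rschwartz f -> exists2 C : R, 0 <= C &
  forall x y, `|diff2 f x y| <= C * Num.min 1 (sqn y).
Proof.
move=> rf; have [C C0 hC] := rschwartz_le 0 rf.
have [D D0 hD] := diff2_decay 0 rf.
exists (D + 2 * C) => [|x y]; first by rewrite addr_ge0// mulr_ge0.
apply: le_trans (hD x y) _; rewrite expr0 divr1 (mulrDl D); apply: lerD => //.
have [y1|y1] := leP (sqn y) 1; first by rewrite !mulr_ge0// sqn_ge0.
rewrite /= mulr1; case: ifP => _; last by rewrite mulr_ge0.
have := hC (x + y); have := hC (x - y); rewrite !expr0 !divr1.
by set a := `|f (x - y)|; set b := `|f (x + y)|; lra.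
Qed.

Lemma integrable_diff2 f x : rschwartz f ->
  lam.-integrable setT (EFin \o (fun y => diff2 f x y * rker y)).
Proof.
move=> rf; have [C C0 hC] := diff2_le_min rf.
apply: le_integrable (integrableZl measurableT C integrable_min_rker) => //.
- apply/measurable_EFinP; apply: measurable_funM; last exact: measurable_rker.
  by apply: measurable_diff2; exact: rschwartz_continuous.
- move=> y _ /=; rewrite lee_fin normrM [`|rker y|]ger0_norm ?rker_ge0//.
  rewrite [leRHS]ger0_norm; last first.
    by rewrite !mulr_ge0 ?rker_ge0// le_min ler01 sqn_ge0.
  by rewrite mulrA ler_wpM2r ?rker_ge0.
Qed.

Lemma integral_translate f x (c : R) : continuous f -> `|c| = 1 ->
  (\int[lam]_y `|f (x + c *: y)|%:E = \int[lam]_y `|f y|%:E)%E.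
Proof.
move=> cf c1; have c0 : c != 0 by rewrite -normr_eq0 c1 oner_eq0.
rewrite [RHS](ge0_integral_rV_affine x c0)//; last first.
  by apply/measurable_EFinP; apply: measurableT_comp => //; exact: continuous_measurable_rV.
by rewrite c1 expr1n mul1e.
Qed.

Lemma rschwartz_integrable f : rschwartz f -> lam.-integrable setT (EFin \o f).
Proof.
move=> rf; pose k := (Num.truncn m).+1.
have [C C0 hC] := rschwartz_le k rf.
have i : lam.-integrable setT (EFin \o (fun x : 'rV[R]_n => (1 + sqn x) `^ (- m))).
  apply/integrableP; split; first by apply/measurable_EFinP; exact: measurable_powR_sqn.
  under eq_integral do rewrite /= ger0_norm ?powR_ge0//.
  exact: integral_powR_sqnD1_lty.
apply: le_integrable (integrableZl measurableT C i) => //.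
  by apply/measurable_EFinP; apply: continuous_measurable_rV; exact: rschwartz_continuous.
move=> x _ /=; rewrite lee_fin [leRHS]ger0_norm ?mulr_ge0 ?powR_ge0//.
apply: le_trans (hC x) _; rewrite ler_wpM2l// powRN.
have x1 : 1 <= 1 + sqn x by rewrite lerDl sqn_ge0.
have x0 : 0 < 1 + sqn x by rewrite (lt_le_trans _ x1).
rewrite lef_pV2 ?posrE ?powR_gt0 ?exprn_gt0//.
by rewrite -powR_mulrn ?(ltW x0)// ler_powR// ltW// truncnS_gt.
Qed.

(* The absolutely convergent form of the estimate (-Delta)^s f = O(|x|^(-n-2s)). *)
Lemma integral_diff2_decay f : rschwartz f -> exists2 C : R, 0 <= C &
  forall x, (\int[lam]_y (`|diff2 f x y| * rker y)%:E <=
    (C * (1 + sqn x) `^ (- m))%:E)%E.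
Proof.
move=> rf; pose k := (Num.truncn m).+1.
have cf := rschwartz_continuous rf.
have [C C0 hC] := diff2_decay k rf.
have m0 : 0 < m by rewrite (lt_trans _ m1).
have fI : (\int[lam]_y `|f y|%:E)%E \is a fin_num.
  have /integrableP[_] := rschwartz_integrable rf.
  by rewrite ge0_fin_numE// integral_ge0.
have kI := integrable_fin_num measurableT integrable_min_rker.
pose I := fine (\int[lam]_y `|f y|%:E).
pose K := fine (\int[lam]_y (Num.min 1 (sqn y) * rker y)%:E).
have I0 : 0 <= I by apply: fine_ge0; exact: integral_ge0.
have K0 : 0 <= K.
  apply: fine_ge0; apply: integral_ge0 => y _.
  by rewrite lee_fin mulr_ge0 ?rker_ge0// le_min ler01 sqn_ge0.
have mf c x : measurable_fun setT (fun y : 'rV[R]_n => `|f (x + c *: y)|).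
  by apply: measurableT_comp => //; exact: measurable_translate.
exists (C * K + 9 `^ m * (I + I)) => [|x].
  by rewrite addr_ge0// mulr_ge0 ?powR_ge0// addr_ge0.
have w1 : 1 <= 1 + sqn x by rewrite lerDl sqn_ge0.
have w0 : 0 < 1 + sqn x by rewrite (lt_le_trans _ w1).
pose W := (1 + sqn x) `^ (- m).
have W0 : 0 <= W by rewrite powR_ge0.
(* The tail term of [diff2_decay] lives where 1 + |x|^2 <= 9|y|^2. There the kernel is at most 9^m
   (1+|x|^2)^(-m), and by translation invariance |f(x+y)| and |f(x-y)| integrate over y to a
   constant. *)
apply: (@le_trans _ _ (\int[lam]_y
   ((C * W)%:E * (Num.min 1 (sqn y) * rker y)%:E +
    (9 `^ m * W)%:E * (`|f (x + 1 *: y)|%:E + `|f (x + (-1) *: y)|%:E)))%E).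
  apply: ge0_le_integral => //.
  - by move=> y _; rewrite lee_fin mulr_ge0 ?rker_ge0.
  - apply/measurable_EFinP; apply: measurable_funM; last exact: measurable_rker.
    by apply: measurableT_comp => //; exact: measurable_diff2.
  - apply: emeasurable_funD; apply: measurable_funeM.
      exact: measurable_int integrable_min_rker.
    by apply: emeasurable_funD; exact/measurable_EFinP.
  - move=> y _; rewrite -[leRHS]/((C * W * (Num.min 1 (sqn y) * rker y) +
      9 `^ m * W * (`|f (x + 1 *: y)| + `|f (x + (-1) *: y)|))%:E).
    rewrite lee_fin scale1r scaleN1r.
    apply: le_trans (ler_wpM2r (rker_ge0 y) (hC x y)) _.
    rewrite mulrDl lerD//.
      rewrite -mulrA mulrAC [leRHS]mulrACA -mulrA [X in C * X]mulrC.
      rewrite [leRHS](_ : _ = C * (Num.min 1 (sqn y) * rker y) * W); last by ring.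
      rewrite [leLHS](_ : _ = C * (Num.min 1 (sqn y) * rker y) / (1 + sqn x) ^+ k); last by ring.
      rewrite ler_wpM2l ?mulr_ge0 ?rker_ge0//; first by rewrite le_min ler01 sqn_ge0.
      rewrite /W powRN lef_pV2 ?posrE ?powR_gt0 ?exprn_gt0//.
      by rewrite -powR_mulrn ?(ltW w0)// ler_powR// ltW// truncnS_gt.
    case: ifP => [/andP[y1 xy]|_]; last first.
      by rewrite mul0r !mulr_ge0 ?powR_ge0// addr_ge0.
    rewrite mulrC ler_wpM2r ?addr_ge0//.
    have y0 : 0 < sqn y by rewrite (lt_trans _ y1).
    rewrite /rker /W !powRN ler_pdivlMr ?powR_gt0// mulrC ler_pdivrMr ?powR_gt0//.
    rewrite -powRM ?(ltW y0)//.
    by rewrite ge0_ler_powR ?nnegrE ?(ltW m0) ?(ltW w0) ?mulr_ge0 ?(ltW y0).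
rewrite ge0_integralD//; last 4 first.
- by move=> y _; rewrite -EFinM lee_fin !mulr_ge0 ?rker_ge0 ?powR_ge0// le_min ler01 sqn_ge0.
- by apply: measurable_funeM; exact: measurable_int integrable_min_rker.
- by move=> y _; rewrite -EFinD -EFinM lee_fin !mulr_ge0 ?powR_ge0// addr_ge0.
- by apply: measurable_funeM; apply: emeasurable_funD; exact/measurable_EFinP.
rewrite ge0_integralZl//; last 3 first.
- exact: measurable_int integrable_min_rker.
- by move=> y _; rewrite lee_fin mulr_ge0 ?rker_ge0// le_min ler01 sqn_ge0.
- by rewrite lee_fin mulr_ge0.
rewrite ge0_integralZl//; last 3 first.
- by apply: emeasurable_funD; exact/measurable_EFinP.
- by move=> y _; rewrite -EFinD lee_fin addr_ge0.
- by rewrite lee_fin mulr_ge0 ?powR_ge0.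
rewrite ge0_integralD//; last 2 first.
- exact/measurable_EFinP.
- exact/measurable_EFinP.
rewrite !integral_translate ?normr1 ?normrN1//.
rewrite -(fineK fI) -(fineK kI) -/I -/K.
rewrite -[leLHS]/((C * W * K + 9 `^ m * W * (I + I))%:E) lee_fin.
by rewrite le_eqVlt; apply/orP; left; apply/eqP; rewrite -/W; ring.
Qed.

Lemma rlap_decay f : rschwartz f -> exists2 C : R, 0 <= C &
  forall x, `|rlap f x| <= C * (1 + sqn x) `^ (- m).
Proof.
move=> rf; have [C C0 hC] := integral_diff2_decay rf.
exists C => // x; rewrite -lee_fin; apply: le_trans (hC x).
rewrite EFin_normr_Rintegral//; last exact: integrable_diff2.
apply: le_trans (le_abse_integral _ _ _) _ => //.
  exact: measurable_int (integrable_diff2 x rf).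
rewrite le_eqVlt; apply/orP; left; apply/eqP; apply: eq_integral => y _.
by rewrite /= normrM [`|rker y|]ger0_norm ?rker_ge0.
Qed.

Lemma rlap_le f : rschwartz f -> exists2 C : R, 0 <= C & forall x, `|rlap f x| <= C.
Proof.
move=> rf; have [C C0 hC] := rlap_decay rf; exists C => // x.
apply: le_trans (hC x) _; rewrite ler_piMr// -[leRHS](powRr0 (1 + sqn x)).
by rewrite ler_powR ?lerDl ?sqn_ge0// oppr_le0 ltW// (lt_trans _ m1).
Qed.

(** Differentiation under the integral sign. By [diff2_le_min] for [partial i f], the derivative of
    the integrand is dominated by a multiple of min(1,|y|^2) |y|^(-2m), independently of the base
    point. *)
Lemma is_derive_rlap f i x : rschwartz f ->
  is_derive x (delta_mx ord0 i) (rlap f) (rlap (partial i f) x).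
Proof.
move=> rf; pose e : 'rV[R]_n := delta_mx ord0 i.
have rpf : rschwartz (partial i f) := rschwartz_partials [:: i] rf.
have [C C0 hC] := diff2_le_min rpf.
have df y : derivable f y e by exact: (rf.1 [::]).2.
pose g (t : R) y := diff2 f (x + t *: e) y * rker y.
have dg (t : R) y : is_derive t 1 (g^~ y) (diff2 (partial i f) (x + t *: e) y * rker y).
  have d z := is_derive_coord z df t.
  have := is_deriveZ (rker y) (is_deriveB (is_deriveB (is_deriveZ 2 (d x)) (d (x + y))) (d (x - y))).
  congr (is_derive _ _ _ _).
    apply/funext => u.
    transitivity (rker y * (2 * f (x + u *: e) - f (x + y + u *: e) - f (x - y + u *: e))) => //.
    by rewrite /g /diff2 mulrC (addrAC x y) (addrAC x (- y)).
  transitivity (rker y * (2 * partial i f (x + t *: e) -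
    partial i f (x + y + t *: e) - partial i f (x - y + t *: e))) => //.
  by rewrite /diff2 mulrC (addrAC x y) (addrAC x (- y)).
have p1 t y : partial1of2 g t y = diff2 (partial i f) (x + t *: e) y * rker y.
  by rewrite partial1of2E; have := dg t y => dgty; rewrite derive_val.
have I0 : `]-1, 1[%classic (0 : R) by rewrite /= in_itv/= ltrN10 ltr01.
have ig t : `]-1, 1[%classic t -> lam.-integrable setT (EFin \o g t).
  by move=> _; exact: integrable_diff2.
have dgd t y : `]-1, 1[%classic t -> setT y -> derivable (g^~ y) t 1.
  by move=> _ _; exact: (@ex_derive _ _ _ _ _ _ _ (dg t y)).
pose G y := C * (Num.min 1 (sqn y) * rker y).
have G0 y : 0 <= G y by rewrite !mulr_ge0 ?rker_ge0// le_min ler01 sqn_ge0.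
have iG : lam.-integrable setT (EFin \o G) := integrableZl measurableT C integrable_min_rker.
have gG t y : `]-1, 1[%classic t -> setT y -> `|partial1of2 g t y| <= G y.
  move=> _ _; rewrite p1 normrM [`|rker y|]ger0_norm ?rker_ge0//.
  by rewrite /G mulrA ler_wpM2r ?rker_ge0.
have E1 := differentiation_under_integral measurableT I0 ig dgd G0 iG gG.
have D1 := derivable_under_integral measurableT I0 ig dgd G0 iG gG.
have E : (fun t : R => rlap f (t *: e + x)) = (fun t => \int[lam]_y g t y).
  by apply/funext => t; rewrite /g addrC.
apply: DeriveDef; first by apply/derivable1P; rewrite E.
rewrite [LHS](_ : _ = (fun t : R => rlap f (t *: e + x))^`()%classic 0).
  rewrite E E1; apply: eq_Rintegral => y _.
  by rewrite p1 scale0r addr0.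
have EQ : (fun h : R => h^-1 *: ((rlap f \o shift x) (h *: e) - rlap f x)) =
    (fun h => h^-1 *: (((fun t : R => rlap f (t *: e + x)) \o shift 0) (h *: 1) -
      (fun t : R => rlap f (t *: e + x)) 0)).
  apply/funext => h /=.
  by rewrite [h *: 1]mulr1 addr0 scale0r add0r.
by rewrite derive1E /derive -/e EQ.
Qed.

Lemma partial_rlap f i : rschwartz f -> partial i (rlap f) = rlap (partial i f).
Proof.
by move=> rf; apply/funext => x; have d := is_derive_rlap i x rf; rewrite /partial derive_val.
Qed.

(** Moving one coordinate at a time, the mean value theorem gives a Lipschitz bound. Continuity of
    all derivatives of [rlap f] thus follows from the boundedness of the next ones. *)
Lemma bounded_partials_continuous (g : 'rV[R]_n -> R) (M : R) : 0 <= M ->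
  (forall i y, derivable g y (delta_mx ord0 i)) ->
  (forall i y, `|partial i g y| <= M) -> continuous g.
Proof.
move=> M0 dg bg x.
have H (l : seq 'I_n) (h : 'rV[R]_n) :
    `|g (x + \sum_(i <- l) h ord0 i *: delta_mx ord0 i) - g x| <=
    \sum_(i <- l) `|h ord0 i| * M.
  elim: l => [|i l IH]; first by rewrite !big_nil addr0 subrr normr0.
  rewrite !big_cons addrCA addrC; set z := x + _.
  have [d _ E] := MVT_coord z (h ord0 i) (dg i).
  rewrite (_ : _ - g x = (g (z + h ord0 i *: delta_mx ord0 i) - g z) + (g z - g x)); last by ring.
  by rewrite (le_trans (ler_normD _ _))// lerD// E normrM ler_wpM2l.
apply/(@cvgrPdist_lt _ _ _ _ (nbhs_filter (x : 'rV[R]_n))) => e e0.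
pose d := e / (n%:R * M + 1).
have N0 : 0 < n%:R * M + 1 by rewrite ltr_wpDl// mulr_ge0.
have d0 : 0 < d by rewrite divr_gt0.
apply/nbhs_ballP; exists d => //= y [_ xy].
rewrite distrC (_ : y = x + \sum_i (y - x) ord0 i *: delta_mx ord0 i); last first.
  by rewrite -row_sum_delta addrC subrK.
apply: le_lt_trans (H _ _) _; apply: (@le_lt_trans _ _ (\sum_(i < n) d * M)).
  apply: ler_sum => i _; rewrite ler_wpM2r// !mxE distrC.
  by have := xy ord0 i; rewrite /ball/= => /ltW.
rewrite sumr_const card_ord -mulr_natl mulrCA /d mulrAC ltr_pdivrMr//.
by rewrite ltr_pM2l// ltrDl.
Qed.

Lemma partials_rlap f l : rschwartz f -> partials l (rlap f) = rlap (partials l f).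
Proof.
move=> rf; elim: l => //= i l ->; rewrite partial_rlap//.
exact: rschwartz_partials.
Qed.

Lemma rlap_smooth f : rschwartz f -> smooth (rlap f).
Proof.
move=> rf l; rewrite partials_rlap//; have rl := rschwartz_partials l rf.
have dl i x := is_derive_rlap i x rl.
split; last by move=> i x; exact: (@ex_derive _ _ _ _ _ _ _ (dl i x)).
have /choice[C hC] i : exists C : R, 0 <= C /\ forall x, `|rlap (partial i (partials l f)) x| <= C.
  by have [C C0 hC] := rlap_le (rschwartz_partials [:: i] rl); exists C.
apply: (@bounded_partials_continuous _ (\sum_i C i)).
- by apply: sumr_ge0 => i _; exact: (hC i).1.
- by move=> i x; exact: (@ex_derive _ _ _ _ _ _ _ (dl i x)).
- move=> i x; rewrite partial_rlap//; apply: le_trans ((hC i).2 x) _.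
  by rewrite (bigD1 i)//= lerDl sumr_ge0// => j _; exact: (hC j).1.
Qed.

End real_fractional_laplacian.

(** * The Beta kernel *)

Section beta_kernel.
Context {R : realType}.
Local Notation mu := (@lebesgue_measure R).

Lemma integral_oc_derive (f F : R -> R) (A b : R) : 0 < b ->
  (forall t : R, 0 < t -> is_derive t 1 F (f t)) ->
  (forall t : R, 0 < t -> {for t, continuous f}) ->
  (forall t : R, 0 < t -> 0 <= f t) ->
  F (b / k.+1%:R) @[k --> \oo] --> A ->
  (\int[mu]_(t in `]0%R, b]) (f t)%:E = (F b - A)%:E)%E.
Proof.
move=> b0 dF cf f0 FA.
pose I k : set R := `[b / k.+1%:R, b]%classic.
have mI k : measurable (I k) by exact: measurable_itv.
have pos k (t : R) : I k t -> 0 < t.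
  by rewrite /I/= in_itv/= => /andP[+ _]; apply: lt_le_trans; rewrite divr_gt0.
have I_bigcup : \bigcup_k I k = `]0, b]%classic.
  apply/seteqP; split => [t [k _ kt] | t] /=; rewrite in_itv/=.
    by rewrite (pos k)//=; move: kt; rewrite /I/= in_itv/= => /andP[].
  move=> /andP[t0 tb]; exists (Num.truncn (b / t)) => //.
  rewrite /I/= in_itv/= tb andbT ler_pdivrMr// mulrC -ler_pdivrMr//.
  exact/ltW/truncnS_gt.
have I_nd : nondecreasing_seq I.
  move=> i j ij; apply/subsetPset => t; rewrite /I/= !in_itv/= => /andP[+ ->].
  rewrite andbT; apply: le_trans; rewrite ler_wpM2l ?(ltW b0)//.
  by rewrite lef_pV2 ?posrE// ler_nat ltnS.
have mf : measurable_fun (`]0, +oo[%classic : set R) f.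
  apply: open_continuous_measurable_fun => //.
  by move=> t; rewrite inE/= in_itv/= andbT; exact: cf.
rewrite -I_bigcup.
have := @ge0_nondecreasing_set_cvg_integral _ (measurableTypeR R) _ I (EFin \o f) mu I_nd mI.
move=> /(_ _ _)/cvg_lim <-//; last 2 first.
- move=> k; apply/measurable_EFinP; apply: measurable_funS mf => //.
  by move=> t /pos/=; rewrite in_itv/= andbT.
- by move=> k t /pos t0; rewrite lee_fin; exact: f0.
rewrite (_ : (fun _ => _) = fun k => (F b - F (b / k.+1%:R))%:E).
  apply/cvg_lim => //; apply: cvg_EFin; first exact: nearW.
  by apply: cvgB => //; exact: cvg_cst.
apply/funext => k; rewrite /I (@integral_segment_derive _ f F)// ?divr_gt0//.
by rewrite ler_pdivrMr// ler_peMr ?(ltW b0)// ler1n.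
Qed.

Lemma integral_hpow_le (s b : R) : 0 < s -> 0 < b ->
  (\int[mu]_t (if (t <= b)%R then (hpow s t)%:E else 0) = (b `^ s / s)%:E)%E.
Proof.
move=> s0 b0.
pose f (t : R) := expR ((s - 1) * ln t + 0 * ln (1 + t)).
pose F (t : R) := expR (s * ln t + 0 * ln (1 + t)).
have FE t : 0 < t -> F t = t `^ s.
  by move=> t0; rewrite /F mul0r addr0 /powR gt_eqF.
have dF (t : R) : 0 < t -> is_derive t 1 (s^-1 \*: F) (f t).
  move=> t0; have := is_deriveZ s^-1 (is_derive_expR_lin_ln s 0 t0).
  congr is_derive; transitivity (s^-1 * (F t * (s / t + 0 / (1 + t)))) => //.
  rewrite /f (_ : (s - 1) * _ + _ = (s * ln t + 0 * ln (1 + t)) + - ln t); last by ring.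
  rewrite expRD expRN lnK ?posrE// -/(F t); field.
  by rewrite !gt_eqF ?addr_gt0.
have cf (t : R) : 0 < t -> {for t, continuous f}.
  by move=> t0; exact: (is_derive_continuous (is_derive_expR_lin_ln (s - 1) 0 t0)).
have f0 (t : R) : 0 < t -> 0 <= f t by move=> _; exact: expR_ge0.
have F0 : (s^-1 \*: F) (b / k.+1%:R) @[k --> \oo] --> (0 : R).
  rewrite (_ : (fun _ => _) = fun k => s^-1 * (b / k.+1%:R) `^ s); last first.
    by apply/funext => k; rewrite -FE// divr_gt0.
  rewrite -[X in _ --> X](mulr0 s^-1); apply: cvgMr.
  have /cvg_at_rightP := @powR_cvg0 R s s0.
  apply; split; first by move=> k; rewrite divr_gt0.
  rewrite -[X in _ --> X](mulr0 b); apply: cvgMr.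
  exact: cvg_harmonic.
have := integral_oc_derive b0 dF cf f0 F0.
rewrite subr0 -[(s^-1 \*: F) b]/(s^-1 * F b) FE// mulrC => <-.
rewrite [RHS]integral_mkcond; apply: eq_integral => t _.
rewrite patchE mem_setE in_itv/= /hpow.
case: (ltP 0 t) => t0 /=; last by case: ifP.
by case: ifP => // _; rewrite /f mul0r addr0 /powR gt_eqF.
Qed.

(** For positive [a] and [b] this is the indicator of c <= r < a with c = ab/(a+b), cleared of its
    denominator. *)
Definition beta_region (r a b : R) : R :=
  if (r < a) && (a * b <= r * (a + b)) then 1 else 0.

Lemma beta_region_ge0 r a b : 0 <= beta_region r a b.
Proof. by rewrite /beta_region; case: ifP. Qed.

(** For a > r the condition on [b] reads b <= ra/(a-r), and the integral in [b] is (ra/(a-r))^s / s.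
    With a = r+v, what remains is r^s / s times the Beta integral of v^(-s) / (r+v), which is
    proportional to r^(-s): the powers of [r] cancel. *)
Lemma beta_kernel_integral (s r : R) : 0 < s -> s < 1 -> 0 < r ->
  (\int[mu]_a \int[mu]_b (hpow (- s) a * hpow s b * beta_region r a b)%:E =
   (Gamma (1 - s) * Gamma s / (Gamma 1 * s))%:E)%E.
Proof.
move=> s0 s1 r0.
have Ga : 0 < Gamma (1 : R) by exact: Gamma_gt0.
pose C := r `^ s / s.
have C0 : 0 <= C by rewrite mulr_ge0 ?powR_ge0 ?invr_ge0 ?ltW.
have mg : measurable_fun setT (fun v : R => (hpow (1 - s) v * (r + v) `^ (- 1))%:E).
  apply/measurable_EFinP; apply: measurable_funM; first exact: measurable_hpow.
  apply: (measurableT_comp (measurable_powR _)); exact: measurable_funD.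
have g0 v : (0 <= (hpow (1 - s) v * (r + v) `^ (- 1))%:E)%E.
  by rewrite lee_fin mulr_ge0 ?hpow_ge0 ?powR_ge0.
transitivity (\int[mu]_a (C%:E *
    (hpow (1 - s) (- r + 1 * a) * (r + (- r + 1 * a)) `^ (- 1))%:E))%E.
  apply: eq_integral => a _; rewrite mul1r addNKr [- r + a]addrC.
  have [ra|ar] := ltP r a; last first.
    rewrite [hpow (1 - s) _]/hpow subr_gt0 ltNge ar mul0r mule0 integral0_eq// => b _.
    by rewrite /beta_region ltNge ar mulr0.
  have a0 : 0 < a by rewrite (lt_trans r0).
  have ar0 : 0 < a - r by rewrite subr_gt0.
  transitivity (\int[mu]_b ((hpow (- s) a)%:E *
      (if (b <= r * a / (a - r))%R then (hpow s b)%:E else 0)))%E.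
    apply: eq_integral => b _; rewrite /beta_region ra /= ler_pdivlMr//.
    rewrite (_ : (a * b <= _) = (b * (a - r) <= r * a)); last by apply/idP/idP; lra.
    by case: ifP => _; rewrite ?mulr1 ?mulr0 ?mule0// EFinM.
  rewrite ge0_integralZl//; last 3 first.
  - apply: measurable_fun_ifT => //; first exact: measurable_fun_ler.
    by apply/measurable_EFinP; exact: measurable_hpow.
  - by move=> b _; case: ifP => // _; rewrite lee_fin hpow_ge0.
  - by rewrite lee_fin hpow_ge0.
  rewrite integral_hpow_le ?divr_gt0 ?mulr_gt0// -!EFinM /hpow a0 ar0.
  rewrite /C !powRM ?invr_ge0 ?mulr_ge0 ?(ltW a0) ?(ltW r0) ?(ltW ar0)//.
  rewrite -[(a - r)^-1]powR_inv1 ?(ltW ar0)// -powRrM.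
  rewrite (_ : 1 - s - 1 = -1 * s); last by ring.
  rewrite (_ : a `^ (- 1) = a `^ (- s - 1) * a `^ s); first by congr EFin; ring.
  by rewrite -powRD ?(gt_eqF a0) ?implybT//; congr (_ `^ _); ring.
have mg2 : measurable_fun setT (fun a : R =>
    (hpow (1 - s) (- r + 1 * a) * (r + (- r + 1 * a)) `^ (- 1))%:E).
  by apply: (measurableT_comp mg); exact: measurable_affine.
rewrite ge0_integralZl//.
have := @ge0_integral_affine R (- r) 1 _ (oner_neq0 _) mg g0.
rewrite normr1 mul1e => <-.
rewrite (@integral_hpow_powRD R (1 - s) 1 r) ?subr_gt0//; last by rewrite ltrBlDr ltrDl.
rewrite -EFinM /C; congr EFin.
have e1 : 1 - s - 1 = - s by ring.
have e2 : 1 - (1 - s) = s by ring.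
rewrite e1 e2 powRN; move: Ga (powR_gt0 s r0).
generalize (Gamma (1 - s)) (Gamma s) (Gamma (1 : R)) (r `^ s) => A B G W G0 W0.
by field; rewrite !gt_eqF.
Qed.

End beta_kernel.

(** * Tonelli and Fubini for real-valued functions *)

Section fubini_real.
Context d1 d2 (T1 : measurableType d1) (T2 : measurableType d2) (R : realType).
Variables (m1 : {sigma_finite_measure set T1 -> \bar R})
          (m2 : {sigma_finite_measure set T2 -> \bar R}).

(* The library's own sigma-finite instance for [m1 \x m2] is shadowed by the one
   for subprobabilities, so the product is wrapped under a new name. *)
Definition sigma_finite_prod : set (T1 * T2) -> \bar R := (m1 \x m2)%E.

HB.instance Definition _ := Measure.on sigma_finite_prod.

Let sigma_finite_prodT : sigma_finite setT sigma_finite_prod.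
Proof.
have /sigma_finiteP[F [FT ndF Foo]] := sigma_finiteT m1.
have /sigma_finiteP[G [GT ndG Goo]] := sigma_finiteT m2.
exists (fun k => F k `*` G k).
  apply/seteqP; split => // -[a b] _.
  have [i _ Fa] : (\bigcup_i F i) a by rewrite -FT.
  have [j _ Gb] : (\bigcup_i G i) b by rewrite -GT.
  exists (maxn i j) => //; split.
  - by move: a Fa; exact/subsetPset/ndF/leq_maxl.
  - by move: b Gb; exact/subsetPset/ndG/leq_maxr.
move=> k; have [mF Fk] := Foo k; have [mG Gk] := Goo k.
split; first exact: measurableX.
by rewrite /sigma_finite_prod product_measure1E// lte_mul_pinfty// ge0_fin_numE.
Qed.

HB.instance Definition _ := Measure_isSigmaFinite.Build _ _ _ sigma_finite_prod
  sigma_finite_prodT.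

Variable f : T1 * T2 -> R.
Hypothesis mf : measurable_fun [set: T1 * T2] f.

Let mnf : measurable_fun [set: T1 * T2] (fun z => `|f z|%:E).
Proof. by apply/measurable_EFinP; exact: measurableT_comp. Qed.

Lemma tonelli_norm :
  (\int[m1]_x \int[m2]_y `|f (x, y)|%:E = \int[m2]_y \int[m1]_x `|f (x, y)|%:E)%E.
Proof. by rewrite (fubini_tonelli (fun z => `|f z|%:E)). Qed.

Lemma measurable_tonelli_norm1 :
  measurable_fun [set: T1] (fun x => \int[m2]_y `|f (x, y)|%:E)%E.
Proof. exact: (measurable_fun_fubini_tonelli_F (fun z => `|f z|%:E)). Qed.

Lemma measurable_tonelli_norm2 :
  measurable_fun [set: T2] (fun y => \int[m1]_x `|f (x, y)|%:E)%E.
Proof. exact: (measurable_fun_fubini_tonelli_G (fun z => `|f z|%:E)). Qed.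

Lemma tonelli_prod : (forall z, 0 <= f z) ->
  (\int[sigma_finite_prod]_z (f z)%:E = \int[m1]_x \int[m2]_y (f (x, y))%:E)%E.
Proof.
move=> f0; apply: (fubini_tonelli1 (EFin \o f)); first exact/measurable_EFinP.
by move=> z /=; rewrite lee_fin.
Qed.

Hypothesis fty : (\int[m1]_x \int[m2]_y `|f (x, y)|%:E < +oo)%E.

Lemma fubini_integrable : (m1 \x m2)%E.-integrable setT (EFin \o f).
Proof. by apply/integrable12ltyP => //; exact/measurable_EFinP. Qed.

Lemma fubini_real :
  (\int[m1]_x \int[m2]_y (f (x, y))%:E = \int[m2]_y \int[m1]_x (f (x, y))%:E)%E.
Proof. exact: (Fubini fubini_integrable). Qed.

Lemma fubini_real_prod :
  (\int[sigma_finite_prod]_z (f z)%:E = \int[m1]_x \int[m2]_y (f (x, y))%:E)%E.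
Proof. by rewrite -(integral12_prod_meas1 fubini_integrable). Qed.

End fubini_real.

(** Writing 1/x as x (x^2)^(-1) reduces the claim to [powR]; at 0 both sides vanish. *)
Lemma measurable_inv {R : realType} :
  measurable_fun [set: measurableTypeR R] (fun x : R => x^-1).
Proof.
have -> : (fun x : R => x^-1) = (fun x => x * (x ^+ 2) `^ (- 1)).
  apply/funext => x; rewrite powR_inv1 ?sqr_ge0// expr2 invfM.
  by have [->|x0] := eqVneq x 0; rewrite ?invr0 ?mulr0// mulVKf.
apply: measurable_funM => //; apply: (measurableT_comp (measurable_powR _)).
exact: measurable_funX.
Qed.

Section beta_increment.
Context {R : realType} (s : R).
Hypotheses (s0 : 0 < s) (s1 : s < 1).
Local Notation mu := (@lebesgue_measure R).
Local Notation mu2 := (sigma_finite_prod (@lebesgue_measure R) (@lebesgue_measure R)).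
Variables h dh : R -> R.
Hypothesis dhE : forall t : R, 0 < t -> is_derive t 1 h (dh t).
Hypothesis mh : measurable_fun [set: measurableTypeR R] h.
Hypothesis cdh : forall t : R, 0 < t -> {for t, continuous dh}.

Definition beta_const : R := Gamma (1 - s) * Gamma s / (Gamma 1 * s).

Definition beta_weight (p : R * R) : R := hpow (- s) p.1 * hpow s p.2.

(* Completing the square in [a |x|^2 + b |z - x|^2] leaves [parallel (a, b) |z|^2]. *)
Definition parallel (p : R * R) : R := p.1 * p.2 / (p.1 + p.2).

Lemma beta_weight_ge0 p : 0 <= beta_weight p.
Proof. by rewrite mulr_ge0 ?hpow_ge0. Qed.

Lemma measurable_beta_weight :
  measurable_fun [set: measurableTypeR R * measurableTypeR R] beta_weight.
Proof.
apply: measurable_funM.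
  by apply: (measurableT_comp (measurable_hpow (- s))).
by apply: (measurableT_comp (measurable_hpow s)).
Qed.

Let D (r : R) : R := if 0 < r then dh r else 0.

Let measurable_D : measurable_fun [set: measurableTypeR R] D.
Proof.
have mdh : measurable_fun (`]0, +oo[%classic : set R) dh.
  apply: open_continuous_measurable_fun => //.
  by move=> t; rewrite inE/= in_itv/= andbT; exact: cdh.
have := (measurable_restrictT dh (measurable_itv `]0, +oo[)).1 mdh.
congr measurable_fun; apply/funext => r.
by rewrite patchE mem_setE in_itv/= andbT.
Qed.

Let f (z : measurableTypeR R * (measurableTypeR R * measurableTypeR R)) : R :=
  D z.1 * (beta_weight z.2 * beta_region z.1 z.2.1 z.2.2).

Let measurable_region : measurable_fun
  [set: measurableTypeR R * (measurableTypeR R * measurableTypeR R)]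
  (fun z => beta_weight z.2 * beta_region z.1 z.2.1 z.2.2).
Proof.
have m21 : measurable_fun
    [set: measurableTypeR R * (measurableTypeR R * measurableTypeR R)] (fun z => z.2.1).
  by apply: (measurableT_comp measurable_fst).
have m22 : measurable_fun
    [set: measurableTypeR R * (measurableTypeR R * measurableTypeR R)] (fun z => z.2.2).
  by apply: (measurableT_comp measurable_snd).
apply: measurable_funM; first by apply: (measurableT_comp measurable_beta_weight).
apply: measurable_fun_ifT => //; apply: measurable_and.
  by apply: measurable_fun_ltr.
apply: measurable_fun_ler; first exact: measurable_funM.
by apply: measurable_funM => //; exact: measurable_funD.
Qed.

Let measurable_f : measurable_fun
  [set: measurableTypeR R * (measurableTypeR R * measurableTypeR R)] f.
Proof.
apply: measurable_funM => //.
by apply: (measurableT_comp measurable_D).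
Qed.

Let measurable_region_sec r :
  measurable_fun [set: measurableTypeR R * measurableTypeR R]
    (fun p => beta_weight p * beta_region r p.1 p.2).
Proof.
exact: (measurableT_comp measurable_region
  (@measurable_pair1 _ _ (measurableTypeR R) (measurableTypeR R * measurableTypeR R)%type r)).
Qed.

Let region_ge0 r p : 0 <= beta_weight p * beta_region r p.1 p.2.
Proof. by rewrite mulr_ge0 ?beta_weight_ge0 ?beta_region_ge0. Qed.

Let integral_region r : 0 < r ->
  (\int[mu2]_p (beta_weight p * beta_region r p.1 p.2)%:E = beta_const%:E)%E.
Proof.
move=> r0; rewrite (tonelli_prod _ _ (measurable_region_sec r))//.
exact: beta_kernel_integral.
Qed.

Let integral_region_normf r :
  (\int[mu2]_p `|f (r, p)|%:E = beta_const%:E * `|D r|%:E)%E.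
Proof.
rewrite /f/= /D; case: ifPn => r0; last first.
  by rewrite normr0 mule0 integral0_eq// => p _; rewrite mul0r normr0.
under eq_integral => p _ do rewrite normrM [`|_ * beta_region _ _ _|]ger0_norm// EFinM.
rewrite ge0_integralZl//; last 2 first.
- by apply/measurable_EFinP; exact: measurable_region_sec.
- by move=> p _; rewrite lee_fin.
by rewrite integral_region// muleC.
Qed.

Lemma beta_const_ge0 : 0 <= beta_const.
Proof.
have := Gamma_gt0 s0; have : 0 < Gamma (1 - s) by rewrite Gamma_gt0 ?subr_gt0.
have : 0 < Gamma (1 : R) by rewrite Gamma_gt0.
rewrite /beta_const; generalize (Gamma (1 - s)) (Gamma s) (Gamma (1 : R)) => A B C C0 A0 B0.
by rewrite divr_ge0 ?mulr_ge0 ?(ltW A0) ?(ltW B0) ?(ltW C0) ?(ltW s0).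
Qed.

(** For positive [a] and [b] the region restricts [r] to [parallel (a, b) <= r < a], and the
    fundamental theorem of calculus applies; otherwise the weight vanishes. *)
Let section_f p : (\int[mu]_r (f (r, p))%:E =
  (beta_weight p * (h p.1 - h (parallel p)))%:E)%E.
Proof.
case: p => a b; rewrite /f /=.
have [a0|a0] := leP a 0.
  rewrite integral0_eq => [|r _].
    by rewrite /beta_weight/= /hpow ltNge a0 !mul0r.
  by rewrite /beta_weight/= /hpow ltNge a0 !mul0r mulr0.
have [b0|b0] := leP b 0.
  rewrite integral0_eq => [|r _].
    by rewrite /beta_weight/= /hpow [0 < b]ltNge b0/= mulr0 !mul0r.
  by rewrite /beta_weight/= /hpow [0 < b]ltNge b0/= mulr0 !mul0r mulr0.
have ab0 : 0 < a + b by rewrite addr_gt0.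
have c0 : 0 < parallel (a, b) by rewrite divr_gt0 ?mulr_gt0.
have ca : parallel (a, b) <= a.
  by rewrite /parallel/= ler_pdivrMr// ler_pM2l// lerDr ltW.
have cseg : {within `[parallel (a, b), a], continuous dh}.
  apply: continuous_in_subspaceT => t; rewrite inE/= in_itv/= => /andP[ct _].
  by apply: cdh; rewrite (lt_le_trans c0).
have idh : mu.-integrable (`[parallel (a, b), a[%classic : set R) (EFin \o dh).
  have := continuous_compact_integrable (@segment_compact _ _ _) cseg.
  by apply: integrableS => //; exact: subset_itv_co_cc.
rewrite EFinM -(integral_segment_derive dhE cdh c0 ca).
rewrite -integral_itv_bndo_bndc; last exact: measurable_int idh.
rewrite -integralZl// integral_mkcond; apply: eq_integral => r _.
rewrite patchE mem_setE in_itv/= /D /beta_region /parallel/= ler_pdivrMr//.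
rewrite [(r < a) && _]andbC; have [/andP[cr _]|_] := boolP (_ && (r < a)).
  have r0 : 0 < r by rewrite -(pmulr_lgt0 _ ab0) (lt_le_trans _ cr)// mulr_gt0.
  by rewrite r0 mulr1 -EFinM mulrC.
by rewrite !mulr0.
Qed.

Let integral_normf : (\int[mu]_r \int[mu2]_p `|f (r, p)|%:E =
   beta_const%:E * \int[mu]_(r in `]0%R, +oo[) `|dh r|%:E)%E.
Proof.
under eq_integral => r _ do rewrite integral_region_normf.
rewrite ge0_integralZl//; last 2 first.
- by apply/measurable_EFinP; exact: measurableT_comp.
- by rewrite lee_fin beta_const_ge0.
rewrite integral_gt0_if; congr (_ * _)%E; apply: eq_integral => r _.
by rewrite /D; case: ifP => //; rewrite normr0.
Qed.

Lemma measurable_parallel :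
  measurable_fun [set: measurableTypeR R * measurableTypeR R] parallel.
Proof.
apply: measurable_funM; first exact: measurable_funM.
by apply: (measurableT_comp measurable_inv); exact: measurable_funD.
Qed.

(** The triangle inequality in [r], then Tonelli and the constant mass of the region. The bound
    holds without integrability of [dh] and, applied to all rays, yields an estimate uniform in
    [z]. *)
Lemma beta_increment_le :
  (\int[mu2]_p (beta_weight p * `|h p.1 - h (parallel p)|)%:E <=
   beta_const%:E * \int[mu]_(r in `]0%R, +oo[) `|dh r|%:E)%E.
Proof.
rewrite -integral_normf.
rewrite (tonelli_norm _ _ measurable_f).
apply: ge0_le_integral => //.
- by move=> p _; rewrite lee_fin mulr_ge0 ?beta_weight_ge0.
- apply/measurable_EFinP; apply: measurable_funM; first exact: measurable_beta_weight.
  apply: measurableT_comp => //; apply: measurable_funB.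
    by apply: (measurableT_comp mh).
  by apply: (measurableT_comp mh); exact: measurable_parallel.
- exact: (measurable_tonelli_norm2 _ measurable_f).
- move=> p _.
  have mfp : measurable_fun [set: measurableTypeR R] (fun r => (f (r, p))%:E).
    apply/measurable_EFinP; exact: (measurableT_comp measurable_f
      (@measurable_pair2 _ _ (measurableTypeR R)
        (measurableTypeR R * measurableTypeR R)%type p)).
  have := le_abse_integral mu measurableT mfp.
  by rewrite section_f /= normrM [`|beta_weight _|]ger0_norm ?beta_weight_ge0.
Qed.

(* [h a - h (parallel (a, b))] is the integral of [dh r] over
   [parallel (a, b) <= r < a]; for fixed [r] the weight of the set of such
   [(a, b)] does not depend on [r]. *)
Lemma beta_increment (A B : R) :
  mu.-integrable (`]0%R, +oo[%classic : set R) (EFin \o dh) ->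
  h k.+1%:R^-1 @[k --> \oo] --> B -> h k.+1%:R @[k --> \oo] --> A ->
  (\int[mu2]_p (beta_weight p * (h p.1 - h (parallel p)))%:E =
   (beta_const * (A - B))%:E)%E.
Proof.
move=> idh hB hA.
have fI : (\int[mu]_r \int[mu2]_p `|f (r, p)|%:E < +oo)%E.
  rewrite integral_normf; apply: lte_mul_pinfty => //.
    by rewrite lee_fin beta_const_ge0.
  by have /integrableP[] := idh.
rewrite [LHS](_ : _ = \int[mu2]_p \int[mu]_r (f (r, p))%:E)%E; last first.
  by apply: eq_integral => p _; rewrite section_f.
rewrite -(fubini_real measurable_f fI).
transitivity (\int[mu]_r (beta_const%:E * (D r)%:E))%E.
  apply: eq_integral => r _; rewrite /f/= /D; case: ifPn => r0; last first.
    by rewrite mule0 integral0_eq// => p _; rewrite mul0r.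
  under eq_integral do rewrite EFinM.
  rewrite integralZl//.
    by rewrite integral_region// muleC.
  apply/integrableP; split; first by apply/measurable_EFinP; exact: measurable_region_sec.
  under eq_integral do rewrite gee0_abs ?lee_fin//.
  by rewrite integral_region// ltry.
have DE : (fun r => (D r)%:E) = (EFin \o dh) \_ (`]0, +oo[%classic).
  apply/funext => r; rewrite patchE mem_setE in_itv/= andbT /D.
  by case: ifP.
rewrite integralZl// ?DE; last first.
  by rewrite -integrable_mkcond.
by rewrite -integral_mkcond (integral_derive_lim dhE cdh idh hB hA) -EFinM.
Qed.
End beta_increment.

(** * Restrictions to rays and Gaussian integrals *)

Section ray.
Context {R : realType} {n : nat}.
Local Notation mu := (@lebesgue_measure R).
Implicit Types (f : 'rV[R]_n -> R) (z : 'rV[R]_n).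

(* [1 / sqrt r], written so as to be differentiable by the chain rule. *)
Definition isqrt (r : R) : R := expR (- 2^-1 * ln r).

Lemma isqrt_gt0 r : 0 < isqrt r. Proof. exact: expR_gt0. Qed.

Lemma isqrt_sqr r : 0 < r -> isqrt r ^+ 2 = r^-1.
Proof.
move=> r0; rewrite /isqrt -expRM_natl mulrA mulrN divff// mulN1r expRN lnK//.
Qed.

Lemma is_derive_isqrt (r : R) : 0 < r ->
  is_derive r 1 isqrt (- (isqrt r / (2 * r))).
Proof.
move=> r0; have d1 : is_derive r (1 : R) (@ln R) r^-1 by exact: is_derive1_ln.
have := is_derive1_comp (f := expR) (is_derive_expR _) (is_deriveZ (- 2^-1) d1).
congr is_derive; transitivity (isqrt r * (- 2^-1 * r^-1)) => //.
by field; rewrite gt_eqF.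
Qed.

Lemma measurable_isqrt : measurable_fun [set: measurableTypeR R] isqrt.
Proof.
by apply: measurableT_comp => //; apply: measurable_funM.
Qed.

(** As [r] grows from 0 to infinity, the argument of [f] runs along the half-line through [z] from
    infinity to the origin. *)
Definition ray f z (r : R) : R := f (isqrt r *: z).

Definition dray f z (r : R) : R :=
  - (isqrt r / (2 * r)) * \sum_i z ord0 i * partial i f (isqrt r *: z).

Lemma is_derive_ray f z (r : R) : smooth f -> 0 < r ->
  is_derive r 1 (ray f z) (dray f z r).
Proof.
move=> sf r0.
have d := @is_derive_line R n f 0 z (isqrt r) (fun i => (sf [:: i]).1) (fun i => (sf [::]).2 i).
have := is_derive1_comp d (is_derive_isqrt r0).
rewrite mulrC add0r; congr (is_derive _ _ _ _).
by apply/funext => t; rewrite /= add0r.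
Qed.

Lemma continuous_bigsum (T : topologicalType) (I : Type) (l : seq I) (g : I -> T -> R) (x : T) :
  (forall i, {for x, continuous (g i)}) ->
  {for x, continuous (fun y => \sum_(i <- l) g i y)}.
Proof.
move=> cg; elim: l => [|i l IH].
  rewrite (_ : (fun _ => _) = cst 0); first exact: cst_continuous.
  by apply/funext => y; rewrite big_nil.
rewrite (_ : (fun _ => _) = (fun y => g i y + \sum_(i <- l) g i y)); last first.
  by apply/funext => y; rewrite big_cons.
exact: (@continuousD _ R^o _ (g i) (fun y => \sum_(i <- l) g i y)).
Qed.

Lemma continuous_dray f z (r : R) : smooth f -> 0 < r ->
  {for r, continuous (dray f z)}.
Proof.
move=> sf r0; have cq := is_derive_continuous (is_derive_isqrt r0).
apply: (@continuousM _ _ (fun r => - (isqrt r / (2 * r)))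
  (fun r => \sum_i z ord0 i * partial i f (isqrt r *: z))).
  apply: (@continuousN R R^o).
  apply: (@continuousM _ _ isqrt (fun r => (2 * r)^-1)) => //.
  apply: continuousV; first by rewrite mulf_neq0// gt_eqF.
  by apply: (@continuousM _ _ (cst 2) id) => //; exact: cst_continuous.
apply: continuous_bigsum => i.
apply: (@continuousM _ _ (cst (z ord0 i))); first exact: cst_continuous.
have d := @is_derive_line R n (partial i f) 0 z (isqrt r)
  (fun j => (sf [:: j; i]).1) (fun j => (sf [:: i]).2 j).
rewrite (_ : (fun _ => _) = (fun u : R => partial i f (0 + u *: z)) \o isqrt).
  by apply: continuous_comp => //; exact: (is_derive_continuous d).
by apply/funext => t /=; rewrite add0r.
Qed.

Lemma sqnZ (c : R) z : sqn (c *: z) = c ^+ 2 * sqn z.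
Proof. by rewrite /sqn mulr_sumr; apply: eq_bigr => i _; rewrite mxE exprMn. Qed.

(* [1 / (1 + |z| / sqrt r)] is a bounded primitive dominating [|dray f z|],
   uniformly in [z]. *)
Lemma integral_dray_le f : rschwartz f -> exists2 C : R, 0 <= C & forall z,
  (\int[mu]_(r in `]0%R, +oo[) `|dray f z r|%:E <= C%:E)%E.
Proof.
move=> rf; have [C C0 hC] := rschwartz_partial_le 1 rf.
exists (n%:R * (2 * C)) => [|z]; first by rewrite !mulr_ge0.
pose e : R := Num.sqrt (sqn z).
have e0 : 0 <= e by exact: sqrtr_ge0.
have e2 : e ^+ 2 = sqn z by rewrite sqr_sqrtr// sqn_ge0.
pose B := n%:R * (2 * C).
have B0 : 0 <= B by rewrite !mulr_ge0.
pose P (r : R) : R := 1 + e * isqrt r.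
have P0 r : 0 < P r by rewrite ltr_pwDl// mulr_ge0// ltW// isqrt_gt0.
pose F (r : R) := B * (P r)^-1.
pose g (r : R) := B * (e * (isqrt r / (2 * r)) / P r ^+ 2).
have dP (r : R) : 0 < r -> is_derive r 1 P (e * - (isqrt r / (2 * r))).
  move=> r0; rewrite -[X in is_derive _ _ _ X]add0r.
  exact: (is_deriveD (is_derive_cst _ _ _) (is_deriveZ e (is_derive_isqrt r0))).
have dF (r : R) : 0 < r -> is_derive r 1 F (g r).
  move=> r0; have := is_deriveZ B (is_deriveV (lt0r_neq0 (P0 r)) (dP r r0)).
  congr is_derive.
  transitivity (B * (- P r ^- 2 * (e * - (isqrt r / (2 * r))))) => //.
  by rewrite /g; field; rewrite !gt_eqF.
have cg (r : R) : 0 < r -> {for r, continuous g}.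
  move=> r0; have cq := is_derive_continuous (is_derive_isqrt r0).
  apply: (@continuousM _ _ (cst B)); first exact: cst_continuous.
  apply: (@continuousM _ _ (fun r => e * (isqrt r / (2 * r))) (fun r => (P r ^+ 2)^-1)).
    apply: (@continuousM _ _ (cst e)); first exact: cst_continuous.
    apply: (@continuousM _ _ isqrt (fun r => (2 * r)^-1)) => //.
    apply: continuousV; first by rewrite mulf_neq0// gt_eqF.
    by apply: (@continuousM _ _ (cst 2) id) => //; exact: cst_continuous.
  apply: continuousV; first by rewrite expf_neq0// gt_eqF.
  by apply: (@continuousM _ _ P P); exact: (is_derive_continuous (dP r r0)).
have g0 (r : R) : 0 < r -> 0 <= g r.
  move=> r0; rewrite mulr_ge0// divr_ge0 ?exprn_ge0 ?(ltW (P0 r))//.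
  by rewrite mulr_ge0// divr_ge0 ?mulr_ge0 ?(ltW (isqrt_gt0 _)) ?(ltW r0).
have FB (r : R) : 0 < r -> 0 <= F r <= B.
  move=> r0; rewrite mulr_ge0 ?invr_ge0 ?(ltW (P0 r))//=.
  rewrite ler_piMr// invf_le1// lerDl mulr_ge0//.
  by rewrite ltW// isqrt_gt0.
apply: le_trans (integral_primitive_le dF cg g0 FB).
have mgen (k : R -> R) : (forall r : R, 0 < r -> {for r, continuous k}) ->
    measurable_fun (`]0, +oo[%classic : set R) k.
  move=> ck; apply: open_continuous_measurable_fun => //.
  by move=> t; rewrite inE/= in_itv/= andbT; exact: ck.
apply: ge0_le_integral => //.
- apply/measurable_EFinP; apply: measurableT_comp => //; apply: mgen => r.
  exact: continuous_dray rf.1.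
- by apply/measurable_EFinP; exact: mgen.
move=> r; rewrite /= in_itv/= andbT => r0; rewrite lee_fin.
have q0 := isqrt_gt0 r.
have h0 : 0 <= isqrt r / (2 * r) by rewrite divr_ge0 ?mulr_ge0 ?(ltW q0) ?(ltW r0).
rewrite /dray normrM normrN (ger0_norm h0).
rewrite /g (_ : B * _ = isqrt r / (2 * r) * (B * (e / P r ^+ 2))); last by ring.
rewrite ler_wpM2l// (le_trans (ler_norm_sum _ _ _))//.
apply: (@le_trans _ _ (\sum_(i < n) 2 * C * (e / P r ^+ 2))); last first.
  by rewrite sumr_const card_ord /B -[leRHS]mulrA [leRHS]mulr_natl.
apply: ler_sum => i _; rewrite normrM.
have zi : `|z ord0 i| <= e by rewrite -sqrtr_sqr ler_wsqrtr// coord_sqn.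
rewrite (le_trans (ler_pM _ _ zi (hC i _)))//.
rewrite sqnZ expr1 -e2 -exprMn [isqrt r * e]mulrC /P.
(* With y = |z|/sqrt r, the bound C/(1+y^2) on the gradient is compared with 2C/(1+y)^2, the form in
   which the derivative of the primitive appears. *)
set y := e * isqrt r; have y0 : 0 <= y by rewrite mulr_ge0// ltW.
have y1 : 0 < 1 + y by rewrite ltr_pwDl.
have y2 : 0 < 1 + y ^+ 2 by rewrite ltr_pwDl ?sqr_ge0.
rewrite (_ : e * (C / _) = e * C * (1 + y ^+ 2)^-1); last by rewrite mulrA.
rewrite (_ : 2 * C * _ = e * C * (2 / (1 + y) ^+ 2)); last by ring.
rewrite ler_wpM2l ?mulr_ge0// ler_pdivlMr ?exprn_gt0// ler_pdivrMl//.
by have := sqr_ge0 (1 - y); nra.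
Qed.

(** The name refers to the argument of [f]: it tends to 0 when the parameter of the ray tends to
    infinity. *)
Lemma ray_at_0 f z : smooth f -> ray f z k.+1%:R @[k --> \oo] --> f 0.
Proof.
move=> sf.
have d := @is_derive_line R n f 0 z 0 (fun i => (sf [:: i]).1) (fun i => (sf [::]).2 i).
have cf : {for 0, continuous (fun u : R => f (0 + u *: z))} by exact: (is_derive_continuous d).
have q0 : isqrt k.+1%:R @[k --> \oo] --> (0 : R).
  rewrite (_ : (fun _ => _) = fun k => Num.sqrt (harmonic k)); last first.
    apply/funext => k; rewrite -[harmonic k]/(k.+1%:R^-1) -isqrt_sqr//.
    by rewrite sqrtr_sqr gtr0_norm// isqrt_gt0.
  rewrite -[X in _ --> X](@sqrtr0 R); apply: continuous_cvg.
    exact: sqrt_continuous.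
  exact: cvg_harmonic.
rewrite (_ : f 0 = f (0 + 0 *: z)); last by rewrite scale0r addr0.
rewrite (_ : (fun k => ray f z _) =
    (fun u : R => f (0 + u *: z)) \o (fun k : nat => isqrt k.+1%:R)); last first.
  by apply/funext => k; rewrite /= add0r.
exact: (@continuous_cvg _ _ _ _ _ _ (fun u : R => f (0 + u *: z)) _ cf q0).
Qed.

Lemma ray_at_oo f z : rschwartz f -> z != 0 ->
  ray f z k.+1%:R^-1 @[k --> \oo] --> (0 : R).
Proof.
move=> rf z0; have [C C0 hC] := rschwartz_le 1 rf.
have sz : 0 < sqn z by rewrite lt_neqAle eq_sym sqn_eq0 z0 sqn_ge0.
apply: norm_cvg0.
apply: (@squeeze_cvgr _ _ _ _ (cst 0) (fun k => (C / sqn z) * harmonic k)).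
- apply: nearW => k /=; rewrite normr_ge0 /=.
  apply: le_trans (hC _) _; rewrite expr1 sqnZ isqrt_sqr ?invr_gt0// invrK.
  rewrite -mulrA ler_wpM2l// -invfM lef_pV2 ?posrE ?mulr_gt0//.
    by rewrite mulrC lerDr.
  by rewrite ltr_pwDl// mulr_ge0// ltW.
- exact: cvg_cst.
- by rewrite -[X in _ --> X](mulr0 (C / sqn z)); apply: cvgMr; exact: cvg_harmonic.
Qed.

End ray.

(** A formula known for nonnegative functions extends to signed ones through positive and negative
    parts. Finiteness on the [m2] side is enough to exclude the difference of two infinities. *)
Lemma signed_change_of_variable d1 d2 (R : realType) (T : measurableType d1)
    (V : measurableType d2) (m1 : {measure set T -> \bar R})
    (m2 : {measure set V -> \bar R}) (phi : T -> V) (w : T -> R) (v : V -> R) (K : R) :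
  (forall x, 0 <= w x) -> (forall z, 0 <= v z) -> measurable_fun setT v ->
  (forall g : V -> R, measurable_fun setT g -> (forall z, 0 <= g z) ->
    (\int[m1]_x (g (phi x) * w x)%:E = K%:E * \int[m2]_z (g z * v z)%:E)%E) ->
  forall g : V -> R, measurable_fun setT g ->
    (\int[m2]_z (`|g z| * v z)%:E < +oo)%E ->
    (\int[m1]_x (g (phi x) * w x)%:E = K%:E * \int[m2]_z (g z * v z)%:E)%E.
Proof.
move=> w0 v0 mv H g mg gfin.
have pos d (U : measurableType d) (k l : U -> R) : (forall x, 0 <= l x) ->
    ((fun x => (k x * l x)%:E)^\+ = fun x => (Num.max (k x) 0 * l x)%:E)%E.
  move=> l0; apply/funext => x; rewrite funeposE -EFin_max.
  by rewrite -{1}(mul0r (l x)) maxr_pMl.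
have neg d (U : measurableType d) (k l : U -> R) : (forall x, 0 <= l x) ->
    ((fun x => (k x * l x)%:E)^\- = fun x => (Num.max (- k x) 0 * l x)%:E)%E.
  move=> l0; apply/funext => x; rewrite funenegE -EFinN -EFin_max.
  by rewrite -mulNr -{1}(mul0r (l x)) maxr_pMl.
have fin (k : V -> R) : measurable_fun setT k -> (forall z, 0 <= k z <= `|g z|) ->
    (\int[m2]_z (k z * v z)%:E)%E \is a fin_num.
  move=> mk k01; rewrite ge0_fin_numE; last first.
    by apply: integral_ge0 => z _; rewrite lee_fin mulr_ge0//; case/andP: (k01 z).
  apply: le_lt_trans gfin; apply: ge0_le_integral => //.
  - by move=> z _; rewrite lee_fin mulr_ge0//; case/andP: (k01 z).
  - by apply/measurable_EFinP; exact: measurable_funM.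
  - by apply/measurable_EFinP; apply: measurable_funM => //; exact: measurableT_comp.
  - by move=> z _; rewrite lee_fin ler_wpM2r//; case/andP: (k01 z).
have mp : measurable_fun setT (fun z => Num.max (g z) 0) by exact: measurable_maxr.
have mn : measurable_fun setT (fun z => Num.max (- g z) 0).
  by apply: measurable_maxr => //; exact: measurableT_comp.
rewrite integralE (pos _ _ (g \o phi))// (neg _ _ (g \o phi))//.
rewrite (H (fun z => Num.max (g z) 0))//; last by move=> z; rewrite le_max lexx orbT.
rewrite (H (fun z => Num.max (- g z) 0))//; last by move=> z; rewrite le_max lexx orbT.
rewrite [X in _ = (_ * X)%E]integralE pos// neg//.
have : (\int[m2]_z (Num.max (- g z) 0 * v z)%:E)%E \is a fin_num.
  apply: fin => // z.
  by rewrite le_max lexx orbT/= ge_max normr_ge0 andbT -normrN ler_norm.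
move: (integral _ _ _) (integral _ _ _) => A B Bfin.
by rewrite muleBr// fin_num_adde_defl// fin_numN.
Qed.

(** * Gaussian convolution and rescaling *)

Section gauss_weight.
Context {R : realType} {n : nat}.
Local Notation lam := (lebesgue_rV R n).
Local Notation lam2 := (sigma_finite_prod lam lam).

Definition gw (c : R) (x : 'rV[R]_n) : R := expR (- (c * sqn x)).

Lemma gw_ge0 c x : 0 <= gw c x. Proof. exact: expR_ge0. Qed.

Lemma measurable_gw c : measurable_fun setT (gw c).
Proof.
apply: measurableT_comp => //; apply: measurableT_comp => //.
by apply: measurable_funM => //; exact: measurable_sqn.
Qed.

Lemma measurable_rV_lin2 (b c : R) :
  measurable_fun setT (fun p : 'rV[R]_n * 'rV[R]_n => b *: p.1 + c *: p.2).
Proof.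
apply: measurable_fun_rV_coordP => i.
rewrite (_ : _ \o _ = fun p : 'rV[R]_n * 'rV[R]_n =>
    b * rV_coord i p.1 + c * rV_coord i p.2); last first.
  by apply/funext => x; rewrite /= /rV_coord !mxE.
apply: measurable_funD; apply: measurable_funM => //.
  by apply: (measurableT_comp (measurable_rV_coord i)).
by apply: (measurableT_comp (measurable_rV_coord i)).
Qed.

(** With x = z - ey, the exponent a|x|^2 + b|y|^2 splits into a square centred at a multiple of [z]
    and a multiple of |z|^2. Keeping [e] general treats f(x), f(x+y) and f(x-y) at once. *)
Lemma gauss_complete_square (a b e : R) (y z : 'rV[R]_n) : 0 < a -> 0 < b ->
  gw a (- (e *: y) + 1 *: z) * gw b y =
  gw (b + a * e ^+ 2) (- ((a * e / (b + a * e ^+ 2)) *: z) + 1 *: y) *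
  gw (a * b / (b + a * e ^+ 2)) z.
Proof.
move=> a0 b0; have d0 : b + a * e ^+ 2 != 0.
  by rewrite gt_eqF// ltr_pwDl// mulr_ge0 ?sqr_ge0// ltW.
rewrite /gw -!expRD -!opprD; congr (expR (- _)).
rewrite /sqn !mulr_sumr -!big_split/=; apply: eq_bigr => i _; rewrite !mxE.
by field.
Qed.

(** Translate [x] to z = x+ey, exchange the integrals and complete the square: [y] then occurs only
    in a translated Gaussian, whose mass does not depend on [z]. *)
Lemma ge0_gauss_convolution (a b e : R) (g : 'rV[R]_n -> R) : 0 < a -> 0 < b ->
  measurable_fun setT g -> (forall z, 0 <= g z) ->
  (\int[lam2]_w (g (w.1 + e *: w.2) * (gw a w.1 * gw b w.2))%:E =
   ((pi / (b + a * e ^+ 2)) `^ (n%:R / 2))%:E *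
   \int[lam]_z (g z * gw (a * b / (b + a * e ^+ 2)) z)%:E)%E.
Proof.
move=> a0 b0 mg g0.
have d0 : 0 < b + a * e ^+ 2.
  by rewrite ltr_pwDl// mulr_ge0 ?sqr_ge0// ltW.
have mlin c c' (h : 'rV[R]_n -> R) : measurable_fun setT h ->
    measurable_fun setT (fun p : 'rV[R]_n * 'rV[R]_n => h (c *: p.1 + c' *: p.2)).
  move=> mh; apply: (measurableT_comp mh); exact: measurable_rV_lin2.
have E1 : (fun w : 'rV[R]_n * 'rV[R]_n => g (w.1 + e *: w.2) * (gw a w.1 * gw b w.2)) =
    (fun w => g (1 *: w.1 + e *: w.2) * (gw a (1 *: w.1 + 0 *: w.2) * gw b (0 *: w.1 + 1 *: w.2))).
  by apply/funext => w; rewrite !scale1r !scale0r addr0 add0r.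
have mF : measurable_fun setT (fun w : 'rV[R]_n * 'rV[R]_n =>
    g (w.1 + e *: w.2) * (gw a w.1 * gw b w.2)).
  rewrite E1; apply: measurable_funM; first exact: mlin.
  by apply: measurable_funM; apply: mlin; exact: measurable_gw.
have F0 w : 0 <= g (w.1 + e *: w.2) * (gw a w.1 * gw b w.2).
  by rewrite !mulr_ge0 ?gw_ge0.
rewrite tonelli_prod//.
rewrite (fubini_tonelli (fun w : 'rV[R]_n * 'rV[R]_n => (g (w.1 + e *: w.2) * (gw a w.1 * gw b w.2))%:E))//; last 1 first.
  exact/measurable_EFinP.
transitivity (\int[lam]_y \int[lam]_z
    (g z * (gw a (- (e *: y) + 1 *: z) * gw b y))%:E)%E.
  apply: eq_integral => y _ /=.
  rewrite (ge0_integral_rV_affine (- (e *: y)) (oner_neq0 R)); last 2 first.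
  - apply/measurable_EFinP; exact: (measurableT_comp mF (measurable_pair2 y)).
  - by move=> x; rewrite lee_fin; exact: (F0 (x, y)).
  rewrite normr1 expr1n mul1e; apply: eq_integral => z _.
  by congr (g _ * _)%:E; rewrite scale1r addrAC addNr add0r.
have mG : measurable_fun setT (fun w : 'rV[R]_n * 'rV[R]_n =>
    (g w.2 * (gw a (- (e *: w.1) + 1 *: w.2) * gw b w.1))%:E).
  rewrite (_ : (fun _ => _) = (fun w : 'rV[R]_n * 'rV[R]_n => (g (0 *: w.1 + 1 *: w.2) *
     (gw a ((- e) *: w.1 + 1 *: w.2) * gw b (1 *: w.1 + 0 *: w.2)))%:E)); last first.
    by apply/funext => w; rewrite scaleNr !scale1r !scale0r addr0 add0r.
  apply/measurable_EFinP; apply: measurable_funM; first exact: mlin.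
  by apply: measurable_funM; apply: mlin; exact: measurable_gw.
rewrite (fubini_tonelli (fun w : 'rV[R]_n * 'rV[R]_n =>
  (g w.2 * (gw a (- (e *: w.1) + 1 *: w.2) * gw b w.1))%:E))//; last first.
  by move=> w; rewrite lee_fin !mulr_ge0 ?gw_ge0.
set K := ((pi / _) `^ _)%:E.
rewrite -ge0_integralZl//; last 3 first.
- by apply/measurable_EFinP; apply: measurable_funM => //; exact: measurable_gw.
- by move=> z _; rewrite lee_fin mulr_ge0 ?gw_ge0.
- by rewrite lee_fin powR_ge0.
apply: eq_integral => z _ /=.
under eq_integral do rewrite gauss_complete_square// mulrCA mulrC EFinM.
rewrite ge0_integralZl//; last 3 first.
- apply/measurable_EFinP; apply: (measurableT_comp (measurable_gw _)).
  exact: measurable_rV_affine.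
- by move=> y _; rewrite lee_fin gw_ge0.
- by rewrite lee_fin mulr_ge0 ?gw_ge0.
suff -> : (\int[lam]_y (gw (b + a * e ^+ 2)
    (- ((a * e / (b + a * e ^+ 2)) *: z) + 1 *: y))%:E)%E = K by rewrite muleC.
rewrite /K -gauss_rV// [RHS](ge0_integral_rV_affine
  (- ((a * e / (b + a * e ^+ 2)) *: z)) (oner_neq0 R))//; last first.
  by apply/measurable_EFinP; exact: measurable_gw.
by rewrite normr1 expr1n mul1e.
Qed.

Lemma gw_integrable_bounded (c C : R) (g : 'rV[R]_n -> R) : 0 < c ->
  measurable_fun setT g -> (forall z, `|g z| <= C) ->
  (\int[lam]_z (`|g z| * gw c z)%:E < +oo)%E.
Proof.
move=> c0 mg gC; have C0 : 0 <= C by rewrite (le_trans _ (gC 0)).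
apply: (@le_lt_trans _ _ (\int[lam]_z (C%:E * (gw c z)%:E))%E).
  apply: ge0_le_integral => //.
  - by move=> z _; rewrite lee_fin mulr_ge0 ?gw_ge0.
  - apply/measurable_EFinP; apply: measurable_funM; last exact: measurable_gw.
    exact: measurableT_comp.
  - by apply: measurable_funeM; apply/measurable_EFinP; exact: measurable_gw.
  - by move=> z _; rewrite -EFinM lee_fin ler_wpM2r ?gw_ge0.
rewrite ge0_integralZl//; last 2 first.
- by apply/measurable_EFinP; exact: measurable_gw.
- by move=> z _; rewrite lee_fin gw_ge0.
by rewrite gauss_rV// -EFinM ltry.
Qed.

Lemma gauss_convolution (a b e C : R) (g : 'rV[R]_n -> R) : 0 < a -> 0 < b ->
  measurable_fun setT g -> (forall z, `|g z| <= C) ->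
  (\int[lam2]_w (g (w.1 + e *: w.2) * (gw a w.1 * gw b w.2))%:E =
   ((pi / (b + a * e ^+ 2)) `^ (n%:R / 2))%:E *
   \int[lam]_z (g z * gw (a * b / (b + a * e ^+ 2)) z)%:E)%E.
Proof.
move=> a0 b0 mg gC.
apply: (@signed_change_of_variable _ _ R _ _ lam2 lam
  (fun w => w.1 + e *: w.2) (fun w => gw a w.1 * gw b w.2)) => //.
- by move=> w; rewrite mulr_ge0 ?gw_ge0.
- by move=> z; exact: gw_ge0.
- exact: measurable_gw.
- by move=> h mh h0; exact: ge0_gauss_convolution.
- apply: gw_integrable_bounded gC => //; rewrite divr_gt0 ?mulr_gt0//.
  by rewrite ltr_pwDl// mulr_ge0 ?sqr_ge0// ltW.
Qed.

(** Rescaling moves the parameter [c] from the Gaussian into the argument of [g]. Terms with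
    different [c] can then be subtracted under one integral against the fixed weight [gw 1]. *)
Lemma integral_gw_ray (c C : R) (g : 'rV[R]_n -> R) : 0 < c ->
  measurable_fun setT g -> (forall z, `|g z| <= C) ->
  (\int[lam]_z (g z * gw c z)%:E =
   (c `^ (- (n%:R / 2)))%:E * \int[lam]_z (ray g z c * gw 1 z)%:E)%E.
Proof.
move=> c0 mg gC.
pose d := isqrt c; have d0 : 0 < d by exact: isqrt_gt0.
have -> : c `^ (- (n%:R / 2)) = d ^+ n.
  by rewrite /d /isqrt -expRM_natl /powR gt_eqF//; congr expR; field.
have H : (\int[lam]_z (ray g z c * gw 1 z)%:E =
    (d ^- n)%:E * \int[lam]_z (g z * gw c z)%:E)%E.
  apply: (@signed_change_of_variable _ _ R _ _ lam lam
    (fun z => d *: z) (gw 1) (gw c)) => //.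
  - by move=> z; exact: gw_ge0.
  - by move=> z; exact: gw_ge0.
  - exact: measurable_gw.
  - move=> h mh h0; rewrite [in RHS](@ge0_integral_rV_affine _ _ 0 d)//; last 3 first.
    + by rewrite gt_eqF.
    + apply/measurable_EFinP; apply: measurable_funM => //; exact: measurable_gw.
    + by move=> z; rewrite lee_fin mulr_ge0 ?gw_ge0.
    rewrite muleA -EFinM gtr0_norm// mulVf ?expf_neq0 ?gt_eqF// mul1e.
    apply: eq_integral => z _; rewrite add0r /gw sqnZ isqrt_sqr//.
    by rewrite mulrA divff ?gt_eqF.
  - exact: gw_integrable_bounded gC.
by rewrite H muleA -EFinM divff ?mul1e// expf_neq0// gt_eqF.
Qed.

End gauss_weight.

(** * The Riesz potential inverts the fractional Laplacian *)

Section punctured.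
Context {R : realType} {n : nat}.
Hypothesis n0 : (0 < n)%N.
Local Notation lam := (lebesgue_rV R n).
Local Notation lam2 := (sigma_finite_prod lam lam).
Local Notation mu := (@lebesgue_measure R).
Local Notation mu2 := (sigma_finite_prod mu mu).

Definition chi (x : 'rV[R]_n) : R := (x != 0)%:R.

Lemma chi_ge0 x : 0 <= chi x. Proof. exact: ler0n. Qed.

Lemma chi1 x : x != 0 -> chi x = 1. Proof. by rewrite /chi => ->. Qed.

Lemma measurable_chi : measurable_fun setT chi.
Proof.
rewrite (_ : chi = \1_(~` [set 0])).
  by apply: measurable_indic; apply: measurableC; exact: measurable_rV_set1.
apply/funext => x; rewrite /chi indicE; congr (_%:R); congr nat_of_bool.
apply/idP/idP => [/eqP h|]; first by rewrite inE.
by rewrite inE => /eqP.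
Qed.

Lemma integral_chi (g : 'rV[R]_n -> R) : measurable_fun setT g ->
  (\int[lam]_x (chi x * g x)%:E = \int[lam]_x (g x)%:E)%E.
Proof.
move=> mg; apply: ae_eq_integral => //.
- by apply/measurable_EFinP; apply: measurable_funM => //; exact: measurable_chi.
- exact/measurable_EFinP.
- by apply: ae_rV_neq0 => // x x0 _; rewrite chi1// mul1r.
Qed.

Lemma integral_chi2 (g : 'rV[R]_n * 'rV[R]_n -> R) : measurable_fun setT g ->
  (\int[lam2]_w (chi w.1 * chi w.2 * g w)%:E = \int[lam2]_w (g w)%:E)%E.
Proof.
move=> mg; apply: ae_eq_integral => //.
- apply/measurable_EFinP; apply: measurable_funM => //.
  by apply: measurable_funM; apply: (measurableT_comp measurable_chi).
- exact/measurable_EFinP.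
have m1 := @measurable_rV_set1 R n; have z1 := lebesgue_rV_set1 (R := R) n0.
have neg1 : lam2.-negligible ([set 0] `*` setT : set ('rV[R]_n * 'rV[R]_n)).
  exists ([set 0] `*` setT); split => //; first exact: measurableX.
  by rewrite [LHS]product_measure1E// [X in (X * _)%E]z1 mul0e.
have neg2 : lam2.-negligible (setT `*` [set 0] : set ('rV[R]_n * 'rV[R]_n)).
  exists (setT `*` [set 0]); split => //; first exact: measurableX.
  by rewrite [LHS]product_measure1E// [X in (_ * X)%E]z1 mule0.
have neg := negligibleU neg1 neg2.
apply: negligibleS neg => w /= nw; have [w1|w1] := eqVneq w.1 0; first by left.
have [w2|w2] := eqVneq w.2 0; first by right.
by exfalso; apply: nw => _; rewrite !chi1// !mul1r.
Qed.

(* The factor [chi x] makes the formula hold at [0] too, both sides vanishing. *)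
Definition riesz_mix (p : R) (x : 'rV[R]_n) (t : R) : R := chi x * (hpow p t * gw t x).

Lemma riesz_mix_ge0 p x t : 0 <= riesz_mix p x t.
Proof. by rewrite mulr_ge0 ?chi_ge0// mulr_ge0 ?hpow_ge0 ?gw_ge0. Qed.

Lemma measurable_riesz_mix p : measurable_fun setT
  (fun z : 'rV[R]_n * measurableTypeR R => riesz_mix p z.1 z.2).
Proof.
apply: measurable_funM; first by apply: (measurableT_comp measurable_chi).
have := @measurable_hpow_sqn R n p 0.
by under eq_fun do rewrite add0r; move=> /measurable_EFinP.
Qed.

Lemma integral_riesz_mix p x : 0 < p ->
  (\int[mu]_t (riesz_mix p x t)%:E = (Gamma p * sqn x `^ (- p))%:E)%E.
Proof.
move=> p0; rewrite /riesz_mix; have [->|x0] := eqVneq x 0.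
  rewrite /chi eqxx (_ : sqn 0 = 0); last by apply/eqP; rewrite sqn_eq0.
  rewrite powR0 ?oppr_eq0 ?gt_eqF// mulr0.
  by under eq_integral do rewrite mul0r; rewrite integral0.
rewrite chi1//; under eq_integral => t _ do rewrite mul1r /gw [t * _]mulrC.
by rewrite Gamma_integralZ// lt_neqAle sqn_ge0 eq_sym sqn_eq0 x0.
Qed.

Lemma measurable_riesz_mix2 p m : measurable_fun setT
  (fun z : ('rV[R]_n * 'rV[R]_n) * (measurableTypeR R * measurableTypeR R) =>
    riesz_mix p z.1.1 z.2.1 * riesz_mix m z.1.2 z.2.2).
Proof.
pose T : Type := (('rV[R]_n * 'rV[R]_n) * (measurableTypeR R * measurableTypeR R))%type.
have m11 : measurable_fun setT (fun z : T => (z.1.1, z.2.1)).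
  by apply: measurable_fun_pair; apply: measurableT_comp.
have m22 : measurable_fun setT (fun z : T => (z.1.2, z.2.2)).
  by apply: measurable_fun_pair; apply: measurableT_comp.
have h1 := measurableT_comp (measurable_riesz_mix p) m11.
have h2 := measurableT_comp (measurable_riesz_mix m) m22.
exact: (measurable_funM h1 h2).
Qed.

Lemma integral_riesz_mix2 p m x y : 0 < p -> 0 < m ->
  (\int[mu2]_t (riesz_mix p x t.1 * riesz_mix m y t.2)%:E =
   (Gamma p * Gamma m * (sqn x `^ (- p) * sqn y `^ (- m)))%:E)%E.
Proof.
move=> p0 m0.
have mr q z : measurable_fun setT (fun t : measurableTypeR R => riesz_mix q z t).
  exact: (measurableT_comp (measurable_riesz_mix q) (measurable_pair1 z)).
rewrite (@tonelli_prod _ _ (measurableTypeR R) (measurableTypeR R) R mu mu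
  (fun t => riesz_mix p x t.1 * riesz_mix m y t.2)); last 2 first.
- exact: (measurableT_comp (measurable_riesz_mix2 p m) (measurable_pair1 (x, y))).
- by move=> t; rewrite mulr_ge0 ?riesz_mix_ge0.
under eq_integral => a _.
  under eq_integral do rewrite /= EFinM.
  rewrite ge0_integralZl//; last 3 first.
  - by apply/measurable_EFinP; exact: mr.
  - by move=> b _; rewrite lee_fin riesz_mix_ge0.
  - by rewrite lee_fin riesz_mix_ge0.
  rewrite integral_riesz_mix// muleC; over.
rewrite ge0_integralZl//; last 3 first.
- by apply/measurable_EFinP; exact: mr.
- by move=> b _; rewrite lee_fin riesz_mix_ge0.
- by rewrite lee_fin mulr_ge0 ?powR_ge0// ltW// Gamma_gt0.
by rewrite integral_riesz_mix// -EFinM mulrACA [Gamma m * _]mulrC [sqn y `^ _ * _]mulrC.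
Qed.

End punctured.

Section riesz_identity.
Context {R : realType} {n : nat} (s : R).
Hypotheses (s0 : 0 < s) (s1 : s < 1) (sn : s < n%:R / 2).
Hypotheses (n2m : n%:R / 2 < n%:R / 2 + s) (m1n : n%:R / 2 + s - 1 < n%:R / 2)
  (m1 : 1 < n%:R / 2 + s) (n0 : (0 < n)%N).
Variable f : 'rV[R]_n -> R.
Hypothesis rf : rschwartz f.
Local Notation lam := (lebesgue_rV R n).
Local Notation lam2 := (sigma_finite_prod lam lam).
Local Notation mu := (@lebesgue_measure R).
Local Notation mu2 := (sigma_finite_prod mu mu).
Local Notation p := (n%:R / 2 - s).
Local Notation m := (n%:R / 2 + s).
Local Notation rV := 'rV[R]_n.
Local Notation RR := (measurableTypeR R * measurableTypeR R)%type.

Let p0 : 0 < p. Proof. by rewrite subr_gt0. Qed.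
Let m0 : 0 < m. Proof. by rewrite (lt_trans _ m1). Qed.
Let cf := rschwartz_continuous rf.
Let mf : measurable_fun setT f. Proof. exact: continuous_measurable_rV. Qed.

Let mtr (e : R) : measurable_fun setT (fun w : rV * rV => f (w.1 + e *: w.2)).
Proof.
have := measurableT_comp mf (@measurable_rV_lin2 R n 1 e).
by rewrite (_ : _ \o _ = (fun w : rV * rV => f (w.1 + e *: w.2)))//; apply/funext => w /=; rewrite scale1r.
Qed.

Let mdiff2 : measurable_fun setT (fun w : rV * rV => diff2 f w.1 w.2).
Proof.
rewrite (_ : (fun _ => _) = (fun w : rV * rV => 2 * f (w.1 + 0 *: w.2) - f (w.1 + 1 *: w.2) - f (w.1 + (- 1) *: w.2))).
  by apply: measurable_funB; [apply: measurable_funB => //; apply: measurable_funM => //|].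
by apply/funext => w; rewrite diff2E scale0r addr0.
Qed.

Let W (w : rV * rV) (t : R * R) : R := riesz_mix p w.1 t.1 * riesz_mix m w.2 t.2.
Let Phi (z : (rV * rV) * (R * R)) : R := diff2 f z.1.1 z.1.2 * W z.1 z.2.

Let W_ge0 w t : 0 <= W w t. Proof. by rewrite mulr_ge0 ?riesz_mix_ge0. Qed.

Let mW : measurable_fun setT (fun z : (rV * rV) * RR => W z.1 z.2).
Proof. exact: measurable_riesz_mix2. Qed.

Let mPhi : measurable_fun setT (Phi : (rV * rV) * RR -> R).
Proof.
apply: measurable_funM mW.
exact: (measurableT_comp mdiff2 (@measurable_fst _ _ (rV * rV)%type RR)).
Qed.

Let iW (c : R) w : (\int[mu2]_t (c * W w t)%:E =
  (c * (Gamma p * Gamma m * (sqn w.1 `^ (- p) * rker m w.2)))%:E)%E.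
Proof.
have E := @integral_riesz_mix2 R n p m w.1 w.2 p0 m0.
under eq_integral do rewrite EFinM.
rewrite integralZl//; first by rewrite [X in (_ * X)%E]E.
apply/integrableP; split.
  apply/measurable_EFinP; exact: (measurableT_comp mW (measurable_pair1 w)).
under eq_integral do rewrite /= ger0_norm//.
by rewrite [X in (X < _)%E]E ltry.
Qed.

(** At the origin the exponent p < n/2 governs. At infinity the exponents add up to p + m = n, which
    exceeds n/2. *)
Lemma integrable_riesz_weight (u : rV -> R) (C : R) : 0 <= C ->
  measurable_fun setT u -> (forall x, `|u x| <= C * (1 + sqn x) `^ (- m)) ->
  lam.-integrable setT (EFin \o (fun x => sqn x `^ (- p) * u x)).
Proof.
move=> C0 mu0 hC.
apply: (@integrable_rV_powR_sqn _ _ p n%:R C) => //.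
- by rewrite ltrBlDr ltrDl.
- by rewrite ltr_pdivrMr// mulr_natr mulr2n ltrDl ltr0n.
- apply: measurable_funM mu0.
  by apply: (measurableT_comp (measurable_powR (- p))); exact: measurable_sqn.
- move=> x x1; rewrite normrM ger0_norm ?powR_ge0// mulrC ler_wpM2r ?powR_ge0//.
  apply: le_trans (hC x) _; rewrite ler_piMr// -[leRHS](powRr0 (1 + sqn x)).
  by rewrite ler_powR ?lerDl ?sqn_ge0// oppr_le0 ltW// (lt_trans _ m1).
- move=> x x1; have x0 : 0 < sqn x by rewrite (lt_le_trans _ x1).
  rewrite normrM ger0_norm ?powR_ge0//.
  rewrite (_ : sqn x `^ (- n%:R) = sqn x `^ (- p) * sqn x `^ (- m)); last first.
    by rewrite -powRD ?(gt_eqF x0) ?implybT//; congr (_ `^ _); field.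
  rewrite mulrCA ler_wpM2l ?powR_ge0//; apply: le_trans (hC x) _.
  rewrite ler_wpM2l// !powRN lef_pV2 ?posrE ?powR_gt0 ?ltr_pwDl ?sqn_ge0//.
  by rewrite ge0_ler_powR ?nnegrE ?(ltW m0) ?addr_ge0 ?sqn_ge0// lerDr.
Qed.

Lemma integrable_riesz_rlap : lam.-integrable setT
  (EFin \o (fun x => sqn x `^ (- p) * rlap m f x)).
Proof.
have [C C0 hC] := rlap_decay n2m m1n m1 rf.
apply: integrable_riesz_weight hC => //.
apply: continuous_measurable_rV.
exact: (rlap_smooth n2m m1n m1 rf [::]).1.
Qed.

Let G := Gamma p * Gamma m.

Let G_ge0 : 0 <= G. Proof. by rewrite mulr_ge0// ltW// Gamma_gt0. Qed.

Let D (w : rV * rV) : R := diff2 f w.1 w.2 * (G * (sqn w.1 `^ (- p) * rker m w.2)).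

Let mD : measurable_fun setT D.
Proof.
apply: measurable_funM => //; apply: measurable_funM => //; apply: measurable_funM.
  apply: (measurableT_comp (measurable_powR (- p))).
  by apply: (measurableT_comp (@measurable_sqn R n)).
by apply: (measurableT_comp (@measurable_rker R n m)).
Qed.

(** The integral over [y] is O((1+|x|^2)^(-m)), and this decay is what makes |x|^(-2p) integrable
    against it. *)
Let Dfin : (\int[lam]_x \int[lam]_y `|D (x, y)|%:E < +oo)%E.
Proof.
have [C C0 hC] := integral_diff2_decay n2m m1n m1 rf.
have u0 x : 0 <= (1 + sqn x : R) `^ (- m) by exact: powR_ge0.
have mu1 : measurable_fun setT (fun x : rV => (1 + sqn x : R) `^ (- m)).
  exact: measurable_powR_sqn.
have wle (x : rV) : `|(1 + sqn x) `^ (- m)| <= 1 * (1 + sqn x) `^ (- m).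
  by rewrite mul1r ger0_norm.
have uI := integrable_riesz_weight ler01 mu1 wle.
have := integrableZl measurableT (G * C) uI => /integrableP[_].
apply: le_lt_trans; apply: ge0_le_integral => //.
- by move=> x _; apply: integral_ge0 => y _; rewrite lee_fin.
- exact: measurable_tonelli_norm1.
- apply: measurableT_comp => //; apply: measurable_funeM.
  exact: measurable_int uI.
move=> x _.
rewrite [leRHS](_ : _ = ((G * sqn x `^ (- p)) * (C * (1 + sqn x) `^ (- m)))%:E)%E; last first.
  rewrite -[LHS]/(`|G * C * (sqn x `^ (- p) * (1 + sqn x) `^ (- m))|%:E).
  have h0 : 0 <= G * C * (sqn x `^ (- p) * (1 + sqn x) `^ (- m)).
    by apply: mulr_ge0; apply: mulr_ge0 => //; exact: powR_ge0.
  by rewrite ger0_norm// [in LHS]mulrACA.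
rewrite (_ : (\int[lam]_y _ = (G * sqn x `^ (- p))%:E *
    \int[lam]_y (`|diff2 f x y| * rker m y)%:E)%E); last first.
  rewrite -ge0_integralZl//; last 3 first.
  - apply/measurable_EFinP; apply: measurable_funM; last exact: measurable_rker.
    by apply: measurableT_comp => //; exact: measurable_diff2.
  - by move=> y _; rewrite lee_fin mulr_ge0 ?rker_ge0.
  - by rewrite lee_fin mulr_ge0 ?powR_ge0.
  apply: eq_integral => y _; rewrite -EFinM; congr EFin.
  have h0 : 0 <= G * (sqn x `^ (- p) * rker m y).
    by rewrite mulr_ge0// mulr_ge0 ?powR_ge0 ?rker_ge0.
  by rewrite normrM (ger0_norm h0) mulrCA mulrA [_ * rker _ _]mulrC; ring.
by rewrite [leRHS]EFinM; apply: lee_wpmul2l => //; rewrite lee_fin mulr_ge0 ?powR_ge0.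
Qed.


Let Phifin : (\int[lam2]_w \int[mu2]_t `|Phi (w, t)|%:E < +oo)%E.
Proof.
rewrite (_ : (\int[lam2]_w _)%E = (\int[lam2]_w `|D w|%:E)%E).
  rewrite (@tonelli_prod _ _ _ _ R lam lam (fun w => `|D w|))//.
  exact: measurableT_comp.
apply: eq_integral => w _.
have h0 : 0 <= G * (sqn w.1 `^ (- p) * rker m w.2).
  by rewrite mulr_ge0// mulr_ge0 ?powR_ge0 ?rker_ge0.
rewrite /D normrM (ger0_norm h0) -iW; apply: eq_integral => t _.
by rewrite /Phi normrM (ger0_norm (W_ge0 _ _)).
Qed.

Let lhsE : (\int[lam2]_w \int[mu2]_t (Phi (w, t))%:E =
  \int[lam]_x (G * (sqn x `^ (- p) * rlap m f x))%:E)%E.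
Proof.
transitivity (\int[lam2]_w (D w)%:E)%E.
  by apply: eq_integral => w _; rewrite /D -iW.
rewrite (fubini_real_prod mD Dfin); apply: eq_integral => x _.
transitivity (\int[lam]_y ((G * sqn x `^ (- p))%:E * (diff2 f x y * rker m y)%:E))%E.
  by apply: eq_integral => y _; rewrite -EFinM; congr EFin; rewrite /D/=; ring.
have iD := integrable_diff2 n2m m1n m1 x rf.
rewrite integralZl// -[X in (_ * X)%E]fineK; last exact: integrable_fin_num iD.
by rewrite -EFinM mulrA.
Qed.

Let f_bounded : exists C : R, forall x, `|f x| <= C.
Proof.
by have [C _ hC] := rschwartz_le 0 rf; exists C => x; have := hC x; rewrite expr0 divr1.
Qed.

Let Jint (e a b : R) : 0 < a -> 0 < b -> lam2.-integrable setT
  (EFin \o (fun w : rV * rV => f (w.1 + e *: w.2) * (gw a w.1 * gw b w.2))).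
Proof.
move=> a0 b0; have [C hC] := f_bounded.
have d0 : 0 < b + a * e ^+ 2 by rewrite ltr_pwDl// mulr_ge0 ?sqr_ge0// ltW.
have mg : measurable_fun setT (fun w : rV * rV => gw a w.1 * gw b w.2).
  apply: measurable_funM; first by apply: (measurableT_comp (@measurable_gw R n a)).
  by apply: (measurableT_comp (@measurable_gw R n b)).
apply/integrableP; split; first by apply/measurable_EFinP; exact: measurable_funM.
have mnf : measurable_fun setT (fun x => `|f x|) by exact: measurableT_comp.
have := gauss_convolution e a0 b0 mnf (fun z => _) => /(_ C) H.
rewrite (_ : (\int[lam2]_w _ = \int[lam2]_w (`|f (w.1 + e *: w.2)| * (gw a w.1 * gw b w.2))%:E)%E); last first.
  apply: eq_integral => w _; rewrite -[LHS]/((`|f (w.1 + e *: w.2) * (gw a w.1 * gw b w.2)|)%:E).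
  by rewrite normrM [X in _ * X]ger0_norm// mulr_ge0 ?gw_ge0.
rewrite H => [|z]; last by rewrite normr_id.
rewrite lte_mul_pinfty// ?lee_fin ?powR_ge0//.
by apply: (@gw_integrable_bounded _ _ _ C) => //; rewrite divr_gt0 ?mulr_gt0.
Qed.

Let Ray (c : R) : R := fine (\int[lam]_z (ray f z c * gw 1 z)%:E)%E.

Let mray (c : R) : measurable_fun setT (fun z : rV => ray f z c).
Proof.
have := measurableT_comp mf (@measurable_rV_affine R n 0 (isqrt c)).
by rewrite (_ : _ \o _ = (fun z : rV => ray f z c))//; apply/funext => w /=; rewrite add0r.
Qed.

Let Rayint (c : R) : lam.-integrable setT (EFin \o (fun z : rV => ray f z c * gw 1 z)).
Proof.
have [C hC] := f_bounded.
apply/integrableP; split.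
  by apply/measurable_EFinP; apply: measurable_funM => //; exact: measurable_gw.
rewrite (_ : (\int[lam]_w _ = \int[lam]_w (`|ray f w c| * gw 1 w)%:E)%E).
  exact: (@gw_integrable_bounded R n 1 C (fun z => ray f z c) ltr01 (mray c) (fun z => hC _)).
apply: eq_integral => w _; rewrite -[LHS]/((`|ray f w c * gw 1 w|)%:E).
by rewrite normrM [X in _ * X]ger0_norm// gw_ge0.
Qed.

Let RayE c : (\int[lam]_z (ray f z c * gw 1 z)%:E = (Ray c)%:E)%E.
Proof. by rewrite fineK//; exact: integrable_fin_num (Rayint c). Qed.

Let JE (e a b : R) : 0 < a -> 0 < b ->
  (\int[lam2]_w (f (w.1 + e *: w.2) * (gw a w.1 * gw b w.2))%:E =
   ((pi / (b + a * e ^+ 2)) `^ (n%:R / 2) *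
    ((a * b / (b + a * e ^+ 2)) `^ (- (n%:R / 2)) * Ray (a * b / (b + a * e ^+ 2))))%:E)%E.
Proof.
move=> a0 b0; have [C hC] := f_bounded.
have d0 : 0 < b + a * e ^+ 2 by rewrite ltr_pwDl// mulr_ge0 ?sqr_ge0// ltW.
rewrite (gauss_convolution e a0 b0 mf hC).
rewrite (@integral_gw_ray _ _ _ C)//; first by rewrite RayE -!EFinM.
by rewrite divr_gt0 ?mulr_gt0.
Qed.

(** The integrand left once [x] and [y] have been traded for [z], to be integrated over [z] and (a,
    b). The factor [chi] discards the null point z = 0, where the rays do not tend to 0. *)
Let Psi (zt : rV * (R * R)) : R := 2 * pi `^ (n%:R / 2) * (chi zt.1 * gw 1 zt.1) *
  (beta_weight s zt.2 * (ray f zt.1 zt.2.1 - ray f zt.1 (parallel zt.2))).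

(** Used with x = b + ae^2 and y = ab/(b + ae^2): the product xy = ab is the same for e = 0, 1, -1,
    so the three convolutions carry one common factor. *)
Let powR_balance (x y v : R) : 0 < x -> 0 < y ->
  (pi / x) `^ v * y `^ (- v) = pi `^ v * (x * y) `^ (- v).
Proof.
move=> x0 y0; rewrite powRM ?pi_ge0 ?invr_ge0 ?(ltW x0)// powRM ?(ltW x0) ?(ltW y0)//.
by rewrite -powR_inv1 ?(ltW x0)// -powRrM mulN1r mulrA.
Qed.

Let collect (k P Q A B : R) : k * (2 * (P * (Q * A)) - P * (Q * B) - P * (Q * B)) =
  2 * P * (k * Q) * (A - B).
Proof. by ring. Qed.

(** For fixed (a, b) everything converges absolutely, so the second difference may be split into its
    three convolutions. Those for e = 1 and e = -1 coincide, both with parameter [parallel (a, b)],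
    while e = 0 gives the parameter [a]. *)
Let Phi_Psi t : (\int[lam2]_w (Phi (w, t))%:E = \int[lam]_z (Psi (z, t))%:E)%E.
Proof.
case: t => a b.
have [a0|a0] := leP a 0.
  rewrite (_ : (fun w => _) = cst 0%E); last first.
    by apply/funext => w; rewrite /Phi/W/=/riesz_mix /hpow [0 < a]ltNge a0/= mul0r mulr0 mul0r mulr0.
  rewrite integral0 (_ : (fun w => _) = cst 0%E) ?integral0//.
  by apply/funext => w; rewrite /Psi/=/beta_weight/hpow/= ltNge a0 /= mul0r mul0r mulr0.
have [b0|b0] := leP b 0.
  rewrite (_ : (fun w => _) = cst 0%E); last first.
    by apply/funext => w; rewrite /Phi/W/=/riesz_mix /hpow [0 < b]ltNge b0/= mul0r !mulr0.
  rewrite integral0 (_ : (fun w => _) = cst 0%E) ?integral0//.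
  by apply/funext => w; rewrite /Psi/=/beta_weight/hpow/= [0 < b]ltNge b0 /= mulr0 mul0r mulr0.
have ab0 : 0 < a + b by rewrite addr_gt0.
pose k := hpow p a * hpow m b.
pose F (e : R) (w : rV * rV) := f (w.1 + e *: w.2) * (gw a w.1 * gw b w.2).
pose X (e : R) := pi `^ (n%:R / 2) * ((a * b) `^ (- (n%:R / 2)) * Ray (a * b / (b + a * e ^+ 2))).
have FX e : (\int[lam2]_w (F e w)%:E = (X e)%:E)%E.
  have d0 : 0 < b + a * e ^+ 2 by rewrite ltr_pwDl// mulr_ge0 ?sqr_ge0// ltW.
  rewrite JE// mulrA powR_balance ?divr_gt0 ?mulr_gt0// -mulrA.
  by rewrite [_ * (a * b / _)]mulrC divfK// gt_eqF.
have mF e : measurable_fun setT (F e).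
  by have /integrableP[/measurable_EFinP] := Jint e a0 b0.
have lE : (\int[lam2]_w (Phi (w, (a, b)))%:E = (k * (2 * X 0 - X 1 - X (- 1)))%:E)%E.
  transitivity (\int[lam2]_w (chi w.1 * chi w.2 * (k * (2 * F 0 w - F 1 w - F (-1) w)))%:E)%E.
    apply: eq_integral => w _; congr EFin.
    rewrite /Phi /W /= diff2E /F /riesz_mix /k scale0r addr0 /=; ring.
  rewrite (integral_chi2 n0 (g := fun w => k * (2 * F 0 w - F 1 w - F (-1) w))); last first.
    by apply: measurable_funM => //; apply: measurable_funB => //; apply: measurable_funB => //; apply: measurable_funM.
  have iF e : lam2.-integrable setT (fun w => (F e w)%:E) by exact: Jint.
  have i0 : lam2.-integrable setT (fun w => (2%:E * (F 0 w)%:E)%E) by exact: integrableZl.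
  have i1 : lam2.-integrable setT (fun w => (2%:E * (F 0 w)%:E - (F 1 w)%:E)%E) by exact: integrableB.
  have i2 : lam2.-integrable setT (fun w => (2%:E * (F 0 w)%:E - (F 1 w)%:E - (F (-1) w)%:E)%E).
    exact: integrableB.
  rewrite (_ : (\int[lam2]_w _ = \int[lam2]_w (k%:E * (2%:E * (F 0 w)%:E - (F 1 w)%:E - (F (-1) w)%:E)))%E)//.
  rewrite (integralZl measurableT i2) (integralB measurableT i1 (iF _)).
  by rewrite (integralB measurableT i0 (iF _)) (integralZl measurableT (iF _)) !FX.
have rE : (\int[lam]_z (Psi (z, (a, b)))%:E = (2 * pi `^ (n%:R / 2) * beta_weight s (a, b) *
     (Ray a - Ray (parallel (a, b))))%:E)%E.
  set K := 2 * _ * _.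
  transitivity (\int[lam]_z (chi z * (K * (ray f z a * gw 1 z - ray f z (parallel (a, b)) * gw 1 z)))%:E)%E.
    by apply: eq_integral => z _; congr EFin; rewrite /Psi /K /=; ring.
  have mg c : measurable_fun setT (fun z : rV => ray f z c * gw 1 z).
    by apply: measurable_funM => //; exact: measurable_gw.
  rewrite (integral_chi n0 (g := fun z => K * (ray f z a * gw 1 z - ray f z (parallel (a, b)) * gw 1 z))); last first.
    by apply: measurable_funM => //; exact: measurable_funB.
  have iR c : lam.-integrable setT (fun z => (ray f z c * gw 1 z)%:E) by exact: Rayint.
  have i1 : lam.-integrable setT (fun z =>
      ((ray f z a * gw 1 z)%:E - (ray f z (parallel (a, b)) * gw 1 z)%:E)%E) by exact: integrableB.
  rewrite (_ : (\int[lam]_w _ = \int[lam]_w (K%:E * ((ray f w a * gw 1 w)%:E - (ray f w (parallel (a, b)) * gw 1 w)%:E)))%E)//.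
  by rewrite (integralZl measurableT i1) (integralB measurableT (iR _) (iR _)) !RayE.
rewrite lE rE; congr EFin.
have c1 : a * b / (b + a * 1 ^+ 2) = parallel (a, b) by rewrite expr1n mulr1 addrC.
have c2 : a * b / (b + a * (-1) ^+ 2) = parallel (a, b) by rewrite sqrrN expr1n mulr1 addrC.
have c0 : a * b / (b + a * 0 ^+ 2) = a by rewrite expr0n mulr0 addr0 mulfK// gt_eqF.
rewrite /X c0 c1 c2.
(* The exponents combine as p - 1 - n/2 = -s - 1 and m - 1 - n/2 = s - 1. *)
suff -> : beta_weight s (a, b) = k * (a * b) `^ (- (n%:R / 2)) by exact: collect.
rewrite /beta_weight /k /hpow /= a0 b0 powRM ?(ltW a0) ?(ltW b0)// mulrACA.
rewrite -!powRD ?(gt_eqF a0) ?(gt_eqF b0) ?implybT//.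
by congr (_ `^ _ * _ `^ _); ring.
Qed.

Let mray2 : measurable_fun setT (fun z : rV * measurableTypeR R => ray f z.1 z.2).
Proof.
suff h : measurable_fun setT (fun z : rV * measurableTypeR R => isqrt z.2 *: z.1).
  exact: (measurableT_comp mf h).
apply: measurable_fun_rV_coordP => i.
rewrite (_ : _ \o _ = fun z : rV * measurableTypeR R => isqrt z.2 * rV_coord i z.1); last first.
  by apply/funext => z; rewrite /= /rV_coord !mxE.
apply: measurable_funM.
  by apply: (measurableT_comp measurable_isqrt).
by apply: (measurableT_comp (measurable_rV_coord i)).
Qed.

Let incr (z : rV) (t : R * R) := beta_weight s t * (ray f z t.1 - ray f z (parallel t)).

Let mincr : measurable_fun setT (fun zt : rV * RR => incr zt.1 zt.2).
Proof.
have h1 : measurable_fun setT (fun zt : rV * RR => (zt.1, zt.2.1)).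
  by apply: measurable_fun_pair => //; apply: measurableT_comp.
have h2 : measurable_fun setT (fun zt : rV * RR => (zt.1, parallel zt.2)).
  by apply: measurable_fun_pair => //; apply: (measurableT_comp measurable_parallel).
apply: measurable_funM.
  by apply: (measurableT_comp (@measurable_beta_weight R s)).
have g1 := measurableT_comp mray2 h1; have g2 := measurableT_comp mray2 h2.
exact: (measurable_funB g1 g2).
Qed.

Let mPsi : measurable_fun setT (Psi : rV * RR -> R).
Proof.
apply: measurable_funM mincr; apply: measurable_funM => //; apply: measurable_funM.
  by apply: (measurableT_comp (@measurable_chi R n)).
by apply: (measurableT_comp (@measurable_gw R n 1)).
Qed.

Let mray1 z : measurable_fun [set: measurableTypeR R] (ray f z).
Proof. exact: (measurableT_comp mray2 (measurable_pair1 z)). Qed.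

Let drayE (z : rV) (t : R) (t0 : 0 < t) := is_derive_ray z rf.1 t0.
Let cdray (z : rV) (t : R) (t0 : 0 < t) := @continuous_dray _ _ f z t rf.1 t0.

Let incr_abs_le : exists2 C : R, 0 <= C & forall z,
  (\int[mu2]_t `|incr z t|%:E <= C%:E)%E.
Proof.
have [C C0 hC] := integral_dray_le rf.
have K0 := beta_const_ge0 s0 s1.
exists (beta_const s * C) => [|z]; first exact: mulr_ge0.
rewrite EFinM; apply: (@le_trans _ _ ((beta_const s)%:E * \int[mu]_(r in `]0%R, +oo[) `|dray f z r|%:E)%E).
  have H := beta_increment_le s0 s1 (@drayE z) (mray1 z) (@cdray z).
  apply: (le_trans _ H).
  rewrite le_eqVlt; apply/orP; left; apply/eqP; apply: eq_integral => t _.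
  by rewrite /incr normrM (ger0_norm (beta_weight_ge0 _ _)).
by apply: lee_wpmul2l.
Qed.

Let incr_integrable z : mu2.-integrable setT (EFin \o incr z).
Proof.
have [C C0 hC] := incr_abs_le.
apply/integrableP; split.
  by apply/measurable_EFinP; exact: (measurableT_comp mincr (measurable_pair1 z)).
by apply: le_lt_trans (hC z) _; rewrite ltry.
Qed.

(** For z != 0 the ray goes from 0 to f(0). For z = 0 it is constant and its increments vanish,
    whence the hypothesis. *)
Let integral_incr z : z != 0 -> (\int[mu2]_t (incr z t)%:E = (beta_const s * f 0)%:E)%E.
Proof.
move=> z0; have [C C0 hC] := integral_dray_le rf.
have := beta_increment s0 s1 (@drayE z) (@cdray z) _ (ray_at_oo rf z0) (ray_at_0 z rf.1).
rewrite subr0; apply; apply/integrableP; split.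
  apply/measurable_EFinP; apply: open_continuous_measurable_fun => //.
  by move=> t; rewrite inE/= in_itv/= andbT; exact: cdray.
by apply: le_lt_trans (hC z) _; rewrite ltry.
Qed.

Let c0 : R := 2 * pi `^ (n%:R / 2).

Let c0_ge0 : 0 <= c0. Proof. by rewrite mulr_ge0// powR_ge0. Qed.

Let Psi_incr z t : (Psi (z, t))%:E = ((c0 * (chi z * gw 1 z))%:E * (incr z t)%:E)%E.
Proof. by rewrite -EFinM. Qed.

Let gw_lty : (\int[lam]_z (gw 1 z)%:E = (pi `^ (n%:R / 2))%:E)%E.
Proof. by rewrite gauss_rV// divr1. Qed.

Let Psifin : (\int[lam]_z \int[mu2]_t `|Psi (z, t)|%:E < +oo)%E.
Proof.
have [C C0 hC] := incr_abs_le.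
have mg : measurable_fun setT (fun z : rV => (gw 1 z)%:E).
  by apply/measurable_EFinP; exact: measurable_gw.
apply: (@le_lt_trans _ _ (\int[lam]_z ((c0 * C)%:E * (gw 1 z)%:E))%E).
  apply: ge0_le_integral => //.
  - by move=> z _; apply: integral_ge0 => t _; rewrite lee_fin.
  - exact: (measurable_tonelli_norm1 mu2 mPsi).
  - exact: measurable_funeM.
  move=> z _; rewrite (_ : (\int[mu2]_t _)%E =
      ((c0 * (chi z * gw 1 z))%:E * \int[mu2]_t `|incr z t|%:E)%E).
    rewrite [leRHS](_ : _ = (c0 * gw 1 z)%:E * C%:E)%E; last first.
      by rewrite -!EFinM mulrAC.
    apply: lee_pmul => //.
    + by rewrite lee_fin mulr_ge0// mulr_ge0 ?chi_ge0 ?gw_ge0.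
    + by apply: integral_ge0 => t _; rewrite lee_fin.
    + rewrite lee_fin ler_wpM2l// ler_piMl ?gw_ge0// /chi.
      by case: (_ != _).
  rewrite -ge0_integralZl//; last 2 first.
  - apply/measurable_EFinP; apply: measurableT_comp => //.
    exact: (measurableT_comp mincr (measurable_pair1 z)).
  - by rewrite lee_fin mulr_ge0// mulr_ge0 ?chi_ge0 ?gw_ge0.
  apply: eq_integral => t _; rewrite -EFinM; congr EFin.
  rewrite -[Psi _]/(c0 * (chi z * gw 1 z) * incr z t) normrM.
  by rewrite [X in X * _]ger0_norm// mulr_ge0// mulr_ge0 ?chi_ge0 ?gw_ge0.
rewrite ge0_integralZl//; last 2 first.
- by move=> z _; rewrite lee_fin gw_ge0.
- by rewrite lee_fin mulr_ge0.
by rewrite gw_lty -EFinM ltry.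
Qed.

Let rhsE : (\int[lam]_z \int[mu2]_t (Psi (z, t))%:E =
  (c0 * pi `^ (n%:R / 2) * (beta_const s * f 0))%:E)%E.
Proof.
have mg : measurable_fun setT (fun z : rV => (gw 1 z)%:E).
  by apply/measurable_EFinP; exact: measurable_gw.
transitivity (\int[lam]_z (chi z * (c0 * (beta_const s * f 0) * gw 1 z))%:E)%E.
  apply: eq_integral => z _; under eq_integral do rewrite Psi_incr.
  rewrite (integralZl measurableT (incr_integrable z)).
  have [->|z0] := eqVneq z 0.
    by rewrite /chi eqxx !(mul0r, mulr0) mul0e.
  by rewrite [X in (_ * X)%E]integral_incr// -EFinM; congr EFin; ring.
rewrite (integral_chi n0 (g := fun z => c0 * (beta_const s * f 0) * gw 1 z)); last first.
  by apply: measurable_funM => //; exact: measurable_gw.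
under eq_integral do rewrite EFinM.
rewrite integralZl//; first by rewrite gw_lty -EFinM mulrAC.
apply/integrableP; split => //.
by under eq_integral do rewrite /= ger0_norm ?gw_ge0//; rewrite gw_lty ltry.
Qed.

(** [Phi] and [Psi] are each integrated in both orders, and meet in their integrals for fixed (a,
    b). Of pi^n, one factor pi^(n/2) comes from the convolutions and the other is the mass of the
    Gaussian in [z]. *)
Lemma riesz_rlap : \int[lam]_x (sqn x `^ (- p) * rlap m f x) =
  2 * pi `^ n%:R * beta_const s / (Gamma p * Gamma m) * f 0.
Proof.
have G0 : G != 0 by rewrite mulf_neq0// gt_eqF// Gamma_gt0.
have := lhsE.
rewrite (@fubini_real _ _ (rV * rV)%type RR R lam2 mu2 Phi mPhi Phifin).
under eq_integral do rewrite Phi_Psi.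
rewrite -(fubini_real (m1 := lam) (m2 := mu2) mPsi Psifin) rhsE.
under eq_integral do rewrite EFinM.
rewrite (integralZl measurableT integrable_riesz_rlap).
rewrite -[X in (_ * X)%E]fineK; last exact: integrable_fin_num integrable_riesz_rlap.
rewrite -EFinM => -[E]; rewrite -[LHS]/(fine _).
apply: (mulfI G0); rewrite -[LHS]E /c0.
have -> : pi `^ n%:R = pi `^ (n%:R / 2) * pi `^ (n%:R / 2) :> R.
  have pn : ((pi : R) == 0) = false by rewrite gt_eqF// pi_gt0.
  by rewrite -powRD ?pn ?implybT//; congr (_ `^ _); field.
move: G0; rewrite -/G; generalize G (pi `^ (n%:R / 2) : R) (beta_const s) (f 0) => g P b y G0.
by field.
Qed.

End riesz_identity.

(** * The distribution induced by E_s *)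

Section complex_parts.
Context {R : realType} {n : nat} (s : R).
Hypotheses (hn : (2 <= n)%N) (s0 : 0 < s) (s1 : s < 1).
Local Notation rV := 'rV[R]_n.
Local Notation lam := (lebesgue_rV R n).
Local Notation p := (n%:R / 2 - s).
Local Notation m := (n%:R / 2 + s).
Local Open Scope complex_scope.
Import ComplexField.

(** The dimension hypothesis in the form that, with 0 < s < 1, gives both s < n/2 and m > 1. *)
Let n2 : 1 <= n%:R / 2 :> R.
Proof. by rewrite ler_pdivlMr// mul1r ler_nat. Qed.
Let n0 : (0 < n)%N. Proof. exact: leq_trans hn. Qed.
Let sn : s < n%:R / 2. Proof. exact: lt_le_trans n2. Qed.
Let n2m : n%:R / 2 < m. Proof. by rewrite ltrDl. Qed.
Let m1n : m - 1 < n%:R / 2. Proof. by rewrite ltrBlDr ltrD2l. Qed.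
Let m1 : 1 < m. Proof. by rewrite (le_lt_trans n2). Qed.
Let m0 : 0 < m. Proof. by rewrite (lt_trans _ m1). Qed.
Let p0 : 0 < p. Proof. by rewrite subr_gt0. Qed.

(** This is the total mass of the exponential law of parameter 1, whose density differs from the
    integrand only at 0. *)
Lemma Gamma1 : Gamma (1 : R) = 1.
Proof.
have g1 : 0 < (1 : R) by [].
apply: EFin_inj; rewrite -(Gamma_integral g1) -[RHS](integral_exponential_pdf g1).
apply: ae_eq_integral => //.
- exact: measurable_hpow_expRN.
- by apply/measurable_EFinP; exact: measurable_exponential_pdf.
exists [set (0:R)]; split => //; first exact: lebesgue_measure_set1.
move=> t /= nt; apply/eqP; apply: contra_notT nt => t0 _.
have [tn|tp|tE] := ltgtP t 0; last by rewrite tE eqxx in t0.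
- by rewrite lt0_exponential_pdf// /hpow ltNge (ltW tn) mul0r.
- by rewrite exponential_pdfE ?(ltW tp)// /hpow tp subrr powRr0 !mul1r mulN1r.
Qed.

Lemma enorm_powR (x : rV) (r : R) : enorm x `^ r = sqn x `^ (r / 2).
Proof. by rewrite /enorm -powR12_sqrt ?sqn_ge0// -powRrM mulrC. Qed.

Lemma enorm_kernel (x : rV) : enorm x `^ (n%:R + 2 * s) = sqn x `^ m.
Proof. by rewrite enorm_powR; congr (_ `^ _); field. Qed.

Lemma E_sE (x : rV) : E_s s x = @alpha_ns R n s * sqn x `^ (- p).
Proof. by rewrite /E_s enorm_powR; congr (_ * _ `^ _); field. Qed.

Lemma normc_le_ReIm (z : R[i]) : Normc.normc z <= `|complex.Re z| + `|complex.Im z|.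
Proof.
case: z => a b /=; rewrite -[leRHS]ger0_norm ?addr_ge0// -sqrtr_sqr ler_wsqrtr//.
rewrite sqrrD -!normrX !(ger0_norm (sqr_ge0 _)) addrAC lerDl.
by rewrite mulrn_wge0// mulr_ge0.
Qed.

Lemma Re_le_normc (z : R[i]) : `|complex.Re z| <= Normc.normc z.
Proof. by case: z => a b /=; rewrite -sqrtr_sqr ler_wsqrtr// lerDl sqr_ge0. Qed.

Lemma Im_le_normc (z : R[i]) : `|complex.Im z| <= Normc.normc z.
Proof. by case: z => a b /=; rewrite -sqrtr_sqr ler_wsqrtr// lerDr sqr_ge0. Qed.

Lemma Re_mulC (r : R) (z : R[i]) : complex.Re (r%:C * z) = r * complex.Re z.
Proof. by case: z => a b /=; rewrite mul0r subr0. Qed.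

Lemma Im_mulC (r : R) (z : R[i]) : complex.Im (r%:C * z) = r * complex.Im z.
Proof. by case: z => a b /=; rewrite mul0r addr0. Qed.

Lemma fracLapE (phi : rV -> R[i]) (x : rV) : fracLap s phi x =
  (@gamma_ns R n s / 2)%:C * (rlap m (fun x => complex.Re (phi x)) x +i*
    rlap m (fun x => complex.Im (phi x)) x).
Proof.
rewrite /fracLap /cintegral; congr (_ * (_ +i* _)); apply: eq_Rintegral => y _.
- rewrite -fmorphV mulrC Re_mulC enorm_kernel mulrC /rker powRN; congr (_ * _).
  rewrite /diff2; case: (phi x) (phi (x + y)) (phi (x - y)) => [a b] [c d] [e f] /=.
  by ring.
- rewrite -fmorphV mulrC Im_mulC enorm_kernel mulrC /rker powRN; congr (_ * _).
  rewrite /diff2; case: (phi x) (phi (x + y)) (phi (x - y)) => [a b] [c d] [e f] /=.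
  by ring.
Qed.

(** Puts scaling in the shape k f + g of [smooth_lin] and [partials_lin], with [f] itself as [g]. *)
Lemma scale_as_lin (f : rV -> R) (c : R) : (fun x => c * f x) = (fun x => (c - 1) * f x + f x).
Proof. by apply/funext => x; rewrite mulrBl mul1r subrK. Qed.

Lemma smoothZ (f : rV -> R) (c : R) : smooth f -> smooth (fun x => c * f x).
Proof. by move=> sf; rewrite scale_as_lin; exact: smooth_lin. Qed.

Lemma partialsZ (f : rV -> R) (c : R) l : smooth f ->
  partials l (fun x => c * f x) = (fun x => c * partials l f x).
Proof. by move=> sf; rewrite scale_as_lin partials_lin// [RHS]scale_as_lin. Qed.

(** With [Ss_weight_ge], shows that the weight 1 + |x|^(n+2s) of S_s is equivalent to (1+|x|^2)^m,
    the form in which decay has been proved. *)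
Lemma Ss_weight_le (x : rV) : 1 + sqn x `^ m <= 2 * (1 + sqn x) `^ m.
Proof.
rewrite (_ : 2 * _ = (1 + sqn x) `^ m + (1 + sqn x) `^ m); last by ring.
apply: lerD.
  by rewrite -[leLHS](powRr0 (1 + sqn x)) ler_powR ?lerDl ?sqn_ge0 ?(ltW m0).
by rewrite ge0_ler_powR ?nnegrE ?(ltW m0) ?addr_ge0 ?sqn_ge0// lerDr.
Qed.

Lemma Ss_weight_ge (x : rV) : (1 + sqn x) `^ m <= 2 `^ m * (1 + sqn x `^ m).
Proof.
have q0 := sqn_ge0 x.
have h (t : R) : 0 <= t -> 1 + sqn x <= 2 * t -> (1 + sqn x) `^ m <= 2 `^ m * t `^ m.
  move=> t0 xt; rewrite -powRM//.
  by rewrite ge0_ler_powR ?nnegrE ?(ltW m0) ?addr_ge0// mulr_ge0.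
have [x1|x1] := leP (sqn x) 1.
  apply: le_trans (h 1 ler01 _) _; first by lra.
  by rewrite powR1 ler_wpM2l ?powR_ge0// lerDl powR_ge0.
rewrite (le_trans (h (sqn x) q0 _))//; first by lra.
by rewrite ler_wpM2l ?powR_ge0// lerDr.
Qed.

(** Derivatives commute with [rlap], so each derivative of the fractional Laplacian is again the
    fractional Laplacian of Schwartz data, and the decay (1+|x|^2)^(-m) matches the weight of
    S_s. *)
Lemma fracLap_Ss (phi : rV -> R[i]) : schwartz phi ->
  (fracLap s phi : rV -> R[i]^o) \in Ss_pred s.
Proof.
move=> sphi; have rr := schwartz_Re sphi; have ri := schwartz_Im sphi.
have [c cE] : exists c : R, c = @gamma_ns R n s / 2 by eexists.
have reE : (fun x => complex.Re (fracLap s phi x)) =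
    (fun x => c * rlap m (fun x => complex.Re (phi x)) x).
  by apply/funext => x; rewrite fracLapE Re_mulC cE.
have imE : (fun x => complex.Im (fracLap s phi x)) =
    (fun x => c * rlap m (fun x => complex.Im (phi x)) x).
  by apply/funext => x; rewrite fracLapE Im_mulC cE.
have sr := rlap_smooth n2m m1n m1 rr; have si := rlap_smooth n2m m1n m1 ri.
apply/asboolP; split; first by split; rewrite ?reE ?imE; exact: smoothZ.
move=> a; have [l lE] : exists l, forall f : rV -> R, mpartial a f = partials l f by eexists.
have [A A0 hA] := rlap_decay n2m m1n m1 (rschwartz_partials l rr).
have [B B0 hB] := rlap_decay n2m m1n m1 (rschwartz_partials l ri).
exists (2 * (`|c| * (A + B))) => _ [x _ <-].
rewrite /Ss_weight enorm_kernel.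
have w0 : 0 < (1 + sqn x) `^ m by rewrite powR_gt0// ltr_pwDl ?sqn_ge0.
apply: (@le_trans _ _ (2 * (1 + sqn x) `^ m * (`|c| * (A + B) * (1 + sqn x) `^ (- m)))).
  apply: ler_pM; rewrite ?addr_ge0 ?powR_ge0 ?Ss_weight_le//.
    by case: (cmpartial _ _ _) => ? ?; exact: sqrtr_ge0.
  apply: le_trans (normc_le_ReIm _) _; rewrite /cmpartial /= reE imE !lE.
  rewrite !partialsZ// !(partials_rlap n2m m1n m1)// !normrM -mulrDr -mulrA.
  by rewrite ler_wpM2l// mulrDl; apply: lerD; [exact: hA|exact: hB].
rewrite powRN; move: w0; generalize ((1 + sqn x) `^ m) (`|c| * (A + B)) => w K w0.
by rewrite -mulrA [w * _]mulrC mulfVK ?gt_eqF.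
Qed.

Lemma mpartial0 (f : rV -> R) : mpartial [ffun=> 0%N] f = f.
Proof.
rewrite /mpartial (_ : flatten _ = [::])//.
by elim: (enum _) => //= i l ->; rewrite ffunE.
Qed.

Local Notation a0 := ([ffun=> 0%N] : multiindex n).

Lemma Ss_decay (u : Ss n s) x :
  Normc.normc (u x) <= 2 `^ m * Ss_seminorm s a0 u * (1 + sqn x) `^ (- m).
Proof.
have [su bu] : csmooth u /\ forall a, has_ubound (range (Ss_weight s a u)).
  by case: u => u /= /asboolP.
have h : Ss_weight s a0 u x <= Ss_seminorm s a0 u by apply: ub_le_sup => //; exists x.
have w0 : 0 < (1 + sqn x) `^ m by rewrite powR_gt0// ltr_pwDl ?sqn_ge0.
rewrite powRN ler_pdivlMr// mulrC.
have c0 : 0 <= Normc.normc (u x) by case: (u x) => ? ?; exact: sqrtr_ge0.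
apply: le_trans (ler_wpM2r c0 (Ss_weight_ge x)) _.
rewrite -mulrA ler_wpM2l ?powR_ge0//; apply: le_trans h.
rewrite /Ss_weight /cmpartial !mpartial0 enorm_kernel.
by case: (u x).
Qed.

Lemma Ss_measurable (u : Ss n s) :
  measurable_fun setT (fun x => complex.Re (u x)) /\
  measurable_fun setT (fun x => complex.Im (u x)).
Proof.
have [[sr si] _] : csmooth u /\ forall a, has_ubound (range (Ss_weight s a u)).
  by case: u => u /= /asboolP.
by split; apply: continuous_measurable_rV; [exact: (sr [::]).1|exact: (si [::]).1].
Qed.

Lemma Ss_seminorm_ge0 (u : Ss n s) : 0 <= Ss_seminorm s a0 u.
Proof.
have /asboolP[_ bu] : (u : rV -> R[i]^o) \in Ss_pred s by case: u.
apply: (@le_trans _ _ (Ss_weight s a0 u 0)); last by apply: ub_le_sup => //; exists 0.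
rewrite mulr_ge0 ?addr_ge0 ?powR_ge0//.
by case: (cmpartial _ _ _) => ? ?; exact: sqrtr_ge0.
Qed.

Lemma Ss_cintegrable (u : Ss n s) : cintegrable (fun x => (E_s s x)%:C * u x).
Proof.
have [mr mi] := Ss_measurable u.
have key (f : rV -> R) : measurable_fun setT f ->
    (forall x, `|f x| <= Normc.normc (u x)) ->
    lam.-integrable setT (fun x => (E_s s x * f x)%:E).
  move=> mf hf; have := integrable_riesz_weight s0 sn m1 n0 _ mf (fun x => le_trans (hf x) (Ss_decay u x)).
  rewrite mulr_ge0 ?powR_ge0 ?Ss_seminorm_ge0// => /(_ isT) h.
  rewrite (_ : (fun _ => _) = (fun x => (@alpha_ns R n s)%:E * (sqn x `^ (- p) * f x)%R%:E)%E).
    exact: integrableZl.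
  by apply/funext => x; rewrite E_sE -mulrA.
split.
- under eq_fun do rewrite Re_mulC; apply: key => // x; exact: Re_le_normc.
- under eq_fun do rewrite Im_mulC; apply: key => // x; exact: Im_le_normc.
Qed.

Lemma cintegral_lin (k : R[i]) (u v : rV -> R[i]) : cintegrable u -> cintegrable v ->
  cintegral (fun x => k * u x + v x) = k * cintegral u + cintegral v.
Proof.
have lin (a b : R) (f g h : rV -> R) : lam.-integrable setT (fun x => (f x)%:E) ->
    lam.-integrable setT (fun x => (g x)%:E) -> lam.-integrable setT (fun x => (h x)%:E) ->
    \int[lam]_x (a * f x + b * g x + h x) =
    a * (\int[lam]_x f x) + b * (\int[lam]_x g x) + \int[lam]_x h x.
  move=> fi gi hi.
  have afi : lam.-integrable setT (EFin \o (fun x => a * f x)).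
    exact: (integrableZl measurableT a fi).
  have bgi : lam.-integrable setT (EFin \o (fun x => b * g x)).
    exact: (integrableZl measurableT b gi).
  rewrite RintegralD//; last exact: (integrableD measurableT afi bgi).
  by rewrite RintegralD// !RintegralZl.
move=> [ur ui] [vr vi]; rewrite /cintegral; case: k => a b.
apply/eqP; rewrite eq_complex /=; apply/andP; split; apply/eqP.
- rewrite -mulNr -lin//; apply: eq_Rintegral => x _.
  by case: (u x) (v x) => [c d] [e f] /=; rewrite mulNr.
- rewrite [a * _ + b * _]addrC -lin//; apply: eq_Rintegral => x _.
  by case: (u x) (v x) => [c d] [e f] /=; rewrite [b * c + _]addrC.
Qed.

Definition riesz_functional (u : Ss n s) : R[i] := cintegral (fun x => (E_s s x)%:C * u x).

Lemma riesz_functional_lin (k : R[i]) (u v : Ss n s) :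
  riesz_functional (k *: u + v) = k * riesz_functional u + riesz_functional v.
Proof.
rewrite -cintegral_lin; try exact: Ss_cintegrable.
rewrite /riesz_functional; congr cintegral; apply/funext => x.
transitivity ((E_s s x)%:C * (k * u x + v x)) => //.
by rewrite mulrDr mulrCA.
Qed.

(** The seminorm without derivatives suffices, because it already bounds |u| by a multiple of
    (1+|x|^2)^(-m). The factor 2 counts the real and the imaginary part. *)
Lemma riesz_functional_le : exists2 M : R, 0 <= M & forall u : Ss n s,
  Normc.normc (riesz_functional u) <= M * Ss_seminorm s a0 u.
Proof.
have mu1 : measurable_fun setT (fun x : rV => (1 + sqn x : R) `^ (- m)).
  exact: measurable_powR_sqn.
have wle (x : rV) : `|(1 + sqn x) `^ (- m)| <= 1 * (1 + sqn x) `^ (- m).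
  by rewrite mul1r ger0_norm ?powR_ge0.
have wI := integrable_riesz_weight s0 sn m1 n0 ler01 mu1 wle.
pose W := \int[lam]_x (sqn x `^ (- p) * (1 + sqn x) `^ (- m)).
have W0 : 0 <= W by apply: Rintegral_ge0 => x _; rewrite mulr_ge0 ?powR_ge0.
pose K : R := `|@alpha_ns R n s| * 2 `^ m.
exists (2 * (K * W)) => [|u]; first by rewrite !mulr_ge0 ?powR_ge0.
have S0 := Ss_seminorm_ge0 u.
have key (f : rV -> R) : lam.-integrable setT (fun x => (E_s s x * f x)%:E) ->
    (forall x, `|f x| <= Normc.normc (u x)) ->
    `|\int[lam]_x (E_s s x * f x)| <= K * W * Ss_seminorm s a0 u.
  move=> fi hf; apply: le_trans (le_normr_Rintegral _ _) _ => //.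
  rewrite (_ : K * W * _ = \int[lam]_x (K * Ss_seminorm s a0 u * (sqn x `^ (- p) * (1 + sqn x) `^ (- m)))); last first.
    by rewrite RintegralZl// mulrAC.
  apply: le_Rintegral => //.
  - exact: (integrable_norm fi).
  - exact: (integrableZl measurableT (K * Ss_seminorm s a0 u) wI).
  move=> x _; rewrite E_sE normrM [X in X * _]normrM (ger0_norm (powR_ge0 _ _)).
  rewrite (_ : K * _ * _ = `|@alpha_ns R n s| * sqn x `^ (- p) *
    (2 `^ m * Ss_seminorm s a0 u * (1 + sqn x) `^ (- m))); last by rewrite /K; ring.
  by rewrite ler_wpM2l ?mulr_ge0 ?powR_ge0// (le_trans (hf x))// Ss_decay.
have [ir ii] := Ss_cintegrable u.
apply: le_trans (normc_le_ReIm _) _; rewrite (_ : 2 * _ * _ =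
  K * W * Ss_seminorm s a0 u + K * W * Ss_seminorm s a0 u); last by ring.
apply: lerD => /=.
- under eq_Rintegral do rewrite Re_mulC; apply: key; last by move=> x; exact: Re_le_normc.
  by under eq_fun do rewrite -Re_mulC.
- under eq_Rintegral do rewrite Im_mulC; apply: key; last by move=> x; exact: Im_le_normc.
  by under eq_fun do rewrite -Im_mulC.
Qed.

(** The ball belongs to the subbase and so is open; the second hypothesis places its centre inside
    it. *)
Lemma Ss_ball_nbhs (u : Ss n s) (a : multiindex n) (e : R) : 0 < e ->
  Ss_seminorm s a (u - u) < e -> nbhs u [set v : Ss n s | Ss_seminorm s a (v - u) < e].
Proof.
move=> e0 ue; apply: open_nbhs_nbhs; split => //.
exists [set [set v : Ss n s | Ss_seminorm s a (v - u) < e]]; last by rewrite bigcup_set1.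
by move=> _ ->; apply: finI_from1; exists a, u, e.
Qed.

Lemma riesz_functional_continuous : continuous (riesz_functional : Ss n s -> R[i]^o).
Proof.
have [M M0 hM] := riesz_functional_le.
move=> u.
apply: (@cvgrPdist_lt _ R[i]^o _ (nbhs u) (nbhs_filter u) riesz_functional (riesz_functional u)).2 => e e0.
(* Positivity in [R[i]] forces the imaginary part of [e] to vanish. *)
have [d d0 ed] : exists2 d : R, 0 < d & e = d%:C.
  case: e e0 => d d'; rewrite ltcE /= => /andP[/eqP -> d0].
  by exists d.
(* [M] may be 0, hence the division by [M + 1]. *)
have d1 : 0 < d / (M + 1) by rewrite divr_gt0// ltr_wpDl.
have S0 : Ss_seminorm s a0 (u - u) < d / (M + 1).
  apply: le_lt_trans d1; rewrite subrr; apply: ge_sup.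
    by exists (Ss_weight s a0 (0 : Ss n s) 0), 0.
  move=> _ [x _ <-]; rewrite /Ss_weight /cmpartial !mpartial0/=.
  by rewrite expr0n addr0 sqrtr0 mulr0.
apply: filterS (Ss_ball_nbhs d1 S0) => v vu.
have -> : riesz_functional u - riesz_functional v = - riesz_functional (v - u).
  rewrite (_ : v - u = (-1) *: u + v); last by rewrite scaleN1r addrC.
  by rewrite riesz_functional_lin mulN1r opprD opprK.
rewrite normrN normc_def ed ltcR.
apply: (@le_lt_trans _ _ (Normc.normc (riesz_functional (v - u)))).
  by case: (riesz_functional _).
apply: le_lt_trans (hM _) _; apply: (@le_lt_trans _ _ (M * (d / (M + 1)))).
  exact: (ler_wpM2l M0 (ltW vu)).
by rewrite mulrCA gtr_pMr// ltr_pdivrMr ?ltr_wpDl// mul1r ltrDl.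
Qed.

HB.instance Definition _ := GRing.isLinear.Build R[i] (Ss n s) R[i]^o _
  riesz_functional riesz_functional_lin.

Definition riesz_distribution : Ss_dual n s :=
  MkSs_dual (Ss_dual_fun := riesz_functional : {scalar Ss n s}) riesz_functional_continuous.

(** The normalising constants multiply to s Gamma(p) Gamma(m) / (2 pi^n Gamma(s) Gamma(1-s)), the
    inverse of the constant in [riesz_rlap] once Gamma(1) = 1 is known. *)
Lemma cintegral_fracLap (phi : rV -> R[i]) : schwartz phi ->
  cintegral (fun x => (E_s s x)%:C * fracLap s phi x) = phi 0.
Proof.
move=> sphi.
have key (f : rV -> R) : rschwartz f ->
    \int[lam]_x (E_s s x * (@gamma_ns R n s / 2 * rlap m f x)) = f 0.
  move=> rf; have I := integrable_riesz_rlap s0 sn n2m m1n m1 n0 rf.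
  rewrite (_ : (fun x => E_s s x * _) = (fun x => (@alpha_ns R n s * (@gamma_ns R n s / 2)) *
      (sqn x `^ (- p) * rlap m f x))); last first.
    by apply/funext => x; rewrite E_sE mulrACA.
  rewrite RintegralZl// (riesz_rlap s0 s1 sn n2m m1n m1 n0 rf).
  rewrite /alpha_ns /gamma_ns /beta_const Gamma1.
  rewrite (_ : (n%:R + 2 * s) / 2 = m); last by field.
  have : Gamma p != 0 by rewrite gt_eqF// Gamma_gt0.
  have : Gamma m != 0 by rewrite gt_eqF// Gamma_gt0.
  have : Gamma s != 0 by rewrite gt_eqF// Gamma_gt0.
  have : Gamma (1 - s) != 0 by rewrite gt_eqF// Gamma_gt0// subr_gt0.
  have pp : pi `^ n%:R = pi `^ (n%:R / 2) * pi `^ (n%:R / 2) :> R.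
    have pn : ((pi : R) == 0) = false by rewrite gt_eqF// pi_gt0.
    by rewrite -powRD ?pn ?implybT//; congr (_ `^ _); field.
  have : pi `^ (n%:R / 2) != 0 :> R by rewrite gt_eqF// powR_gt0// pi_gt0.
  have : 2 `^ (2 * s) != 0 :> R by rewrite gt_eqF// powR_gt0.
  rewrite pp; generalize (2 `^ (2 * s) : R) (pi `^ (n%:R / 2) : R).
  generalize (Gamma (1 - s)) (Gamma s) (Gamma m) (Gamma p) (f 0) => A B C D y.
  move=> P Q P0 Q0 A0 B0 C0 D0; have s00 : s != 0 by rewrite gt_eqF.
  field; rewrite ?A0 ?B0 ?C0 ?D0 ?P0 ?Q0 ?s00//.
have rr := schwartz_Re sphi; have ri := schwartz_Im sphi.
transitivity (complex.Re (phi 0) +i* complex.Im (phi 0)); last by case: (phi 0).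
rewrite /cintegral; congr (_ +i* _).
- by rewrite -[RHS](key _ rr); apply: eq_Rintegral => x _; rewrite Re_mulC fracLapE Re_mulC.
- by rewrite -[RHS](key _ ri); apply: eq_Rintegral => x _; rewrite Im_mulC fracLapE Im_mulC.
Qed.

End complex_parts.

Local Open Scope complex_scope.

Unset Implicit Arguments.

Theorem theorem8p4 (R : realType) (n : nat) (s : R)
    (hn : (2 <= n)%N) (hs0 : 0 < s) (hs1 : s < 1) :
  exists E : Ss_dual n s,
    induced_by (E_s s) E /\
    fundamental_solution E /\
    forall phi : 'rV[R]_n -> R[i], schwartz phi ->
      exists u : Ss n s,
        (u : 'rV[R]_n -> R[i]) = fracLap s phi /\
        E u = cintegral (fun x => (E_s s x)%:C * fracLap s phi x) /\
        cintegral (fun x => (E_s s x)%:C * fracLap s phi x) = phi 0.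
Proof.
have H (phi : 'rV[R]_n -> R[i]) : schwartz phi ->
    exists u : Ss n s, (u : 'rV[R]_n -> R[i]) = fracLap s phi /\
      riesz_distribution hn hs0 hs1 u = cintegral (fun x => (E_s s x)%:C * fracLap s phi x).
  by move=> sphi; exists (MkSs (fracLap_Ss hn hs0 hs1 sphi)).
exists (riesz_distribution hn hs0 hs1); split.
  by move=> u; split; first exact: Ss_cintegrable.
split=> phi sphi; have [u [uE Eu]] := H phi sphi; exists u; split => //.
  by rewrite Eu cintegral_fracLap.
by split => //; exact: cintegral_fracLap.
Qed.
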